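(* Let $1\le L\le N$ be integers and let $D_N=\mathrm{diag}(d_1,\ldots,d_N)$ be an $N\times N$ diagonal matrix of rank $N$ with $d_1,\ldots,d_N>0$. Put $d_{\min}=\min_i d_i$ and $d_{\max}=\max_i d_i$. Then for any continuous (complex or real valued) function $f\in C[d_{\min},d_{\max}]$, $$\int_{\Omega_{L,N}}\mathrm{Tr}\big(f(\Phi^{*}D_N\Phi)\big)\,d\phi=\sum_{k=0}^{L-1}\frac{(N-(k+1))!}{(L-(k+1))!}\cdot\frac{\det(G_k)}{\det(\Delta(D_N))},$$ where $\Delta(D_N)$ is the Vandermonde matrix associated to $D_N$ (the $N\times N$ matrix whose $(j,i)$ entry is $d_i^{N-j}$), and $G_k$ is the matrix defined by replacing the $(k+1)$-th row $\{d_i^{N-(k+1)}\}_{i=1}^{N}$ of $\Delta(D_N)$ by the row $$\Big\{I^{(N-L)}\big(x^{L-(k+1)}f(x)\big)\big|_{x=d_i}\Big\}_{i=1}^{N}.$$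
   Context: $\Omega_{L,N}=\{\Phi\in\mathbb{C}^{N\times L}:\Phi^{*}\Phi=I_L\}$ is the Stiefel manifold, and $d\phi$ is the isotropic (Haar) probability measure on it, i.e. the probability measure invariant under left multiplication by $N\times N$ unitary matrices. $A^*$ is the conjugate transpose, $\mathrm{Tr}$ is the non-normalized trace, and $f(A)$ for a normal matrix $A$ is defined by functional calculus. For each integer $p\ge 0$, $I^{(p)}$ is the operator defined on $x^n$ by $I^{(p)}(x^{n})=\frac{x^{n+p}}{(n+1)\cdots(n+p)}$ and extended linearly and continuously to a linear operator $I^{(p)}:C[0,r]\to C[0,r]$, where $C[0,r]$ is the space of continuous functions on $[0,r]$.
   Formalization: The numbers d_1,…,d_N are additionally assumed pairwise distinct (det Δ(D_N) ≠ 0), since otherwise the quotient det(G_k)/det(Δ(D_N)) has zero denominator and is undefined. *)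

(* Defs.v *)
From HB Require Import structures.
From mathcomp Require Import all_boot all_order all_algebra.
From mathcomp Require Import complex.
From mathcomp Require Import all_classical all_reals all_analysis.

Set Implicit Arguments.
Unset Strict Implicit.
Unset Printing Implicit Defensive.

Import Order.TTheory GRing.Theory Num.Theory numFieldNormedType.Exports.

Local Open Scope classical_set_scope.
Local Open Scope complex_scope.
Local Open Scope sesquilinear_scope.
Local Open Scope ring_scope.

(* Functional calculus, through the spectral decomposition
   A = P^-1 *m diag_mx X *m P with P unitary. Meaningful for A normal; the
   value then does not depend on the chosen decomposition. *)
Definition mxfun (R : realType) (n : nat) (g : R[i] -> R[i])
    (A : 'M[R[i]]_n) : 'M[R[i]]_n :=
  invmx (spectralmx A) *m diag_mx (map_mx g (spectral_diag A)) *m spectralmx A.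

(* The topology of C sits on the regular module R[i]^o, hence the switches
   between R[i] and R[i]^o, which are convertible. *)
Definition borelMx (R : realType) (m n : nat) :=
  g_sigma_algebraType (@open 'M[R[i]^o]_(m, n)).

Definition stiefel (R : realType) (L N : nat) : set (borelMx R N L) :=
  [set Phi : 'M[R[i]]_(N, L) | Phi^t* *m Phi = 1%:M].

Arguments stiefel : clear implicits.

(* The law on the ambient matrix space of the isotropic measure. *)
Definition isotropic (R : realType) (L N : nat)
    (mu : probability (borelMx R N L) R) : Prop :=
  mu (stiefel R L N) = 1%E /\
  forall U : 'M[R[i]]_N, U \is unitarymx ->
  forall A : set (borelMx R N L), measurable A ->
    mu ((fun Phi : 'M[R[i]]_(N, L) => U *m Phi) @^-1` A) = mu A.

Definition Cintegral (d : measure_display) (T : measurableType d)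
    (R : realType) (mu : {measure set T -> \bar R}) (D : set T)
    (g : T -> R[i]) : R[i] :=
  Rintegral mu D (fun t => complex.Re (g t)) +i*
  Rintegral mu D (fun t => complex.Im (g t)).

(* C[0, r]: total functions, of which only the values on [0, r] matter. *)
Definition C0 (R : realType) (r : R) : set (R -> R[i]) :=
  [set g : R -> R[i] | {within `[0, r], continuous (g : R -> R[i]^o)}].

(* T is a linear operator C[0, r] -> C[0, r], continuous for the topology of
   uniform convergence on [0, r], with
   T (x ^ n) = x ^ (n + p) / ((n + 1) ... (n + p)). *)
Definition is_Iop (R : realType) (r : R) (p : nat)
    (T : (R -> R[i]) -> (R -> R[i])) : Prop :=
  [/\ forall g, C0 r g -> C0 r (T g),
      forall (a : R[i]) g h, C0 r g -> C0 r h -> forall x : R, x \in `[0, r] ->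
        T (fun y => a * g y + h y) x = a * T g x + T h x,
      {within (C0 r : set {uniform` `[0, r] -> R[i]^o}), continuous
        (T : {uniform` `[0, r] -> R[i]^o} -> {uniform` `[0, r] -> R[i]^o})} &
      forall (n : nat) (x : R), x \in `[0, r] ->
        T (fun y => y%:C ^+ n) x =
        x%:C ^+ (n + p) / \prod_(1 <= j < p.+1) (n + j)%:R].

(* Unique on C[0, r] by the Weierstrass approximation theorem; it exists, being
   the identity for p = 0 and otherwise given by
   g |-> (x |-> \int_0^x (x - t)^(p - 1) / (p - 1)! g(t) dt). *)
Definition Iop (R : realType) (r : R) (p : nat) :
    (R -> R[i]) -> (R -> R[i]) :=
  xget (id : (R -> R[i]) -> (R -> R[i])) [set T | is_Iop r p T].

Definition dmax (R : realType) (N : nat) (d : 'rV[R]_N) : R :=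
  \big[Num.max/0]_(i < N) d 0 i.

(* The default values 0 and dmax d are neutral when all entries of d are
   positive and N > 0. *)
Definition dmin (R : realType) (N : nat) (d : 'rV[R]_N) : R :=
  \big[Num.min/dmax d]_(i < N) d 0 i.

(* Row and column indices start at 0, so row j below is the usual row j + 1. *)
Definition Delta (R : realType) (N : nat) (d : 'rV[R]_N) : 'M[R[i]]_N :=
  \matrix_(j < N, i < N) (d 0 i)%:C ^+ (N - j.+1).

Definition Gmx (R : realType) (L N : nat) (r : R) (d : 'rV[R]_N)
    (F : R -> R[i]) (k : nat) : 'M[R[i]]_N :=
  \matrix_(j < N, i < N)
    if (j : nat) == k
    then Iop r (N - L) (fun x => x%:C ^+ (L - k.+1) * F x) (d 0 i)
    else Delta d j i.

(* Main.v *)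
(* By Weierstrass approximation it suffices to treat f = x^n, where both sides
   are evaluated through hook Schur functions. On the right, reducing x^(N+a)
   modulo the characteristic polynomial of D gives, up to sign, the hook Schur
   functions s_(a|k)(D) as coefficients, which computes det G_k / det Delta. On
   the left, Tr((Phi^* D Phi)^n) = Tr((P D)^n) with P = Phi Phi^*, and this power
   sum is the alternating sum of the s_(a|b)(P D) with a + b + 1 = n; what has to
   be shown is that the mean of s_(a|b)(P D) is an explicit multiple of
   s_(a|b)(D). The law of Phi is invariant under the unitaries 1 + (z - 1) q with
   q a projection of rank one and |z| = 1; the coefficient of z - 1 in this
   invariance, extended from such q to all matrices, is a loop equation for the
   moments of P. It yields the mean of the determinants involved in the elementary
   symmetric functions of P D and, for an independent P of rank one, expresses the
   complete symmetric functions as moments, so that both factors of a hook are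
   averaged at once. *)
Require Import Defs.
From HB Require Import structures.
From mathcomp Require Import all_boot all_order all_algebra.
From mathcomp Require Import complex.
From mathcomp Require Import all_classical all_reals all_analysis.
From mathcomp Require Import measurable_realfun.
From mathcomp Require Import fingroup perm.
From mathcomp Require Import ring lra zify.

Set Implicit Arguments.
Unset Strict Implicit.
Unset Printing Implicit Defensive.

Import Order.TTheory GRing.Theory Num.Theory numFieldNormedType.Exports.

Local Open Scope classical_set_scope.
Local Open Scope complex_scope.
Local Open Scope sesquilinear_scope.
Local Open Scope ring_scope.

(** * Elementary, complete and hook functions of a matrix *)

(** The matrix P D need not be normal, so eigenvalues are avoided: elementary functions are
    coefficients of det(1 + tA), complete ones are moments of the quadratic form psi^* A psi up to a
    constant, and Newton's identity alone ties the latter to power sums. The obstacle to averaging a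
    hook of P D over Phi is that its complete factor is itself an integral over psi. Exchanging the
    two means leaves, for fixed psi, a product of b + 1 antisymmetric and a symmetric factors in P,
    whose mean is a scalar times the value at D. That scalar is the quotient of L(L-1)...(L-b)
    (L+1)...(L+a) by the same expression in N, and it explains the shape of the formula. It equals
    (N-b-1)!/(L-b-1)! times (L+a)!/(N+a)!: the first factor is the prefactor of the summand k = b,
    the second is the constant that I^(N-L) puts on x^(L-k-1+n) when n = a + k + 1. For b >= L it
    vanishes, whence the range of k. *)

Lemma det_block_mx11 (R : idomainType) n (M : 'M[R]_n) (c : 'M[R]_(n, 1))
    (r : 'M[R]_(1, n)) (d : 'M[R]_1) : \det M != 0 ->
  \det (block_mx M c r d) = d 0 0 * \det M - (r *m \adj M *m c) 0 0.
Proof.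
move=> M0; apply: (mulIf M0).
(* The column operation that clears [c], scaled by det M to avoid inverses; its determinant is the
   factor that [mulIf] introduced. *)
have detB : \det (block_mx 1%:M (- (\adj M *m c)) 0 (\det M)%:M : 'M[R]_(n + 1))
    = \det M by rewrite det_ublock det1 mul1r det_scalar1.
rewrite -[X in _ * X = _]detB -det_mulmx mulmx_block !mulmx1 !mulmx0 !addr0.
have -> : M *m - (\adj M *m c) + c *m (\det M)%:M = 0.
  by rewrite mulmxN mulmxA mul_mx_adj mul_scalar_mx mul_mx_scalar addrC subrr.
rewrite det_lblock mulrC det_mx11; congr (_ * _).
by rewrite mulmxN mulmxA mul_mx_scalar !mxE mulrC [LHS]addrC.
Qed.

Definition setrow (R : nzRingType) n (i : 'I_n) (u : 'rV[R]_n) (M : 'M[R]_n) :=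
  \matrix_(k, j) if k == i then u 0 j else M k j.

Lemma det_setrow (R : comNzRingType) n (i : 'I_n) (u : 'rV[R]_n) (M : 'M[R]_n) :
  \det (setrow i u M) = \sum_j u 0 j * cofactor M i j.
Proof.
rewrite (expand_det_row _ i); apply: eq_bigr => j _.
rewrite mxE eqxx; congr (_ * (_ * \det _)).
apply/matrixP => k l; rewrite !mxE ifF //.
by apply/negbTE; rewrite eq_sym neq_lift.
Qed.

Lemma det_setrow_perm (R : comNzRingType) n (i : 'I_n) (u : 'rV[R]_n)
    (M : 'M[R]_n) :
  \det (setrow i u M) =
  \sum_(s : 'S_n) (-1) ^+ s * (u 0 (s i) * \prod_(k | k != i) M k (s k)).
Proof.
apply: eq_bigr => s _; rewrite (bigD1 i) //= mxE eqxx; congr (_ * (_ * _)).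
by apply: eq_bigr => k /negbTE ki; rewrite mxE ki.
Qed.

Lemma deriv_prod_seq (R : comNzRingType) (I : eqType) (r : seq I)
    (F : I -> {poly R}) : uniq r ->
  (\prod_(i <- r) F i)^`() =
  \sum_(i <- r) (F i)^`() * \prod_(j <- r | j != i) F j.
Proof.
elim: r => [|x r IH] /=; first by rewrite !big_nil derivC.
case/andP => xr ur; rewrite !big_cons derivM IH // eqxx /=; congr (_ * _ + _).
  rewrite [RHS]big_seq_cond [LHS]big_seq; apply: eq_bigl => j.
  by case jr: (j \in r) => //=; apply/esym; apply: contraNneq xr => <-.
rewrite big_distrr [LHS]big_seq [RHS]big_seq; apply: eq_bigr => j jr.
rewrite big_cons ifT; first by rewrite mulrCA.
by apply: contraNneq xr => ->.
Qed.

Lemma deriv_prod (R : comNzRingType) (I : finType) (S : {set I})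
    (F : I -> {poly R}) :
  (\prod_(i in S) F i)^`() =
  \sum_(i in S) (F i)^`() * \prod_(j in S | j != i) F j.
Proof.
rewrite -big_enum deriv_prod_seq ?enum_uniq // big_enum.
by apply: eq_bigr => i _; rewrite big_enum_cond.
Qed.

(** Jacobi's formula. The Leibniz rule differentiates one row at a time, and expansion along that
    row produces the cofactors. *)
Lemma deriv_det (R : idomainType) n (M : 'M[{poly R}]_n) :
  (\det M)^`() = \tr (\adj M *m map_mx deriv M).
Proof.
rewrite mxtrace_mulC /mxtrace raddf_sum /=.
transitivity (\sum_i \det (setrow i (map_mx deriv (row i M)) M)).
  under [RHS]eq_bigr do rewrite det_setrow_perm.
  rewrite exchange_big; apply: eq_bigr => s _.
  have <- : \prod_(i in [set: 'I_n]%SET) M i (s i) = \prod_i M i (s i).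
    by apply: eq_bigl => i; rewrite inE.
  rewrite -mulr_sumr.
  have -> : \sum_i (map_mx deriv (row i M)) 0 (s i) *
      \prod_(k | k != i) M k (s k) = (\prod_(i in [set: 'I_n]%SET) M i (s i))^`().
    rewrite deriv_prod; apply: eq_big => [i|i _]; first by rewrite inE.
    by rewrite !mxE; congr (_ * _); apply: eq_bigl => j; rewrite inE.
  by rewrite !mulr_sign; case: ifP => _; rewrite ?derivN.
apply: eq_bigr => i _; rewrite det_setrow mxE.
by apply: eq_bigr => j _; rewrite !mxE.
Qed.

Lemma size_det_le (R : idomainType) n m (M : 'M[{poly R}]_n) :
  (forall i j, size (M i j) <= m.+1)%N -> (size (\det M) <= (n * m).+1)%N.
Proof.
move=> sM; apply: (big_ind (fun p : {poly R} => (size p <= (n * m).+1)%N)).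
- by rewrite size_poly0.
- by move=> p q hp hq; rewrite (leq_trans (size_polyD _ _)) // geq_max hp.
move=> s _; rewrite -signr_odd mulr_sign; case: ifP => _; rewrite ?size_polyN.
all: rewrite (leq_trans (size_poly_prod_leq _ _)) //.
all: rewrite leq_subLR card_ord addnS ltnS -[X in (_ <= X + _)%N]muln1 -mulnDr add1n.
all: apply: (@leq_trans (\sum_(i < n) m.+1)%N); first by apply: leq_sum => i _.
all: by rewrite sum_nat_const card_ord.
Qed.

(** * Coefficients of det(1 + tA) and of its adjugate *)

Section Elementary.
Variables (K : numFieldType) (N : nat) (A : 'M[K]_N).

Definition affine_mx : 'M[{poly K}]_N := 1%:M + 'X *: map_mx polyC A.
Definition elem (k : nat) : K := (\det affine_mx)`_k.
(** For diagonal [A], the diagonal entries are the elementary functions of the eigenvalues other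
    than the i-th. *)
Definition elemx (k : nat) : 'M[K]_N := \matrix_(i, j) (\adj affine_mx i j)`_k.

Lemma affine_mxE i j : affine_mx i j = (i == j)%:R + 'X * (A i j)%:P.
Proof. by rewrite !mxE. Qed.

Lemma elem0 : elem 0 = 1.
Proof.
rewrite /elem -horner_coef0 -[LHS]/(horner_eval 0 _) -det_map_mx.
rewrite -[RHS](det1 K N); congr (\det _); apply/matrixP => i j.
rewrite !mxE rmorphD rmorph_nat rmorphM /= /horner_eval hornerX mul0r addr0 //.
Qed.

Lemma det_affine_neq0 : \det affine_mx != 0.
Proof. by apply: contra_eqN elem0 => /eqP e0; rewrite /elem e0 coef0 eq_sym oner_eq0. Qed.

(** The coefficient of t^(k+1) in (1 + tA) adj(1 + tA) = det(1 + tA), that is, the Faddeev-LeVerrier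
    recursion. *)
Lemma elemx_mul k : elemx k.+1 + A *m elemx k = (elem k.+1)%:M.
Proof.
apply/matrixP => i j.
have := mul_mx_adj affine_mx.
rewrite {1}/affine_mx mulmxDl mul1mx -scalemxAl.
move=> /matrixP/(_ i j)/(congr1 (fun p : {poly K} => p`_k.+1)).
rewrite !mxE coefD coefXM /= coefMn => <-.
  congr (_ + _); rewrite coef_sum; apply: eq_bigr => l _.
  by rewrite !mxE coefCM.
Qed.

Lemma elemx_mulC k : elemx k.+1 + elemx k *m A = (elem k.+1)%:M.
Proof.
apply/matrixP => i j.
have := mul_adj_mx affine_mx.
rewrite {2}/affine_mx mulmxDr mulmx1 -scalemxAr.
move=> /matrixP/(_ i j)/(congr1 (fun p : {poly K} => p`_k.+1)).
rewrite !mxE coefD coefXM /= coefMn => <-.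
  congr (_ + _); rewrite coef_sum; apply: eq_bigr => l _.
  by rewrite !mxE coefMC.
Qed.

Lemma elemx0 : elemx 0 = 1%:M.
Proof.
apply/matrixP => i j.
have := mul_mx_adj affine_mx.
rewrite {1}/affine_mx mulmxDl mul1mx -scalemxAl.
move=> /matrixP/(_ i j)/(congr1 (fun p : {poly K} => p`_0)).
rewrite !mxE coefD coefXM addr0 coefMn -/(elem 0) elem0 => ->.
by [].
Qed.

Lemma trace_mul_elemx k : \tr (A *m elemx k) = elem k.+1 *+ k.+1.
Proof.
rewrite -coef_deriv deriv_det [in RHS]mxtrace_mulC /mxtrace coef_sum.
apply: eq_bigr => i _; rewrite !mxE coef_sum; apply: eq_bigr => j _.
rewrite !mxE derivD derivM derivX derivC mulr0 mul1r.
by rewrite derivMn addr0 -polyC1 derivC mul0rn add0r coefCM.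
Qed.

Lemma trace_elemx k : \tr (elemx k) = elem k * (N%:R - k%:R).
Proof.
case: k => [|k]; first by rewrite elemx0 elem0 mxtrace1 mul1r subr0.
rewrite -[elemx _](addrK (A *m elemx k)) elemx_mul raddfB /= trace_mul_elemx.
by rewrite mxtrace_scalar mulrBr !mulr_natr.
Qed.

(** The entries of the adjugate are minors of size N - 1 of a matrix affine in t, hence of degree
    below N. *)
Lemma elemx_eq0 k : (N <= k)%N -> elemx k = 0.
Proof.
move=> Nk; apply/matrixP => i j; rewrite !mxE nth_default //.
have: forall k' l, (size (affine_mx k' l) <= 2)%N.
  move=> k' l; rewrite affine_mxE (leq_trans (size_polyD _ _)) // geq_max.
  rewrite -polyC_natr (leq_trans (size_polyC_leq1 _)) // mulrC mul_polyC.
  by rewrite (leq_trans (size_scale_leq _ _)) // size_polyX.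
move: affine_mx; case: N i j Nk => [[]//|n] i j nk M sM.
rewrite /cofactor -signr_odd mulr_sign; apply: leq_trans nk.
rewrite (fun_if (fun p : {poly K} => size p)) size_polyN if_same.
rewrite -[X in (_ <= X.+1)%N]muln1; apply: size_det_le => k' l.
by rewrite !mxE.
Qed.

End Elementary.

(** * Complete functions and hooks from Newton's identity *)

Section Complete.
Variables (K : numFieldType) (N : nat) (A : 'M[K]_N) (h : nat -> K).
Hypothesis h0 : h 0 = 1.
(* [h a] plays the role of the complete homogeneous symmetric polynomial of the
   eigenvalues of [A], characterized by its Newton identity. *)
Hypothesis newton : forall a,
  h a.+1 *+ a.+1 = \sum_(j < a.+1) \tr (A ^+ j.+1) * h (a - j).

(** The coefficient of t^a in H(t) (1 - tA)^-1, where H(t) is the generating series of [h]. *)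
Definition completex (a : nat) : 'M[K]_N := \sum_(j < a.+1) h (a - j) *: A ^+ j.

Lemma completexS a : completex a.+1 = h a.+1 *: 1%:M + A *m completex a.
Proof.
rewrite /completex big_ord_recl subn0 expr0; congr (_ + _).
rewrite mulmx_sumr; apply: eq_bigr => j _.
by rewrite -scalemxAr lift0 subSS exprS.
Qed.

Lemma completexC a : A *m completex a = completex a *m A.
Proof.
rewrite mulmx_sumr mulmx_suml; apply: eq_bigr => j _.
by rewrite -scalemxAr -scalemxAl mulmxE -exprS exprSr.
Qed.

Lemma trace_mul_completex a : \tr (A *m completex a) = h a.+1 *+ a.+1.
Proof.
rewrite newton mulmx_sumr raddf_sum /=; apply: eq_bigr => j _.
by rewrite -scalemxAr mxtraceZ mulmxE -exprS mulrC.
Qed.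

Lemma trace_completex a : \tr (completex a) = h a * (N%:R + a%:R).
Proof.
case: a => [|a].
  by rewrite /completex big_ord1 expr0 mxtraceZ mxtrace1 addr0.
rewrite completexS mxtraceD mxtraceZ mxtrace1 trace_mul_completex.
by rewrite mulrDr !mulr_natr.
Qed.

(** This is a + k + 1 times the Schur function of the hook (a | k), as the value at k = 0 and the
    Pieri rule below determine it. *)
Definition hook (a k : nat) : K := \tr (A *m elemx A k *m completex a).

Lemma hook0 a : hook a 0 = h a.+1 *+ a.+1.
Proof. by rewrite /hook elemx0 mulmx1 trace_mul_completex. Qed.

(** The recursions of [completex] and [elemx] make the same trace appear in both hooks with opposite
    signs. The remaining traces give h e times (N + a + 1) - (N - k - 1). *)
Lemma hook_pieri a k :
  hook a k.+1 + hook a.+1 k = h a.+1 * elem A k.+1 *+ (a + k).+2.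
Proof.
have eA : elemx A k.+1 *m A = A *m elemx A k.+1.
  by apply: (addrI (elemx A k.+2)); rewrite elemx_mulC elemx_mul.
have -> : hook a k.+1 =
    \tr (elemx A k.+1 *m completex a.+1) - h a.+1 * \tr (elemx A k.+1).
  rewrite completexS mulmxDr -scalemxAr mulmx1 mxtraceD mxtraceZ addrC addKr.
  by rewrite mulmxA eA.
have -> : hook a.+1 k = elem A k.+1 * \tr (completex a.+1)
    - \tr (elemx A k.+1 *m completex a.+1).
  rewrite /hook -[A *m elemx A k](addKr (elemx A k.+1)) elemx_mul.
  by rewrite addrC mulmxBl mul_scalar_mx raddfB /= mxtraceZ.
rewrite trace_elemx trace_completex -[RHS]mulr_natr.
have -> : (a + k).+2 = (a.+1 + k.+1)%N by rewrite addnS.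
by rewrite [in RHS]natrD; ring.
Qed.

Lemma hook_eq0 a k : (N <= k)%N -> hook a k = 0.
Proof. by move=> Nk; rewrite /hook elemx_eq0 // mulmx0 mul0mx mxtrace0. Qed.

Lemma completex0 : completex 0 = 1%:M.
Proof. by rewrite /completex big_ord1 h0 scale1r. Qed.

(** The coefficient of t^m in adj(1 - tA) H(t) (1 - tA)^-1. Peeling off a factor through
    [completexS] or through [elemx_mulC] gives two recursions, whose comparison yields det(1 - tA)
    H(t) = 1. The series is therefore (1 - tA)^-2, which accounts for the multiplicity m + 1 in
    [conv_elemxE]. *)
Definition conv_elemx (m : nat) : 'M[K]_N :=
  \sum_(b < m.+1) (-1) ^+ b *: (elemx A b *m completex (m - b)).

Lemma conv_elemx0 : conv_elemx 0 = 1%:M.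
Proof. by rewrite /conv_elemx big_ord1 scale1r elemx0 mul1mx completex0. Qed.

Lemma conv_elemxS_h m : conv_elemx m.+1 =
  \sum_(b < m.+2) ((-1) ^+ b * h (m.+1 - b)) *: elemx A b + conv_elemx m *m A.
Proof.
rewrite /conv_elemx big_ord_recr [in RHS]big_ord_recr /= subnn completex0 h0.
rewrite mulmx1 mulr1 addrAC; congr (_ + _).
rewrite mulmx_suml -big_split /=; apply: eq_bigr => b _.
rewrite subSn ?leq_ord // completexS mulmxDr -scalemxAr mulmx1 scalerDr scalerA.
by rewrite -scalemxAl -mulmxA completexC.
Qed.

Lemma conv_elemxS_e m : conv_elemx m.+1 =
  \sum_(b < m.+2) ((-1) ^+ b * elem A b) *: completex (m.+1 - b)
  + conv_elemx m *m A.
Proof.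
rewrite /conv_elemx big_ord_recl [in RHS]big_ord_recl /= elem0 elemx0.
rewrite mul1mx mulr1 -addrA; congr (_ + _).
rewrite mulmx_suml -big_split /=; apply: eq_bigr => b _.
rewrite /bump /= add1n subSS -[elemx A b.+1](addrK (elemx A b *m A)) elemx_mulC.
rewrite mulmxBl mul_scalar_mx scalerBr scalerA; congr (_ + _).
by rewrite exprS mulN1r scaleNr opprK -scalemxAl -!mulmxA completexC.
Qed.

(* The identity [det (1 - tA) * sum_a h_a t^a = 1], obtained by comparing the
   traces of the two expressions of [conv_elemx]. *)
Lemma elem_complete_orth m :
  \sum_(b < m.+2) (-1) ^+ b * elem A b * h (m.+1 - b) = 0.
Proof.
have := conv_elemxS_h m; rewrite conv_elemxS_e => /addIr/(congr1 mxtrace).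
rewrite !raddf_sum /= => /eqP; rewrite -subr_eq0 -sumrB => /eqP eq0.
(* The traces weigh the summand b by N - b on one side and by N + m + 1 - b on the other; the
   difference m + 1 does not depend on b and can be cancelled. *)
have m0 : m.+1%:R != 0 :> K by rewrite pnatr_eq0.
apply: (mulIf m0); rewrite mul0r -[RHS]eq0 big_distrl; apply: eq_bigr => b _ /=.
rewrite !mxtraceZ trace_completex trace_elemx natrB -1?ltnS //.
by ring.
Qed.

Lemma sum_elem_completex m :
  \sum_(b < m.+1) ((-1) ^+ b * elem A b) *: completex (m - b) = A ^+ m.
Proof.
elim: m => [|m IH].
  by rewrite big_ord1 expr0 elem0 mulr1 scale1r completex0.
rewrite exprS -IH -mulmxE big_ord_recr /= subnn completex0 mulmx_sumr.
have -> : ((-1) ^+ m.+1 * elem A m.+1) *: 1%:M = - \sum_(b < m.+1)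
    ((-1) ^+ b * elem A b * h (m.+1 - b)) *: 1%:M :> 'M[K]_N.
  rewrite -scaler_suml -scaleNr; congr (_ *: _); apply/eqP.
  have := elem_complete_orth m; rewrite big_ord_recr /= subnn h0 mulr1 => e0.
  by rewrite -addr_eq0 addrC e0.
rewrite -sumrB; apply: eq_bigr => b _.
by rewrite subSn ?leq_ord // completexS scalerDr scalerA addrC addKr scalemxAr.
Qed.

Lemma conv_elemxE m : conv_elemx m = A ^+ m *+ m.+1.
Proof.
elim: m => [|m IH]; first exact: conv_elemx0.
rewrite conv_elemxS_e sum_elem_completex IH [in RHS]mulrS; congr (_ + _).
by rewrite mulmxE mulrnAl -exprSr.
Qed.

Lemma power_sum_hook n :
  \sum_(b < n.+1) (-1) ^+ b * hook (n - b) b = \tr (A ^+ n.+1) *+ n.+1.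
Proof.
rewrite -raddfMn /= exprS -mulrnAr -conv_elemxE -mulmxE mulmx_sumr raddf_sum /=.
by apply: eq_bigr => b _; rewrite -scalemxAr mxtraceZ mulmxA.
Qed.

End Complete.

(** * Hook functions and generalized Vandermonde determinants *)

Section Vandermonde.
Variables (K : numFieldType) (N : nat) (d : 'rV[K]_N) (h : nat -> K).
Let A := diag_mx d.
Hypothesis h0 : h 0 = 1.
Hypothesis newton : forall a,
  h a.+1 *+ a.+1 = \sum_(j < a.+1) \tr (A ^+ j.+1) * h (a - j).

Definition revVandermonde : 'M[K]_N := \matrix_(j, i) d 0 i ^+ (N - j.+1).

(* [schur_hook a k] is the Schur function of the hook (a | k), so that the next
   lemma computes monomials modulo the characteristic polynomial. *)
Definition schur_hook (a k : nat) : K := hook A h a k / (a + k).+1%:R.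

Lemma schur_hook_pieri a k :
  schur_hook a k.+1 + schur_hook a.+1 k = h a.+1 * elem A k.+1.
Proof.
by rewrite /schur_hook addnS addSn -mulrDl hook_pieri // -mulr_natr mulfK.
Qed.

Lemma expr_schur_hook a i :
  d 0 i ^+ (N + a) =
  \sum_(k < N) (-1) ^+ k * schur_hook a k * d 0 i ^+ (N - k.+1).
Proof.
have N_gt0 : (0 < N)%N by case: (N) i => [[]|].
have base : d 0 i ^+ N =
    \sum_(k < N) (-1) ^+ k * elem A k.+1 * d 0 i ^+ (N - k.+1).
  (* Since [elemx A k.+1 i i] plus d_i times [elemx A k i i] is e_(k+1), the sum telescopes; it ends
     at [elemx A N], which is 0. *)
  pose u (k : nat) : K := (-1) ^+ k * elemx A k i i * d 0 i ^+ (N - k).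
  have -> : d 0 i ^+ N = u 0 - u N.
    by rewrite /u (elemx_eq0 A (leqnn N)) elemx0 !mxE eqxx subn0 !mul1r mulr0 mul0r subr0.
  rewrite -[RHS]opprK -sumrN -opprB; congr (- _).
  rewrite -(telescope_sumr u) // big_mkord; apply: eq_bigr => k _.
  have <- : elemx A k.+1 i i + d 0 i * elemx A k i i = elem A k.+1.
    have /matrixP/(_ i i) := elemx_mul A k.
    move: (elemx A k.+1) (elemx A k) => X Y.
    by rewrite mul_diag_mx !mxE eqxx mulr1n.
  by rewrite /u -(subnSK (ltn_ord k)) !exprS; ring.
elim: a => [|a IH].
  rewrite addn0 base; apply: eq_bigr => k _; congr (_ * _ * _).
  rewrite /schur_hook /hook completex0 // mulmx1 trace_mul_elemx.
  by rewrite add0n -[X in X / _]mulr_natr mulfK ?pnatr_eq0.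
rewrite addnS exprSr IH big_distrl /=.
(* Multiplying by d_i raises all exponents; the term k = 0 reaches d_i^N, which [base] reduces
   again, and the Pieri rule collects the coefficients. *)
transitivity (schur_hook a 0 * d 0 i ^+ N
    - \sum_(k < N) (-1) ^+ k * schur_hook a k.+1 * d 0 i ^+ (N - k.+1)).
  transitivity (\sum_(k < N) (-1) ^+ k * schur_hook a k * d 0 i ^+ (N - k)).
    by apply: eq_bigr => k _; rewrite -(subnSK (ltn_ord k)) [in RHS]exprSr; ring.
  have aN : schur_hook a N = 0 by rewrite /schur_hook hook_eq0 // mul0r.
  move: (d 0 i) (schur_hook a) aN => x s; case: (N) N_gt0 => // n _ an0.
  rewrite big_ord_recl mul1r subn0; congr (_ + _).
  rewrite big_ord_recr /= an0 mulr0 mul0r addr0 -sumrN; apply: eq_bigr => k _.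
  by rewrite /bump add1n exprS mulN1r !mulNr.
rewrite base {1}/schur_hook hook0 // addn0 -[X in X / _]mulr_natr mulfK ?pnatr_eq0 //.
rewrite big_distrr -sumrB /=; apply: eq_bigr => k _.
by rewrite -(addKr (schur_hook a k.+1) (schur_hook a.+1 k)) schur_hook_pieri; ring.
Qed.

(** By [expr_schur_hook] the new row is a combination of the Vandermonde rows, and only the multiple
    of row k itself survives in the determinant. *)
Lemma det_setrow_hook a (k : 'I_N) :
  \det (setrow k (\row_i d 0 i ^+ (N + a)) revVandermonde) =
  (-1) ^+ k * schur_hook a k * \det revVandermonde.
Proof.
rewrite det_setrow.
transitivity (\sum_(l < N) (-1) ^+ l * schur_hook a l *
    (revVandermonde *m \adj revVandermonde) l k).
  under [RHS]eq_bigr do rewrite mxE big_distrr /=.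
  rewrite exchange_big; apply: eq_bigr => j _ /=.
  rewrite mxE expr_schur_hook big_distrl; apply: eq_bigr => l _.
  by rewrite !mxE /= !mulrA.
rewrite (bigD1 k) //= big1 => [|l /negbTE lk].
  by rewrite mul_mx_adj mxE eqxx mulr1n addr0.
by rewrite mul_mx_adj mxE lk mulr0n mulr0.
Qed.

Lemma det_setrow_dup (k : 'I_N) m : (m < N)%N -> m != (N - k.+1)%N ->
  \det (setrow k (\row_i d 0 i ^+ m) revVandermonde) = 0.
Proof.
(* The index N - m - 1 is that of the row with exponent m, which the new row repeats. *)
move=> mN mk; have lN : (N - m.+1 < N)%N by rewrite ltn_subrL (leq_ltn_trans _ mN).
apply: (determinant_alternate (i1 := k) (i2 := Ordinal lN)).
  by apply: contra mk => /eqP ->; rewrite /= subnSK // subKn // ltnW.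
move=> j; rewrite !mxE eqxx ifF ?subnSK ?subKn // 1?ltnW //.
apply: contraNF mk => /eqP <-; by rewrite /= subnSK // subKn // ltnW.
Qed.

End Vandermonde.

(** * Bounded measurable functions and the Stiefel manifold *)

Lemma norm_complex_le (R : realType) (z : R[i]) :
  `|z| <= (`|complex.Re z| + `|complex.Im z|)%:C.
Proof.
case: z => x y; rewrite normc_def lecR /=.
rewrite -[leRHS]ger0_norm ?addr_ge0 // -sqrtr_sqr ler_wsqrtr // sqrrD.
by rewrite !real_normK ?num_real // addrAC lerDl mulrn_wge0 ?mulr_ge0.
Qed.

Lemma norm_Re_le (R : realType) (z : R[i]) (M : R) : `|z| <= M%:C -> `|complex.Re z| <= M.
Proof.
case: z => x y; rewrite normc_def lecR /=; apply: le_trans.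
by rewrite -sqrtr_sqr ler_wsqrtr // lerDl sqr_ge0.
Qed.

Lemma norm_Im_le (R : realType) (z : R[i]) (M : R) : `|z| <= M%:C -> `|complex.Im z| <= M.
Proof.
case: z => x y; rewrite normc_def lecR /=; apply: le_trans.
by rewrite -sqrtr_sqr ler_wsqrtr // lerDr sqr_ge0.
Qed.

(** * The algebra of bounded measurable functions and their means *)

Section BoundedMeasurable.
Context (d : measure_display) (T : measurableType d) (R : realType).
Variables (mu : probability T R) (D : set T).
Hypotheses (mD : measurable D) (muD : mu D = 1%E).

(** A class closed under the ring operations whose members are integrable because [mu] has mass 1 on
    [D]; linearity of the mean is stated on it. *)
Definition bmeas (g : T -> R) :=
  measurable_fun D g /\ exists M : R, forall x, D x -> `|g x| <= M.

Lemma bmeas_cst a : bmeas (fun=> a).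
Proof. by split; [exact: measurable_cst | exists `|a|]. Qed.

Lemma bmeasD f g : bmeas f -> bmeas g -> bmeas (fun x => f x + g x).
Proof.
move=> [mf [A fA]] [mg [B gB]]; split; first exact: measurable_funD.
by exists (A + B) => x Dx; rewrite (le_trans (ler_normD _ _)) // lerD // ?fA ?gB.
Qed.

Lemma bmeasM f g : bmeas f -> bmeas g -> bmeas (fun x => f x * g x).
Proof.
move=> [mf [A fA]] [mg [B gB]]; split; first exact: measurable_funM.
by exists (A * B) => x Dx; rewrite normrM ler_pM ?fA ?gB.
Qed.

Lemma bmeasN f : bmeas f -> bmeas (fun x => - f x).
Proof.
move=> [mf [A fA]]; split; first exact: measurableT_comp.
by exists A => x Dx; rewrite normrN fA.
Qed.

Lemma bmeas_integrable f : bmeas f -> mu.-integrable D (EFin \o f).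
Proof.
have muDoo : (mu D < +oo)%E by rewrite muD ltry.
move=> [mf [A fA]]; apply: measurable_bounded_integrable => //.
exists A; split; first exact: num_real.
by move=> x /ltW Ax y Dy /=; exact: le_trans (fA _ Dy) Ax.
Qed.

Definition bmeasC (g : T -> R[i]) :=
  bmeas (fun x => complex.Re (g x)) /\ bmeas (fun x => complex.Im (g x)).

Lemma bmeasC_ext f g : (forall x, f x = g x) -> bmeasC f -> bmeasC g.
Proof. by move=> /funext ->. Qed.

Lemma bmeasC_cst a : bmeasC (fun=> a).
Proof. by split; exact: bmeas_cst. Qed.

Lemma bmeasCD f g : bmeasC f -> bmeasC g -> bmeasC (fun x => f x + g x).
Proof.
move=> [f1 f2] [g1 g2]; split.
  rewrite (_ : (fun _ => _) = fun x => complex.Re (f x) + complex.Re (g x)).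
    exact: bmeasD.
  by apply/funext => x; case: (f x) (g x) => [? ?] [? ?].
rewrite (_ : (fun _ => _) = fun x => complex.Im (f x) + complex.Im (g x)).
  exact: bmeasD.
by apply/funext => x; case: (f x) (g x) => [? ?] [? ?].
Qed.

Lemma bmeasCM f g : bmeasC f -> bmeasC g -> bmeasC (fun x => f x * g x).
Proof.
move=> [f1 f2] [g1 g2]; split.
  rewrite (_ : (fun _ => _) = fun x => complex.Re (f x) * complex.Re (g x) +
      - (complex.Im (f x) * complex.Im (g x))).
    by apply: bmeasD; [|apply: bmeasN]; exact: bmeasM.
  by apply/funext => x; case: (f x) (g x) => [? ?] [? ?].
rewrite (_ : (fun _ => _) = fun x => complex.Re (f x) * complex.Im (g x) +
    complex.Im (f x) * complex.Re (g x)).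
  by apply: bmeasD; exact: bmeasM.
by apply/funext => x; case: (f x) (g x) => [? ?] [? ?].
Qed.

Lemma bmeasCZ a f : bmeasC f -> bmeasC (fun x => a * f x).
Proof. by move=> bf; apply: bmeasCM => //; exact: bmeasC_cst. Qed.

Lemma bmeasCN f : bmeasC f -> bmeasC (fun x => - f x).
Proof. by move=> /(bmeasCZ (-1)); apply: bmeasC_ext => x; rewrite mulN1r. Qed.

Lemma bmeasCB f g : bmeasC f -> bmeasC g -> bmeasC (fun x => f x - g x).
Proof. by move=> bf bg; apply: bmeasCD => //; exact: bmeasCN. Qed.

Lemma bmeasC_sum (I : Type) (r : seq I) (P : pred I) (F : I -> T -> R[i]) :
  (forall i, P i -> bmeasC (F i)) -> bmeasC (fun x => \sum_(i <- r | P i) F i x).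
Proof.
move=> bF; elim: r => [|i r IH].
  by apply: (bmeasC_ext _ (bmeasC_cst 0)) => x; rewrite big_nil.
case Pi: (P i); last by apply: bmeasC_ext IH => x; rewrite big_cons Pi.
by apply: (bmeasC_ext _ (bmeasCD (bF _ Pi) IH)) => x; rewrite big_cons Pi.
Qed.

Lemma bmeasC_prod (I : Type) (r : seq I) (P : pred I) (F : I -> T -> R[i]) :
  (forall i, P i -> bmeasC (F i)) ->
  bmeasC (fun x => \prod_(i <- r | P i) F i x).
Proof.
move=> bF; elim: r => [|i r IH].
  by apply: (bmeasC_ext _ (bmeasC_cst 1)) => x; rewrite big_nil.
case Pi: (P i); last by apply: bmeasC_ext IH => x; rewrite big_cons Pi.
by apply: (bmeasC_ext _ (bmeasCM (bF _ Pi) IH)) => x; rewrite big_cons Pi.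
Qed.

Lemma bmeasCX f n : bmeasC f -> bmeasC (fun x => f x ^+ n).
Proof.
move=> bf; apply: (bmeasC_ext _ (@bmeasC_prod 'I_n (index_enum 'I_n) xpredT (fun=> f) _)) => //.
by move=> x; rewrite prodr_const card_ord.
Qed.

Lemma bmeasC_det n (F : T -> 'M[R[i]]_n) :
  (forall i j, bmeasC (fun x => F x i j)) -> bmeasC (fun x => \det (F x)).
Proof.
by move=> bF; apply: bmeasC_sum => s _; apply: bmeasCZ; exact: bmeasC_prod.
Qed.

Lemma bmeasC_mulmx m n p (F : T -> 'M[R[i]]_(m, n)) (G : T -> 'M[R[i]]_(n, p)) :
  (forall i j, bmeasC (fun x => F x i j)) ->
  (forall i j, bmeasC (fun x => G x i j)) ->
  forall i j, bmeasC (fun x => (F x *m G x) i j).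
Proof.
move=> bF bG i j.
apply: (@bmeasC_ext (fun x => \sum_k F x i k * G x k j)).
  by move=> x; rewrite mxE.
by apply: bmeasC_sum => k _; exact: bmeasCM.
Qed.

Lemma bmeasC_trace n (F : T -> 'M[R[i]]_n) :
  (forall i j, bmeasC (fun x => F x i j)) -> bmeasC (fun x => \tr (F x)).
Proof. by move=> bF; exact: bmeasC_sum. Qed.

Local Notation E := (@Cintegral d T R mu D).

Lemma eq_EC f g : (forall x, D x -> f x = g x) -> E f = E g.
Proof.
by move=> fg; congr (_ +i* _); apply: eq_Rintegral => x /set_mem /fg ->.
Qed.

Lemma Rintegral_cst1 a : Rintegral mu D (fun=> a) = a.
Proof.
rewrite Rintegral_cst // -[RHS]mulr1; congr (_ * _).
exact: (congr1 fine muD).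
Qed.

Lemma EC_cst a : E (fun=> a) = a.
Proof. by rewrite /Cintegral !Rintegral_cst1; case: a. Qed.

Lemma EC_add f g : bmeasC f -> bmeasC g -> E (fun x => f x + g x) = E f + E g.
Proof.
move=> [f1 f2] [g1 g2].
apply: (@etrans _ _ ((_ + _) +i* (_ + _))); last by [].
congr (_ +i* _).
  rewrite -RintegralD //; try exact: bmeas_integrable.
  by apply: eq_Rintegral => x _; case: (f x) (g x) => [? ?] [? ?].
rewrite -RintegralD //; try exact: bmeas_integrable.
by apply: eq_Rintegral => x _; case: (f x) (g x) => [? ?] [? ?].
Qed.

Lemma EC_scale a f : bmeasC f -> E (fun x => a * f x) = a * E f.
Proof.
case: a => a b [f1 f2]; rewrite /Cintegral.
have i1 := bmeas_integrable f1; have i2 := bmeas_integrable f2.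
apply: (@etrans _ _ ((_ - _) +i* (_ + _))); last by [].
congr (_ +i* _).
  rewrite -!RintegralZl // -RintegralB //.
  - by apply: eq_Rintegral => x _; case: (f x).
  - exact/bmeas_integrable/(bmeasM _ f1)/bmeas_cst.
  - exact/bmeas_integrable/(bmeasM _ f2)/bmeas_cst.
rewrite -!RintegralZl // -RintegralD //.
- by apply: eq_Rintegral => x _; case: (f x).
- exact/bmeas_integrable/(bmeasM _ f2)/bmeas_cst.
- exact/bmeas_integrable/(bmeasM _ f1)/bmeas_cst.
Qed.

Lemma EC_opp f : bmeasC f -> E (fun x => - f x) = - E f.
Proof.
move=> bf; rewrite -mulN1r -EC_scale //.
by apply: eq_EC => x _; rewrite mulN1r.
Qed.

Lemma EC_sub f g : bmeasC f -> bmeasC g -> E (fun x => f x - g x) = E f - E g.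
Proof.
by move=> bf bg; rewrite EC_add ?EC_opp //; exact: bmeasCN.
Qed.

Lemma EC_sum (I : Type) (r : seq I) (P : pred I) (F : I -> T -> R[i]) :
  (forall i, P i -> bmeasC (F i)) ->
  E (fun x => \sum_(i <- r | P i) F i x) = \sum_(i <- r | P i) E (F i).
Proof.
move=> bF; elim: r => [|i r IH].
  rewrite big_nil -[RHS](EC_cst 0).
  by apply: eq_EC => x _; rewrite big_nil.
rewrite big_cons; case Pi: (P i); last first.
  by rewrite -IH; apply: eq_EC => x _; rewrite big_cons Pi.
rewrite -IH -EC_add; [|exact: bF|exact: bmeasC_sum].
by apply: eq_EC => x _; rewrite big_cons Pi.
Qed.

Lemma norm_Rintegral_le (f : T -> R) (M : R) : measurable_fun D f ->
  (forall x, D x -> `|f x| <= M) -> `|Rintegral mu D f| <= M.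
Proof.
move=> mf fM.
have bf : bmeas f by split => //; exists M.
apply: (le_trans (le_normr_Rintegral _ _)) => //; first exact: bmeas_integrable.
have <- : Rintegral mu D (fun=> M) = M by exact: Rintegral_cst1.
apply: le_Rintegral => //; last exact/bmeas_integrable/bmeas_cst.
apply: bmeas_integrable; split; first exact: measurableT_comp.
by exists M => x Dx; rewrite normr_id fM.
Qed.

(** Real and imaginary parts are bounded separately, hence the factor 2. *)
Lemma norm_EC_le f (M : R) : bmeasC f ->
  (forall x, D x -> `|f x| <= M%:C) -> `|E f| <= (M + M)%:C.
Proof.
move=> [[f1 _] [f2 _]] fM.
have n1 : `|Rintegral mu D (fun x => complex.Re (f x))| <= M.
  by apply: norm_Rintegral_le => // x /fM /norm_Re_le.
have n2 : `|Rintegral mu D (fun x => complex.Im (f x))| <= M.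
  by apply: norm_Rintegral_le => // x /fM /norm_Im_le.
by apply: le_trans (norm_complex_le _) _; rewrite lecR lerD.
Qed.

End BoundedMeasurable.

(** * Borel measurability on the space of matrices *)

Lemma mulmx_continuous (K : numFieldType) m n p (U : 'M[K]_(m, n)) :
  continuous (mulmx U : 'M[K]_(n, p) -> 'M[K]_(m, p)).
Proof.
have cU i j : continuous (fun N : 'M[K]_(n, p) => (U *m N) i j).
  rewrite (_ : (fun N => _) = fun N : 'M[K]_(n, p) => \sum_k U i k * N k j).
    apply: continuous_big => [|k _]; first exact: add_continuous.
    move=> M; apply: continuousM; first exact: cst_continuous.
    exact: coord_continuous.
  by apply/funext => M; rewrite mxE.
move=> M A [P MP PA].
apply: (@filterS _ (nbhs M) (nbhs_filter M) _ _ _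
  (@filter_forall _ _ (fun (ij : 'I_m * 'I_p) (N : 'M[K]_(n, p)) =>
    P ij.1 ij.2 ((U *m N) ij.1 ij.2)) (nbhs M) (nbhs_filter M) _)).
  by move=> N PN; apply: PA => i j; exact: (PN (i, j)).
by move=> [i j]; apply: cU; exact: MP.
Qed.

Section Borel.
Context (R : realType) (L N : nat).
Local Notation T := (borelMx R N L).

Lemma continuous_borelMx_measurable (g : 'M[R[i]^o]_(N, L) -> R) :
  continuous g -> measurable_fun [set: T] (g : T -> R).
Proof.
move=> /continuousP cg; apply: (measurability _ (RGenOpens.measurableE R)).
move=> _ [_ [a [b ->] <-]]; rewrite setTI; apply: sub_sigma_algebra.
by apply: cg; exact: interval_open.
Qed.

Lemma Re_continuous : continuous (@complex.Re R : R[i]^o -> R).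
Proof.
move=> z A /nbhs_ballP[e /= e0 eA].
apply/(@nbhs_ballP _ R[i]^o); exists e%:C; first by rewrite /= ltcR.
move=> w; rewrite -ball_normE /= normc_def ltcR => zw.
apply: eA; rewrite -ball_normE /=; apply: le_lt_trans zw.
case: z w => a b [a' b'] /=.
by rewrite -sqrtr_sqr ler_wsqrtr // lerDl sqr_ge0.
Qed.

Lemma Im_continuous : continuous (@complex.Im R : R[i]^o -> R).
Proof.
move=> z A /nbhs_ballP[e /= e0 eA].
apply/(@nbhs_ballP _ R[i]^o); exists e%:C; first by rewrite /= ltcR.
move=> w; rewrite -ball_normE /= normc_def ltcR => zw.
apply: eA; rewrite -ball_normE /=; apply: le_lt_trans zw.
case: z w => a b [a' b'] /=.
by rewrite -sqrtr_sqr ler_wsqrtr // lerDr sqr_ge0.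
Qed.

Lemma Re_coord_measurable i j :
  measurable_fun [set: T] (fun Phi : T => complex.Re ((Phi : 'M[R[i]]_(N, L)) i j)).
Proof.
apply: continuous_borelMx_measurable => Phi.
apply: (@continuous_comp _ _ _ (fun M : 'M[R[i]^o]_(N, L) => M i j) (@complex.Re R)).
  exact: (@coord_continuous R[i]).
exact: Re_continuous.
Qed.

Lemma Im_coord_measurable i j :
  measurable_fun [set: T] (fun Phi : T => complex.Im ((Phi : 'M[R[i]]_(N, L)) i j)).
Proof.
apply: continuous_borelMx_measurable => Phi.
apply: (@continuous_comp _ _ _ (fun M : 'M[R[i]^o]_(N, L) => M i j) (@complex.Im R)).
  exact: (@coord_continuous R[i]).
exact: Im_continuous.
Qed.

Lemma mulmx_measurable (U : 'M[R[i]]_N) :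
  measurable_fun [set: T] (fun Phi : T => (U *m (Phi : 'M[R[i]]_(N, L)) : T)).
Proof.
apply: (@measurability _ _ T T setT _ (@open 'M[R[i]^o]_(N, L)) erefl).
move=> _ [A oA <-]; rewrite setTI; apply: sub_sigma_algebra.
have /continuousP := @mulmx_continuous R[i] N N L U; exact.
Qed.

End Borel.

Lemma conjCE (R : realType) (x y : R) : Num.conj (x +i* y) = x -i* y.
Proof. by []. Qed.

Lemma Re_mulC (R : realType) (z w : R[i]) :
  complex.Re (z * w) =
  complex.Re z * complex.Re w - complex.Im z * complex.Im w.
Proof. by case: z w => [? ?] [? ?]. Qed.

Lemma Im_mulC (R : realType) (z w : R[i]) :
  complex.Im (z * w) =
  complex.Re z * complex.Im w + complex.Im z * complex.Re w.
Proof. by case: z w => [? ?] [? ?]. Qed.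

(** * The Stiefel manifold and invariance of the mean *)

Section Stiefel.
Context (R : realType) (L N : nat).
Local Notation T := (borelMx R N L).
Local Notation D := (stiefel R L N).

(** The equation of the manifold amounts to finitely many real equations [re] and [im], polynomial
    in the real and imaginary parts of the entries; each one cuts out the preimage of a point. *)
Lemma measurable_stiefel : measurable D.
Proof.
pose re (i j : 'I_L) (Phi : T) : R := \sum_k
  (complex.Re ((Phi : 'M[R[i]]_(N, L)) k i) * complex.Re ((Phi : 'M[R[i]]_(N, L)) k j)
  + complex.Im ((Phi : 'M[R[i]]_(N, L)) k i) * complex.Im ((Phi : 'M[R[i]]_(N, L)) k j)).
pose im (i j : 'I_L) (Phi : T) : R := \sum_k
  (complex.Re ((Phi : 'M[R[i]]_(N, L)) k i) * complex.Im ((Phi : 'M[R[i]]_(N, L)) k j)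
  - complex.Im ((Phi : 'M[R[i]]_(N, L)) k i) * complex.Re ((Phi : 'M[R[i]]_(N, L)) k j)).
have mre i j : measurable_fun setT (re i j).
  apply: measurable_sum => k; apply: measurable_funD; apply: measurable_funM;
  by [exact: Re_coord_measurable | exact: Im_coord_measurable].
have mim i j : measurable_fun setT (im i j).
  apply: measurable_sum => k; apply: measurable_funB; apply: measurable_funM;
  by [exact: Re_coord_measurable | exact: Im_coord_measurable].
have gramE (Phi : 'M[R[i]]_(N, L)) i j :
    (Phi^t* *m Phi) i j = re i j Phi +i* im i j Phi.
  rewrite mxE; apply/eqP; rewrite eq_complex /=; apply/andP; split; apply/eqP.
    rewrite (raddf_sum (@complex.Re R : {additive R[i] -> R})) /re.
    apply: eq_bigr => k _; rewrite /= Re_mulC !mxE.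
    by case: (Phi k i) => a b; rewrite conjCE /= mulNr opprK.
  rewrite (raddf_sum (@complex.Im R : {additive R[i] -> R})) /im.
  apply: eq_bigr => k _; rewrite /= Im_mulC !mxE.
  by case: (Phi k i) => a b; rewrite conjCE /= mulNr.
have -> : D = \bigcap_(ij in [set: 'I_L * 'I_L])
    ((setT `&` re ij.1 ij.2 @^-1` [set (ij.1 == ij.2)%:R]) `&`
     (setT `&` im ij.1 ij.2 @^-1` [set 0])).
  apply/seteqP; split => [Phi hPhi [i j] _ /=|Phi hPhi].
    have := gramE Phi i j; rewrite hPhi mxE => /esym/eqP; rewrite eq_complex.
    by case: (i == j) => /= /andP[/eqP -> /eqP ->].
  apply/matrixP => i j; rewrite gramE.
  by have [[_ /= ->] [_ /= ->]] := hPhi (i, j) Logic.I; rewrite mxE; case: (i == j).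
apply: fin_bigcap_measurable; first exact: finite_finset.
move=> ij _; apply: measurableI.
  by apply: mre => //; exact: measurable_set1.
by apply: mim => //; exact: measurable_set1.
Qed.

Lemma stiefel_coord_le (Phi : 'M[R[i]]_(N, L)) i j : D Phi -> `|Phi i j| <= 1.
Proof.
move=> DPhi; have /matrixP/(_ j j) : Phi^t* *m Phi = 1%:M by exact: DPhi.
rewrite !mxE eqxx mulr1n (bigD1 i) //= !mxE mulrC -normCK => e.
rewrite -(@expr_le1 _ 2) // -e lerDl sumr_ge0 // => k _.
by rewrite !mxE mulrC -normCK exprn_ge0.
Qed.

Lemma stiefel_mulmx (U : 'M[R[i]]_N) (Phi : 'M[R[i]]_(N, L)) :
  U \is unitarymx -> D (U *m Phi) = D Phi.
Proof.
move=> /unitarymxP UU.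
have UU' : U^t* *m U = 1%:M by apply: mulmx1C.
rewrite /stiefel /= trmx_mul map_mxM -mulmxA [_ *m (U *m _)]mulmxA UU'.
by rewrite mul1mx.
Qed.

Lemma coord_bmeasC i j : bmeasC D (fun Phi : T => (Phi : 'M[R[i]]_(N, L)) i j).
Proof.
split; split.
- by apply: measurable_funTS; exact: Re_coord_measurable.
- by exists 1 => Phi /stiefel_coord_le - /(_ i j)/norm_Re_le.
- by apply: measurable_funTS; exact: Im_coord_measurable.
- by exists 1 => Phi /stiefel_coord_le - /(_ i j)/norm_Im_le.
Qed.

Lemma adj_coord_bmeasC i j :
  bmeasC D (fun Phi : T => ((Phi : 'M[R[i]]_(N, L))^t*) i j).
Proof.
have [re im] := coord_bmeasC j i; split.
  rewrite (_ : (fun _ => _) = fun Phi : T => complex.Re ((Phi : 'M[R[i]]_(N, L)) j i)) //.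
  by apply/funext => Phi; rewrite !mxE; case: (_ j i).
rewrite (_ : (fun _ => _) = fun Phi : T => - complex.Im ((Phi : 'M[R[i]]_(N, L)) j i)) //.
  exact: bmeasN.
by apply/funext => Phi; rewrite !mxE; case: (_ j i).
Qed.

Variable mu : probability T R.
Hypothesis mu_iso : isotropic mu.

(** Change of variables along Phi -> U Phi. The pushforward formula is applied to a function
    measurable on the whole space, while [g] is controlled on the manifold only; hence its extension
    [F] by zero, the manifold being stable under U. *)
Lemma isotropic_Rintegral (U : 'M[R[i]]_N) (g : T -> R) :
  U \is unitarymx -> bmeas D g ->
  Rintegral mu D (fun Phi => g (U *m (Phi : 'M[R[i]]_(N, L)) : T)) =
  Rintegral mu D g.
Proof.
move=> Uu bg; have [muD inv] := mu_iso.
pose phi (Phi : T) : T := U *m (Phi : 'M[R[i]]_(N, L)).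
have mphi : measurable_fun setT phi := mulmx_measurable U.
have mD := measurable_stiefel.
have phiD : phi @^-1` D = D.
  by apply/funext => Phi; exact: stiefel_mulmx.
pose F : T -> \bar R := (EFin \o g) \_ D.
have mF : measurable_fun setT F.
  by apply/(measurable_restrictT _ mD)/measurable_EFinP; case: bg.
have FE x : x \in D -> F x = (g x)%:E by move=> xD; rewrite /F patchE xD.
congr fine.
transitivity (\int[mu]_(x in phi @^-1` D) (F \o phi) x)%E.
  rewrite phiD; apply: eq_integral => x xD; rewrite /= FE //.
  by apply/mem_set; rewrite /phi stiefel_mulmx //; exact/set_mem.
rewrite -integral_pushforward //.
  transitivity (\int[mu]_(x in D) F x)%E.
    apply: eq_measure_integral => A mA _; rewrite /pushforward.
    exact: inv.
  by apply: eq_integral => x xD; rewrite FE.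
rewrite phiD.
apply: (@eq_integrable _ _ _ _ _ mD (EFin \o (fun Phi => g (phi Phi)))).
  move=> x xD; rewrite /= FE //.
  by apply/mem_set; rewrite /phi stiefel_mulmx //; exact/set_mem.
apply: (bmeas_integrable mD muD); case: bg => mg [M gM]; split.
  apply/measurable_EFinP.
  apply: (@eq_measurable_fun _ _ _ _ D (F \o phi)).
    move=> x xD; rewrite /= FE //.
  by apply/mem_set; rewrite /phi stiefel_mulmx //; exact/set_mem.
  apply: measurable_funTS; exact: measurableT_comp.
by exists M => x Dx; apply: gM; rewrite stiefel_mulmx.
Qed.

Lemma isotropic_EC (U : 'M[R[i]]_N) (g : T -> R[i]) :
  U \is unitarymx -> bmeasC D g ->
  Cintegral mu D (fun Phi => g (U *m (Phi : 'M[R[i]]_(N, L)) : T)) =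
  Cintegral mu D g.
Proof.
move=> Uu [g1 g2]; rewrite /Cintegral.
by rewrite (isotropic_Rintegral Uu g1) (isotropic_Rintegral Uu g2).
Qed.

End Stiefel.

(** * The loop equation *)

Lemma mxtrace_mul_delta (K : comNzRingType) n (M : 'M[K]_n) i j :
  \tr (M *m delta_mx i j) = M j i.
Proof.
rewrite /mxtrace (bigD1 j) //= big1 ?addr0 => [|k kj].
  rewrite mxE (bigD1 i) //= big1 ?addr0 => [|l li].
    by rewrite mxE !eqxx mulr1.
  by rewrite mxE (negbTE li) mulr0.
by rewrite mxE big1 // => l _; rewrite mxE (negbTE kj) andbF mulr0.
Qed.

Lemma sum_mxtrace_delta (K : comNzRingType) n (A B : 'M[K]_n) :
  \sum_i \sum_j \tr (A *m delta_mx i j) * \tr (B *m delta_mx j i) =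
  \tr (A *m B).
Proof.
rewrite exchange_big; apply: eq_bigr => i _; rewrite mxE; apply: eq_bigr => j _.
by rewrite !mxtrace_mul_delta.
Qed.

Lemma mxtrace_rotation (K : comNzRingType) n (q P Z : 'M[K]_n) (a : K) :
  \tr ((1%:M + a *: q) *m P *m (1%:M + a *: (1%:M - q)) *m Z) =
  \tr (P *m Z) + (\tr ((q *m P - P *m q) *m Z) + \tr (P *m Z)) * a
  + \tr (q *m P *m (1%:M - q) *m Z) * a ^+ 2.
Proof.
rewrite mulmxDl mul1mx -scalemxAl mulmxDr mulmx1 -scalemxAr.
set Y := 1%:M - q; rewrite (mulmxDl P) -scalemxAl scalerDr scalerA -expr2.
rewrite !mulmxDl -!scalemxAl !mxtraceD !mxtraceZ.
have -> : P *m Y *m Z = P *m Z - P *m q *m Z by rewrite mulmxBr mulmx1 mulmxBl.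
by rewrite mulNmx raddfB raddfN /=; ring.
Qed.

(* The Moebius images of the integers are infinitely many points of the unit
   circle. *)
Definition circle_point (R : realType) (k : nat) : R[i] :=
  (1 + 'i * k%:R) / (1 - 'i * k%:R).

Lemma conjCi (R : realType) : Num.conj ('i : R[i]) = - 'i.
Proof. by rewrite conjCE; apply/eqP; rewrite eq_complex /= oppr0 !eqxx. Qed.

Section CirclePoint.
Context (R : realType).
Local Notation z := (@circle_point R).

Lemma circle_den (k : nat) : (1 - 'i * k%:R : R[i]) != 0.
Proof.
rewrite -[k%:R](rmorph_nat (real_complex R)) /=.
rewrite eq_complex /= !(mul0r, mul1r, mulr0, subr0, addr0, oppr0, add0r).
by rewrite oner_eq0.
Qed.

Lemma circle_num (k : nat) : (1 + 'i * k%:R : R[i]) != 0.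
Proof.
rewrite -[k%:R](rmorph_nat (real_complex R)) /=.
rewrite eq_complex /= !(mul0r, mul1r, mulr0, subr0, addr0, oppr0, add0r).
by rewrite oner_eq0.
Qed.

Lemma circle_conj k : Num.conj (z k) = (z k)^-1.
Proof.
rewrite /circle_point invf_div rmorphM fmorphV /= rmorphB rmorphD /=.
rewrite rmorphM /= rmorph1 rmorph_nat.
by rewrite conjCi !mulNr opprK.
Qed.

Lemma circle_neq0 k : z k != 0.
Proof. by rewrite mulf_neq0 ?invr_eq0 ?circle_num ?circle_den. Qed.

Lemma circle_inj : injective z.
Proof.
move=> k l /eqP; rewrite eqr_div ?circle_den // => /eqP e.
have /eqP : 'i * 2 * (k%:R - l%:R) = 0 :> R[i].
  have -> : 'i * 2 * (k%:R - l%:R) = (1 + 'i * k%:R) * (1 - 'i * l%:R)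
    - (1 + 'i * l%:R) * (1 - 'i * k%:R) :> R[i] by ring.
  by rewrite e subrr.
rewrite mulf_eq0 mulf_eq0 subr_eq0 eqr_nat pnatr_eq0 /=.
by rewrite eq_complex /= oner_eq0 andbF /= => /eqP.
Qed.

Lemma poly_circle (p : {poly R[i]}) : (forall k, p.[z k - 1] = 0) -> p = 0.
Proof.
move=> pz; apply/eqP; apply/negPn/negP => p0.
have roots_p : all (root p) [seq z k - 1 | k <- iota 0 (size p)].
  by apply/allP => _ /mapP[k _ ->]; apply/rootP.
have uniq_p : uniq [seq z k - 1 | k <- iota 0 (size p)].
  by rewrite map_inj_uniq ?iota_uniq // => k l /addIr /circle_inj.
by have := max_poly_roots p0 roots_p uniq_p; rewrite size_map size_iota ltnn.
Qed.

End CirclePoint.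

(** Polarization: on v = e_i + w e_j the cross terms leave w G(E_ji) + conj(w) G(E_ij) = 0, and the
    values w = 1 and w = i separate the two. *)
Lemma rank1_delta_eq0 (R : realType) N (G : 'M[R[i]]_N -> R[i]) :
  (forall X Y, G (X + Y) = G X + G Y) -> (forall a X, G (a *: X) = a * G X) ->
  (forall v : 'cV_N, G (v *m v^t*) = 0) -> forall i j, G (delta_mx i j) = 0.
Proof.
move=> GD GZ G1 i j.
have [e ee] : exists e : 'I_N -> 'cV[R[i]]_N,
    forall k l, e k *m (e l)^t* = delta_mx k l.
  exists (fun k => delta_mx k 0) => k l.
  by rewrite trmx_delta map_delta_mx mul_delta_mx.
have expand (a b : 'cV[R[i]]_N) w : (a + w *: b) *m (a + w *: b)^t* =
    a *m a^t* + Num.conj w *: (a *m b^t*)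
    + (w *: (b *m a^t*) + (w * Num.conj w) *: (b *m b^t*)).
  rewrite linearD /= map_mxD linearZ /= map_mxZ mulmxDl !mulmxDr.
  by rewrite -!scalemxAr -!scalemxAl scalerA mulrC.
have polar w : w * G (delta_mx j i) + Num.conj w * G (delta_mx i j) = 0.
  have := G1 (e i + w *: e j).
  by rewrite expand !GD !GZ !G1 mulr0 addr0 add0r !ee addrC.
have /eqP := polar 1; rewrite rmorph1 !mul1r addr_eq0 => /eqP e1.
have /eqP := polar 'i; rewrite e1 conjCi mulrN mulNr -opprD oppr_eq0 -mulrDr.
rewrite mulf_eq0 eq_complex /= oner_eq0 andbF /= -mulr2n mulrn_eq0 /= => /eqP.
by [].
Qed.

Section LoopEquation.
Context (R : realType) (L N : nat).
Variables (mu : probability (borelMx R N L) R) (mu_iso : isotropic mu).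
Variables (Q : 'M[R[i]]_L) (QQ : Q *m Q = Q).
Local Notation T := (borelMx R N L).
Local Notation D := (stiefel R L N).
Local Notation E := (Cintegral mu D).

(** With Q = 1 this is the projection P of the problem; with Q a diagonal matrix unit it is the
    rank-one projection on a column of Phi. A single loop equation thus serves both uses. *)
Definition proj (Phi : T) : 'M[R[i]]_N :=
  (Phi : 'M[R[i]]_(N, L)) *m Q *m (Phi : 'M[R[i]]_(N, L))^t*.

Lemma proj_idem Phi : D Phi -> proj Phi *m proj Phi = proj Phi.
Proof.
move=> DPhi; rewrite /proj -!mulmxA [_^t* *m (_ *m _)]mulmxA DPhi mul1mx.
by rewrite [Q *m (Q *m _)]mulmxA QQ.
Qed.

Lemma trace_proj Phi : D Phi -> \tr (proj Phi) = \tr Q.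
Proof. by move=> DPhi; rewrite /proj mxtrace_mulC mulmxA DPhi mul1mx. Qed.

Lemma proj_bmeasC i j : bmeasC D (fun Phi => proj Phi i j).
Proof.
apply: bmeasC_mulmx => k l; last exact: adj_coord_bmeasC.
apply: bmeasC_mulmx => k' l'; first exact: coord_bmeasC.
exact: bmeasC_cst.
Qed.

Lemma mul_proj_bmeasC (A B : 'M[R[i]]_N) i j :
  bmeasC D (fun Phi => (A *m proj Phi *m B) i j).
Proof.
apply: bmeasC_mulmx => k l; last exact: bmeasC_cst.
apply: bmeasC_mulmx => k' l'; last exact: proj_bmeasC.
exact: bmeasC_cst.
Qed.

Lemma trace_proj_bmeasC (A : 'M[R[i]]_N) :
  bmeasC D (fun Phi => \tr (proj Phi *m A)).
Proof.
apply: bmeasC_trace => i j; apply: bmeasC_mulmx => k l.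
  exact: proj_bmeasC.
exact: bmeasC_cst.
Qed.

Lemma trace_mul_proj_bmeasC (A B : 'M[R[i]]_N) :
  bmeasC D (fun Phi => \tr (A *m proj Phi *m B)).
Proof. by apply: bmeasC_trace => i j; exact: mul_proj_bmeasC. Qed.

Definition leg (X Z : 'M[R[i]]_N) (Phi : T) : R[i] :=
  \tr ((X *m proj Phi - proj Phi *m X) *m Z).

Lemma leg_bmeasC X Z : bmeasC D (leg X Z).
Proof.
apply: bmeasC_trace => i j; apply: bmeasC_mulmx => k l; last exact: bmeasC_cst.
rewrite /= (_ : (fun _ => _) = fun Phi => (X *m proj Phi) k l - (proj Phi *m X) k l).
  apply: bmeasCB; apply: bmeasC_mulmx => k' l'; by [exact: bmeasC_cst | exact: proj_bmeasC].
by apply/funext => Phi; rewrite !mxE.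
Qed.

Variables (I : finType) (S : {set I}) (B : I -> 'M[R[i]]_N).

Definition prod_legs (Phi : T) : R[i] := \prod_(l in S) \tr (proj Phi *m B l).
Definition prod_legs_but (k : I) (Phi : T) : R[i] :=
  \prod_(l in S | l != k) \tr (proj Phi *m B l).

Lemma prod_legs_bmeasC : bmeasC D prod_legs.
Proof. by apply: bmeasC_prod => l _; exact: trace_proj_bmeasC. Qed.

Lemma prod_legs_but_bmeasC k : bmeasC D (prod_legs_but k).
Proof. by apply: bmeasC_prod => l _; exact: trace_proj_bmeasC. Qed.

(* The derivative of [prod_legs Phi * \tr (proj Phi *m B0)] along the
   (complexified) infinitesimal unitary X. *)
Definition variation (X B0 : 'M[R[i]]_N) (Phi : T) : R[i] :=
  leg X B0 Phi * prod_legs Phi +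
  \tr (proj Phi *m B0) * \sum_(k in S) leg X (B k) Phi * prod_legs_but k Phi.

Lemma variation_bmeasC X B0 : bmeasC D (variation X B0).
Proof.
apply: bmeasCD; apply: bmeasCM.
- exact: leg_bmeasC.
- exact: prod_legs_bmeasC.
- exact: trace_proj_bmeasC.
- apply: bmeasC_sum => k _; apply: bmeasCM; first exact: leg_bmeasC.
  exact: prod_legs_but_bmeasC.
Qed.

Section Rotation.
Variables (q B0 : 'M[R[i]]_N).
Hypotheses (qq : q *m q = q) (q_herm : q^t* = q).

(** For U = 1 + (z - 1) q this is z Tr(U P U^* Z) as a polynomial in z - 1; the factor z clears the
    denominator due to conj(z) = 1/z. *)
Definition rotated (Phi : T) (Z : 'M[R[i]]_N) : {poly R[i]} :=
  (\tr (proj Phi *m Z))%:P + (leg q Z Phi + \tr (proj Phi *m Z))%:P * 'X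
  + (\tr (q *m proj Phi *m (1%:M - q) *m Z))%:P * 'X^2.

Lemma unitary_rot k : 1%:M + (circle_point R k - 1) *: q \is unitarymx.
Proof.
apply/unitarymxP; rewrite linearD /= map_mxD trmx1 map_mx1 linearZ /= map_mxZ.
rewrite q_herm rmorphB rmorph1 /= circle_conj mulmxDl mul1mx mulmxDr mulmx1.
rewrite -scalemxAl -scalemxAr qq scalerA -addrA -!scalerDl -[RHS]addr0.
congr (_ + _); rewrite -[RHS](scale0r q); congr (_ *: _).
have := mulfV (circle_neq0 R k); move: (circle_point R k) => w ww.
by transitivity (w / w - 1); [ring | rewrite ww subrr].
Qed.

Lemma horner_rotated k Phi Z :
  (rotated Phi Z).[circle_point R k - 1] = circle_point R k *
  \tr (proj ((1%:M + (circle_point R k - 1) *: q) *m Phi : 'M[R[i]]_(N, L)) *m Z).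
Proof.
set w := circle_point R k; set P := proj Phi.
have -> : proj ((1%:M + (w - 1) *: q) *m Phi : 'M[R[i]]_(N, L)) =
    (1%:M + (w - 1) *: q) *m P *m (1%:M + (w^-1 - 1) *: q).
  rewrite /P /proj trmx_mul map_mxM /= !mulmxA; congr (_ *m _).
  rewrite linearD /= map_mxD trmx1 map_mx1 linearZ /= map_mxZ q_herm rmorphB.
  by rewrite ?rmorph1 /= ?circle_conj.

have -> : w * \tr ((1%:M + (w - 1) *: q) *m P *m (1%:M + (w^-1 - 1) *: q) *m Z) =
    \tr ((1%:M + (w - 1) *: q) *m P *m (1%:M + (w - 1) *: (1%:M - q)) *m Z).
  rewrite -mxtraceZ scalemxAl scalemxAr; congr (\tr (_ *m _ *m _)).
  rewrite scalerDr scalerA mulrBr mulfV ?circle_neq0 // mulr1 scalerBr.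
  rewrite -[- (_ *: q)]scaleNr opprB addrA; congr (_ + _).
  by rewrite scalerBl scale1r subrKC.
rewrite mxtrace_rotation /rotated /leg -/P !hornerD !hornerM !hornerC.
by rewrite !hornerX.
Qed.

Lemma rotated0 Phi Z : (rotated Phi Z)`_0 = \tr (proj Phi *m Z).
Proof.
by rewrite -horner_coef0 /rotated !hornerE /= !mulr0 !addr0.
Qed.

Lemma deriv_rotated0 Phi Z :
  ((rotated Phi Z)^`())`_0 = leg q Z Phi + \tr (proj Phi *m Z).
Proof.
rewrite -horner_coef0 /rotated !derivD !derivM !derivC !derivX !hornerE.
by rewrite /= ?(mulr0, mul0r, addr0, add0r).
Qed.

Lemma size_rotated Phi Z : (size (rotated Phi Z) <= 3)%N.
Proof.
rewrite /rotated (leq_trans (size_polyD _ _)) // geq_max; apply/andP; split.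
  rewrite (leq_trans (size_polyD _ _)) // geq_max.
  rewrite (leq_trans (size_polyC_leq1 _)) //= mul_polyC.
  by rewrite (leq_trans (size_scale_leq _ _)) // size_polyX.
by rewrite mul_polyC (leq_trans (size_scale_leq _ _)) // size_polyXn.
Qed.

Lemma coef_rotated_bmeasC Z k : bmeasC D (fun Phi => (rotated Phi Z)`_k).
Proof.
apply: (@bmeasC_ext _ _ _ _ (fun Phi =>
  \tr (proj Phi *m Z) * (k == 0%N)%:R
  + (leg q Z Phi + \tr (proj Phi *m Z)) * (k == 1%N)%:R
  + \tr (q *m proj Phi *m ((1%:M - q) *m Z)) * (k == 2%N)%:R)).
  move=> Phi; rewrite /rotated !coefD !coefCM coefX coefXn coefC mulmxA.
  by case: (k == 0%N); rewrite ?mulr1 ?mulr0.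
apply: bmeasCD; first apply: bmeasCD.
- by apply: bmeasCM; [exact: trace_proj_bmeasC | exact: bmeasC_cst].
- apply: bmeasCM; last exact: bmeasC_cst.
  by apply: bmeasCD; [exact: leg_bmeasC | exact: trace_proj_bmeasC].
- by apply: bmeasCM; [exact: trace_mul_proj_bmeasC | exact: bmeasC_cst].
Qed.

Definition rotated_prod (Phi : T) : {poly R[i]} :=
  rotated Phi B0 * \prod_(l in S) rotated Phi (B l).

Lemma coef_prod_bmeasC (J : Type) (r : seq J) (P : pred J)
    (F : J -> T -> {poly R[i]}) :
  (forall j k, P j -> bmeasC D (fun Phi => (F j Phi)`_k)) ->
  forall k, bmeasC D (fun Phi => (\prod_(j <- r | P j) F j Phi)`_k).
Proof.
move=> bF; elim: r => [|j r IH] k.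
  apply: (bmeasC_ext _ (bmeasC_cst _ (1 : {poly R[i]})`_k)) => Phi.
  by rewrite big_nil.
case Pj: (P j); last first.
  by apply: bmeasC_ext (IH k) => Phi; rewrite big_cons Pj.
apply: (@bmeasC_ext _ _ _ _ (fun Phi => \sum_(i < k.+1)
    (F j Phi)`_i * (\prod_(j <- r | P j) F j Phi)`_(k - i))).
  by move=> Phi; rewrite big_cons Pj coefM.
by apply: bmeasC_sum => i _; apply: bmeasCM; [exact: bF | exact: IH].
Qed.

Lemma coef_rotated_prod_bmeasC k : bmeasC D (fun Phi => (rotated_prod Phi)`_k).
Proof.
apply: (@bmeasC_ext _ _ _ _ (fun Phi => \sum_(i < k.+1)
    (rotated Phi B0)`_i * (\prod_(l in S) rotated Phi (B l))`_(k - i))).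
  by move=> Phi; rewrite coefM.
apply: bmeasC_sum => i _; apply: bmeasCM; first exact: coef_rotated_bmeasC.
by apply: coef_prod_bmeasC => l k' _; exact: coef_rotated_bmeasC.
Qed.

(** By invariance the mean of [rotated_prod] at z - 1 is z^n times its mean c at 0. This holds for
    infinitely many z, so the mean is the polynomial c (1 + X)^n. Its linear coefficient n c is
    exactly the contribution of the n added factors z, which leaves 0 for the variation. *)
Lemma loop_rotation : E (variation q B0) = 0.
Proof.
have [muD _] := mu_iso; have mD := @measurable_stiefel R L N.
pose n := #|S|.+1; pose m := (n * 3).+1.
have coef0P Phi : (rotated_prod Phi)`_0 = \tr (proj Phi *m B0) * prod_legs Phi.
  rewrite -horner_coef0 hornerM horner_prod horner_coef0 rotated0; congr (_ * _).
  by apply: eq_bigr => l _; rewrite horner_coef0 rotated0.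
have coef1P Phi : (rotated_prod Phi)`_1 =
    variation q B0 Phi + (rotated_prod Phi)`_0 *+ n.
  have -> : (rotated_prod Phi)`_1 = ((rotated_prod Phi)^`())`_0.
    by rewrite coef_deriv mulr1n.
  have prodE : (\prod_(l in S) rotated Phi (B l)).[0] = prod_legs Phi.
    rewrite horner_prod; apply: eq_bigr => l _.
    by rewrite horner_coef0 rotated0.
  have sumE : (\sum_(k in S) (rotated Phi (B k))^`() *
      \prod_(l in S | l != k) rotated Phi (B l)).[0] =
      \sum_(k in S) leg q (B k) Phi * prod_legs_but k Phi
      + prod_legs Phi * #|S|%:R.
    rewrite horner_sum mulr_natr -sumr_const -big_split /=.
    apply: eq_bigr => k kS.
    rewrite hornerM horner_coef0 deriv_rotated0 mulrDl horner_prod.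
    have -> : \prod_(l in S | l != k) (rotated Phi (B l)).[0] =
        prod_legs_but k Phi.
      by apply: eq_bigr => l _; rewrite horner_coef0 rotated0.
    by congr (_ + _); rewrite /prod_legs (bigD1 k).
  rewrite derivM deriv_prod -[LHS]horner_coef0 hornerD !hornerM sumE prodE.
  rewrite !horner_coef0 deriv_rotated0 rotated0 coef0P /variation.
  by rewrite -[_ *+ n]mulr_natr /n -natr1; ring.
have size_P Phi : (size (rotated_prod Phi) <= m)%N.
  rewrite (leq_trans (size_polyMleq _ _)) //.
  have h1 := size_rotated Phi B0.
  have h2 : (size (\prod_(l in S) rotated Phi (B l) : {poly R[i]})%R <= (#|S| * 3).+1)%N.
    rewrite (leq_trans (size_poly_prod_leq _ _)) // leq_subLR addnS ltnS.
    apply: leq_trans (leq_addl _ _).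
    by rewrite -sum_nat_const leq_sum // => l _; exact: size_rotated.
  by rewrite /m /n; lia.
pose ep : {poly R[i]} := \poly_(k < m) E (fun Phi => (rotated_prod Phi)`_k).
have ep_eq : ep = E (fun Phi => (rotated_prod Phi)`_0) *: (1 + 'X) ^+ n.
  apply/eqP; rewrite -subr_eq0; apply/eqP/poly_circle => k.
  rewrite hornerD hornerN hornerZ horner_exp hornerD hornerX hornerC subrKC.
  apply/eqP; rewrite subr_eq0; apply/eqP.
  have bz j : bmeasC D (fun Phi => (circle_point R k - 1) ^+ j * (rotated_prod Phi)`_j).
    exact/bmeasCZ/coef_rotated_prod_bmeasC.
  transitivity (E (fun Phi => (rotated_prod Phi).[circle_point R k - 1])).
    rewrite horner_poly.
    transitivity (\sum_(j < m) E (fun Phi =>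
        (circle_point R k - 1) ^+ j * (rotated_prod Phi)`_j)).
      apply: eq_bigr => j _; rewrite (EC_scale mD muD); first exact: mulrC.
      exact: coef_rotated_prod_bmeasC.
    rewrite -(EC_sum mD muD) //; apply: eq_EC => Phi _.
    rewrite (horner_coef_wide _ (size_P Phi)).
    by apply: eq_bigr => j _; rewrite mulrC.
  rewrite mulrC -(EC_scale mD muD); last exact: coef_rotated_prod_bmeasC.
  have bg : bmeasC D (fun Phi => circle_point R k ^+ n * (rotated_prod Phi)`_0).
    exact/bmeasCZ/coef_rotated_prod_bmeasC.
  rewrite -(isotropic_EC mu_iso (unitary_rot k) bg).
  apply: eq_EC => Phi _; rewrite /= coef0P hornerM horner_prod.
  rewrite (eq_bigr _ (fun l _ => horner_rotated k Phi (B l))) big_split /=.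
  by rewrite prodr_const horner_rotated exprS /prod_legs; ring.
have /(congr1 (fun p : {poly R[i]} => p`_1)) := ep_eq.
rewrite coef_poly coefZ /m /n ltnS muln_gt0 /=.
have -> : ((1 + 'X) ^+ n : {poly R[i]})`_1 = n%:R.
  rewrite -[LHS]mulr1n -coef_deriv deriv_exp derivD derivX -polyC1 derivC add0r.
  rewrite mul1r -horner_coef0 hornerMn horner_exp !hornerE /= expr1n.
  by [].
rewrite (_ : E _ = E (variation q B0)
    + n%:R * E (fun Phi => (rotated_prod Phi)`_0)).
  by rewrite mulrC => /eqP; rewrite -subr_eq0 addrK => /eqP.
rewrite -(EC_scale mD muD); last exact: coef_rotated_prod_bmeasC.
rewrite -(EC_add mD muD); first last.
- exact/bmeasCZ/coef_rotated_prod_bmeasC.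
- exact: variation_bmeasC.
by apply: eq_EC => Phi _; rewrite coef1P mulr_natl.
Qed.

End Rotation.

Lemma legD X Y Z Phi : leg (X + Y) Z Phi = leg X Z Phi + leg Y Z Phi.
Proof.
rewrite /leg [(X + Y) *m proj _]mulmxDl [_ *m (X + Y)]mulmxDr opprD addrACA.
move: (X *m _ - _) (Y *m _ - _) => U V; by rewrite mulmxDl mxtraceD.
Qed.

Lemma legZ a X Z Phi : leg (a *: X) Z Phi = a * leg X Z Phi.
Proof. by rewrite /leg -scalemxAl -scalemxAr -scalerBr -scalemxAl mxtraceZ. Qed.

Lemma variationD X Y B0 Phi :
  variation (X + Y) B0 Phi = variation X B0 Phi + variation Y B0 Phi.
Proof.
rewrite /variation legD mulrDl addrACA -mulrDr -big_split; congr (_ + _ * _).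
by apply: eq_bigr => k _; rewrite legD mulrDl.
Qed.

Lemma variationZ a X B0 Phi :
  variation (a *: X) B0 Phi = a * variation X B0 Phi.
Proof.
rewrite /variation legZ mulrDr -mulrA [a * (\tr _ * _)]mulrCA; congr (_ + _ * _).
by rewrite mulr_sumr; apply: eq_bigr => k _; rewrite legZ mulrA.
Qed.

Let muD : mu D = 1%E := proj1 mu_iso.
Let mD := @measurable_stiefel R L N.

Lemma E_variationD X Y B0 :
  E (variation (X + Y) B0) = E (variation X B0) + E (variation Y B0).
Proof.
rewrite -(EC_add mD muD); try exact: variation_bmeasC.
by apply: eq_EC => Phi _; rewrite variationD.
Qed.

Lemma E_variationZ a X B0 :
  E (variation (a *: X) B0) = a * E (variation X B0).
Proof.
rewrite -(EC_scale mD muD); last exact: variation_bmeasC.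
by apply: eq_EC => Phi _; rewrite variationZ.
Qed.

(** For v nonzero, v v^* is |v|^2 times an orthogonal projection, to which [loop_rotation]
    applies. *)
Lemma loop_rank1 (v : 'cV[R[i]]_N) B0 : E (variation (v *m v^t*) B0) = 0.
Proof.
pose c := (v^t* *m v) 0 0.
have cE : v^t* *m v = c%:M by rewrite [LHS]mx11_scalar.
have c_conj : Num.conj c = c.
  rewrite /c !mxE rmorph_sum; apply: eq_bigr => k _.
  by rewrite rmorphM /= !mxE conjCK mulrC.
have [c0|c0] := eqVneq c 0.
  suff -> : v = 0 by rewrite mul0mx -[0](scale0r 0) E_variationZ mul0r.
  apply/colP => k; rewrite mxE; apply/eqP; rewrite -normr_eq0 -sqrf_eq0.
  have : \sum_k `|v k 0| ^+ 2 = 0.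
    rewrite -[RHS]c0 /c mxE; apply: eq_bigr => l _.
    by rewrite !mxE normCK mulrC.
  by move=> /psumr_eq0P -> // l _; rewrite exprn_ge0.
have -> : v *m v^t* = c *: (c^-1 *: (v *m v^t*)).
  by rewrite scalerA mulfV // scale1r.
rewrite E_variationZ loop_rotation ?mulr0 //.
  rewrite -scalemxAl -scalemxAr mulmxA -[v *m _ *m v]mulmxA cE mul_mx_scalar.
  by rewrite -scalemxAl !scalerA mulVf // mulr1.
rewrite linearZ /= map_mxZ trmx_mul map_mxM /= map_trmx -map_mx_comp trmxK.
by rewrite (map_mx_id (@conjCK _)) fmorphV /= c_conj.
Qed.

Lemma loop_delta i j B0 : E (variation (delta_mx i j) B0) = 0.
Proof.
apply: (rank1_delta_eq0 (G := fun X => E (variation X B0))) => *.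
- exact: E_variationD.
- exact: E_variationZ.
- exact: loop_rank1.
Qed.

(** The variations along all matrix units E_ij are summed, with [B0] replaced by B0 E_ji.
    Contracting the indices splits the trace of the varied factor into two and joins it with each of
    the other traces. *)
Lemma loop_equation (B0 : 'M[R[i]]_N) :
  E (fun Phi => (N%:R * \tr (proj Phi *m B0) - \tr Q * \tr B0) * prod_legs Phi
    + \sum_(k in S) (\tr (proj Phi *m B0 *m proj Phi *m B k)
        - \tr (proj Phi *m B0 *m B k)) * prod_legs_but k Phi) = 0.
Proof.
transitivity (E (fun Phi => \sum_i \sum_j
    variation (delta_mx i j) (B0 *m delta_mx j i) Phi)); last first.
  rewrite (EC_sum mD muD) ?big1 // => [i _|i _]; last first.
    by apply: bmeasC_sum => j _; exact: variation_bmeasC.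
  rewrite (EC_sum mD muD) ?big1 // => [j _|j _]; first exact: loop_delta.
  exact: variation_bmeasC.
apply: eq_EC => Phi DPhi.
have last_leg : \sum_i \sum_j leg (delta_mx i j) (B0 *m delta_mx j i) Phi =
    N%:R * \tr (proj Phi *m B0) - \tr Q * \tr B0.
  rewrite -(trace_proj DPhi) /leg; move: (proj Phi) => P.
  have term i j : \tr ((delta_mx i j *m P - P *m delta_mx i j) *m
      (B0 *m delta_mx j i)) = \tr (P *m B0 *m delta_mx j j) -
      \tr (P *m delta_mx i i) * \tr (B0 *m delta_mx j j).
    rewrite mulmxBl raddfB /=; congr (_ - _).
      by rewrite -[delta_mx i j *m P *m _]mulmxA mxtrace_mulC -!mulmxA mul_delta_mx.
    rewrite !mulmxA mxtrace_mul_delta -!mulmxA mxE !mxtrace_mul_delta.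
    rewrite (bigD1 i) //= big1 ?addr0 => [|k ki].
      congr (_ * _); rewrite mxE (bigD1 j) //= big1 ?addr0 => [|k kj].
        by rewrite mxE !eqxx mul1r.
      by rewrite mxE (negbTE kj) andbF mul0r.
    rewrite mxE big1 ?mulr0 // => l _.
    by rewrite mxE (negbTE ki) mul0r.
  under eq_bigr do under eq_bigr do rewrite term !mxtrace_mul_delta.
  under eq_bigr do rewrite sumrB -mulr_sumr.
  by rewrite sumrB sumr_const card_ord -mulr_suml mulr_natl.
have other_leg k : \sum_i \sum_j \tr (proj Phi *m (B0 *m delta_mx j i)) *
      leg (delta_mx i j) (B k) Phi =
    \tr (proj Phi *m B0 *m proj Phi *m B k) - \tr (proj Phi *m B0 *m B k).
  have legE i j : leg (delta_mx i j) (B k) Phi =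
      \tr (proj Phi *m B k *m delta_mx i j) -
      \tr (B k *m proj Phi *m delta_mx i j).
    rewrite /leg; move: (proj Phi) => P.
    rewrite mulmxBl raddfB /=; congr (_ - _).
      by rewrite [in RHS]mxtrace_mulC mulmxA.
    by rewrite mxtrace_mulC mulmxA.
  under eq_bigr do under eq_bigr do rewrite legE mulrBr mulmxA.
  under eq_bigr do rewrite sumrB.
  rewrite sumrB exchange_big sum_mxtrace_delta exchange_big sum_mxtrace_delta.
  rewrite mulmxA; congr (_ - _).
  (* Idempotence absorbs the second projection of Tr(P B0 B_k P). *)
  move: (proj Phi) (proj_idem DPhi) => P PP.
  by rewrite mulmxA [in LHS]mxtrace_mulC !mulmxA PP.
rewrite -last_leg.
rewrite (eq_bigr (fun k => \sum_i \sum_j \tr (proj Phi *m (B0 *m delta_mx j i)) *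
      leg (delta_mx i j) (B k) Phi * prod_legs_but k Phi)); last first.
  move=> k _; rewrite -other_leg mulr_suml; apply: eq_bigr => i _.
  by rewrite mulr_suml.
rewrite [X in _ + X]exchange_big [X in X + _]mulr_suml -big_split.
apply: eq_bigr => i _ /=.
rewrite [X in _ + X]exchange_big [X in X + _]mulr_suml -big_split.
apply: eq_bigr => j _ /=.
rewrite /variation mulr_sumr; congr (_ + _).
by apply: eq_bigr => k _; rewrite mulrA.
Qed.

End LoopEquation.

(** * Means of mixed determinants *)

(** Composition with the transposition of i and k restores the Leibniz expansion with [u] in row i,
    at the cost of a sign. *)
Lemma det_setrow_swap (K : comNzRingType) n (M : 'M[K]_n) (i k : 'I_n)
    (u : 'rV_n) : i != k ->
  \sum_(s : 'S_n) (-1) ^+ s *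
    (u 0 (s k) * (M k (s i) * \prod_(l | (l != i) && (l != k)) M l (s l))) =
  - \det (setrow i u M).
Proof.
move=> ik; rewrite det_setrow_perm (reindex_inj (mulgI (tperm i k))) -sumrN /=.
apply: eq_bigr => s _; rewrite odd_permM odd_tperm ik /= signrN mulNr.
rewrite !permM tpermL tpermR [in RHS](bigD1 k) 1?eq_sym //=.
congr (- (_ * (_ * (_ * _)))); apply: eq_bigr => l /andP[li lk].
by rewrite permM tpermD // eq_sym.
Qed.

(** Cofactor expansion along the replaced row, then adj(M) M = det M. *)
Lemma sum_det_setrow (K : comNzRingType) n (M : 'M[K]_n) (u : 'rV_n) j :
  \sum_k M k j * \det (setrow k u M) = u 0 j * \det M.
Proof.
under eq_bigr do rewrite det_setrow mulr_sumr.
rewrite exchange_big /=.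
transitivity (\sum_l u 0 l * (\adj M *m M) l j).
  apply: eq_bigr => l _; rewrite mxE mulr_sumr; apply: eq_bigr => k _.
  by rewrite [(\adj M) l k]mxE; ring.
rewrite mul_adj_mx (bigD1 j) //= big1 => [|l lj].
  by rewrite mxE eqxx mulr1n addr0.
by rewrite mxE (negbTE lj) mulr0n mulr0.
Qed.

Lemma det_setrowB (K : comNzRingType) n (M : 'M[K]_n) i (u v : 'rV_n) :
  \det (setrow i (u - v) M) = \det (setrow i u M) - \det (setrow i v M).
Proof.
rewrite !det_setrow -sumrB; apply: eq_bigr => j _.
by rewrite !mxE mulrBl.
Qed.

Lemma mxtrace_mul_rank1 (K : comNzRingType) n (P : 'M[K]_n) (c : 'cV_n)
    (r : 'rV_n) : \tr (P *m (c *m r)) = (r *m P *m c) 0 0.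
Proof. by rewrite mulmxA mxtrace_mulC mulmxA /mxtrace big_ord1. Qed.

Lemma mulmx_row_col (K : comNzRingType) m n p q (A : 'M[K]_(m, n))
    (P : 'M[K]_(n, p)) (B : 'M[K]_(p, q)) i j :
  (row i A *m P *m col j B) 0 0 = (A *m P *m B) i j.
Proof. by rewrite -row_mul !mxE; apply: eq_bigr => k _; rewrite !mxE. Qed.

Lemma mxtrace_two_rank1 (K : comNzRingType) n (P P' : 'M[K]_n)
    (c c' : 'cV_n) (r r' : 'rV_n) :
  \tr (P *m (c *m r) *m P' *m (c' *m r')) =
  (r *m P' *m c') 0 0 * (r' *m P *m c) 0 0.
Proof.
rewrite mxtrace_mul_rank1 -!mulmxA [r' *m (P *m _)]mulmxA.
rewrite [r' *m P *m (_ *m _)]mulmxA.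
by rewrite [_ *m c]mx11_scalar mul_scalar_mx mxE !mulmxA mulrC.
Qed.

Lemma mxtrace_two_rank1_1 (K : comNzRingType) n (P : 'M[K]_n)
    (c c' : 'cV_n) (r r' : 'rV_n) :
  \tr (P *m (c *m r) *m (c' *m r')) = (r *m c') 0 0 * (r' *m P *m c) 0 0.
Proof. by rewrite -[P *m (_ *m _)]mulmx1 mxtrace_two_rank1 mulmx1. Qed.

Lemma mulmx_col_entry (K : comNzRingType) m n p (A : 'M[K]_(m, n))
    (B : 'M[K]_(n, p)) i j : (A *m col j B) i 0 = (A *m B) i j.
Proof. by rewrite !mxE; apply: eq_bigr => k _; rewrite !mxE. Qed.

Lemma mulmx_row_col1 (K : comNzRingType) m n p (A : 'M[K]_(m, n))
    (B : 'M[K]_(n, p)) i j : (row i A *m col j B) 0 0 = (A *m B) i j.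
Proof. by rewrite -row_mul mxE mulmx_col_entry. Qed.

(** Random rows on [S] and fixed rows elsewhere: the induction on the size of [S] trades a row of Xi
    P V for the same row of Xi V. *)
Definition mixmx (K : nzRingType) n (S : {set 'I_n}) (X C : 'M[K]_n) : 'M[K]_n :=
  \matrix_(i, j) if i \in S then X i j else C i j.

Lemma mixmx_in (K : nzRingType) n (S : {set 'I_n}) (X C : 'M[K]_n) i j :
  i \in S -> mixmx S X C i j = X i j.
Proof. by move=> iS; rewrite mxE iS. Qed.

Lemma row_entry (K : nzRingType) m n (X : 'M[K]_(m, n)) i j : (row i X) 0 j = X i j.
Proof. by rewrite mxE. Qed.

Lemma row_entryB (K : nzRingType) m n (X X' : 'M[K]_(m, n)) i j :
  (row i X - row i X') 0 j = X i j - X' i j.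
Proof. by rewrite !mxE. Qed.

Lemma mixmx0 (K : nzRingType) n (X C : 'M[K]_n) : mixmx finset.set0 X C = C.
Proof. by apply/matrixP => i j; rewrite mxE inE. Qed.

Lemma mixmxU1 (K : nzRingType) n (S : {set 'I_n}) i (X C : 'M[K]_n) :
  mixmx (i |: S) X C = setrow i (row i X) (mixmx S X C).
Proof.
apply/matrixP => k j; rewrite !mxE !inE.
by case: eqP => [->|] //=.
Qed.

Lemma mixmx_setrow (K : nzRingType) n (S : {set 'I_n}) i u (X C : 'M[K]_n) :
  i \notin S -> mixmx S X (setrow i u C) = setrow i u (mixmx S X C).
Proof.
move=> iS; apply/matrixP => k j; rewrite !mxE.
by case: (k =P i) => [->|] //; rewrite (negbTE iS).
Qed.

Lemma prod_mixmx (K : comNzRingType) n (S : {set 'I_n}) (X C : 'M[K]_n)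
    (s : 'S_n) (A : pred 'I_n) :
  \prod_(l | A l) mixmx S X C l (s l) =
  \prod_(l in S | A l) X l (s l) * \prod_(l | A l && (l \notin S)) C l (s l).
Proof.
rewrite (bigID (mem S)) /=; congr (_ * _).
  apply: eq_big => [l|l /andP[_ lS]]; first by rewrite andbC.
  by rewrite mxE lS.
by apply: eq_bigr => l /andP[_ /negbTE lS]; rewrite mxE lS.
Qed.

(** * Determinants with random rows and powers of a pairing *)

Section Moments.
Context (R : realType) (L N : nat).
Variables (mu : probability (borelMx R N L) R) (mu_iso : isotropic mu).
Variables (Q : 'M[R[i]]_L) (QQ : Q *m Q = Q).
Local Notation T := (borelMx R N L).
Local Notation D := (stiefel R L N).
Local Notation E := (Cintegral mu D).
Local Notation P := (proj Q).
Let muD : mu D = 1%E := proj1 mu_iso.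
Let mD := @measurable_stiefel R L N.

Definition loop_integrand (I : finType) (S : {set I}) (B : I -> 'M[R[i]]_N) B0 Phi :=
  (N%:R * \tr (P Phi *m B0) - \tr Q * \tr B0) * prod_legs Q S B Phi
    + \sum_(k in S) (\tr (P Phi *m B0 *m P Phi *m B k)
        - \tr (P Phi *m B0 *m B k)) * prod_legs_but Q S B k Phi.

Lemma loop_integrand_bmeasC (I : finType) (S : {set I}) B B0 :
  bmeasC D (loop_integrand S B B0).
Proof.
have bP B' := trace_proj_bmeasC Q B'.
apply: bmeasCD; first apply: bmeasCM.
- by apply: bmeasCB; [exact/bmeasCZ | exact: bmeasC_cst].
- exact: prod_legs_bmeasC.
apply: bmeasC_sum => k _; apply: bmeasCM; last exact: prod_legs_but_bmeasC.
apply: bmeasCB; apply: bmeasC_trace => i j; apply: bmeasC_mulmx => *;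
  try exact: bmeasC_cst.
- apply: bmeasC_mulmx => *; last exact: proj_bmeasC.
  by apply: bmeasC_mulmx => *; [exact: proj_bmeasC | exact: bmeasC_cst].
- by apply: bmeasC_mulmx => *; [exact: proj_bmeasC | exact: bmeasC_cst].
Qed.

Lemma E_loop_sum (J : finType) (c : J -> R[i]) (I : finType) (S : {set I})
    (B : J -> I -> 'M[R[i]]_N) (B0 : J -> 'M[R[i]]_N) :
  E (fun Phi => \sum_j c j * loop_integrand S (B j) (B0 j) Phi) = 0.
Proof.
rewrite (EC_sum mD muD) => [|j _]; last exact/bmeasCZ/loop_integrand_bmeasC.
rewrite big1 // => j _; rewrite (EC_scale mD muD) ?loop_equation ?mulr0 //.
exact: loop_integrand_bmeasC.
Qed.

Section Alternating.
Variables (n : nat) (Xi : 'M[R[i]]_(n, N)) (V : 'M[R[i]]_(N, n)).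
Local Notation Y := (fun Phi => Xi *m P Phi *m V).
Local Notation W := (Xi *m V).

Lemma minor_bmeasC i j : bmeasC D (fun Phi => (Xi *m P Phi *m V) i j).
Proof.
apply: bmeasC_mulmx => *; last exact: bmeasC_cst.
by apply: bmeasC_mulmx => *; [exact: bmeasC_cst | exact: proj_bmeasC].
Qed.

Lemma mixmx_bmeasC (S : {set 'I_n}) (C : 'M[R[i]]_n) i j :
  bmeasC D (fun Phi => mixmx S (Y Phi) C i j).
Proof.
case: (boolP (i \in S)) => iS.
  apply: (bmeasC_ext _ (minor_bmeasC i j)) => Phi.
  by rewrite [RHS]mxE iS.
apply: (bmeasC_ext _ (bmeasC_cst _ (C i j))) => Phi.
by rewrite [RHS]mxE (negbTE iS).
Qed.

(** Each entry of Xi P V is a trace of P against a rank-one matrix, so the loop equation applies to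
    every term of the Leibniz expansion, with the entry of row i as [B0]. Joining it with the entry
    of a row k in S exchanges their columns and gives minus a determinant; each such row thus lowers
    both N and Tr Q by one. *)
Lemma E_det_mixmx_step (S : {set 'I_n}) (i : 'I_n) C : i \notin S ->
  (N%:R - #|S|%:R) * E (fun Phi => \det (mixmx (i |: S) (Y Phi) C)) =
  (\tr Q - #|S|%:R) *
    E (fun Phi => \det (mixmx S (Y Phi) (setrow i (row i W) C))).
Proof.
move=> iS.
have Si l : l \in S -> l != i by move=> lS; apply: contraNneq iS => <-.
have b1 : bmeasC D (fun Phi => \det (mixmx (i |: S) (Y Phi) C)).
  by apply: bmeasC_det => *; exact: mixmx_bmeasC.
have b2 : bmeasC D (fun Phi => \det (mixmx S (Y Phi) (setrow i (row i W) C))).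
  by apply: bmeasC_det => *; exact: mixmx_bmeasC.
rewrite -(EC_scale mD muD _ b1) -(EC_scale mD muD _ b2).
apply/eqP; rewrite -subr_eq0.
rewrite -(EC_sub mD muD (bmeasCZ _ b1) (bmeasCZ _ b2)).
pose c (s : 'S_n) := (-1) ^+ s * \prod_(l | (l != i) && (l \notin S)) C l (s l).
pose B (s : 'S_n) l := col (s l) V *m row l Xi.
rewrite -(E_loop_sum c S B (fun s => B s i)); apply/eqP/eq_EC => Phi DPhi.
rewrite /loop_integrand; set p := P Phi.
have trB s k l : \tr (p *m (col (s l) V *m row k Xi)) = (Xi *m p *m V) k (s l).
  by rewrite mxtrace_mul_rank1 mulmx_row_col.
set M := mixmx S (Xi *m p *m V) C.
rewrite mixmxU1 mixmx_setrow // -/M.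
have dU : forall k, k \in S -> \sum_s c s *
    ((\tr (p *m B s i *m p *m B s k) - \tr (p *m B s i *m B s k)) *
     prod_legs_but Q S (B s) k Phi) =
    - (\det (setrow i (row i (Xi *m p *m V)) M) - \det (setrow i (row i W) M)).
  move=> k kS.
  have ik : i != k by apply: contraNneq iS => ->.
  rewrite -det_setrowB -(det_setrow_swap _ _ ik); apply: eq_bigr => s _.
  rewrite /c -mulrA; congr (_ * _).
  have -> : \tr (p *m B s i *m p *m B s k) =
      (Xi *m p *m V) i (s k) * (Xi *m p *m V) k (s i).
    by rewrite mxtrace_two_rank1 !mulmx_row_col.
  have -> : \tr (p *m B s i *m B s k) = W i (s k) * (Xi *m p *m V) k (s i).
    by rewrite mxtrace_two_rank1_1 mulmx_row_col mulmx_row_col1.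
  rewrite -mulrBl prod_mixmx row_entryB mixmx_in //.
  have -> : prod_legs_but Q S (B s) k Phi =
      \prod_(l in S | (l != i) && (l != k)) (Xi *m p *m V) l (s l).
    apply: eq_big => [l|l _]; last exact: trB.
    by case lS: (l \in S) => //=; rewrite Si.
  have -> : \prod_(l | (l != i) && (l != k) && (l \notin S)) C l (s l) =
      \prod_(l | (l != i) && (l \notin S)) C l (s l).
    apply: eq_bigl => l; case: (l =P i) => //= _.
    by case: (l =P k) => //= ->; rewrite kS.
  by ring.
under [RHS]eq_bigr do rewrite mulrDr mulr_sumr.
rewrite [in RHS]big_split /= [X in _ = _ + X]exchange_big /=.
rewrite [X in _ = _ + X](eq_bigr _ dU).
rewrite sumr_const -[X in _ = _ + X]mulr_natl.
have first : \sum_s c s * ((N%:R * \tr (p *m B s i) - \tr Q * \tr (B s i)) *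
     prod_legs Q S (B s) Phi) =
     N%:R * \det (setrow i (row i (Xi *m p *m V)) M) - \tr Q * \det (setrow i (row i W) M).
  rewrite !det_setrow_perm !mulr_sumr -sumrB; apply: eq_bigr => s _.
  have -> : \tr (B s i) = W i (s i).
    by rewrite -[B s i]mul1mx mxtrace_mul_rank1 mulmx1 -[row i Xi]mulmx1 mulmx_row_col mulmx1.
  rewrite trB prod_mixmx !row_entry /c.
  have -> : prod_legs Q S (B s) Phi = \prod_(l in S | l != i) (Xi *m p *m V) l (s l).
    apply: eq_big => [l|l _]; last exact: trB.
    by case lS: (l \in S) => //=; rewrite Si.
  move: (\prod_(l in S | l != i) _) (\prod_(l | _ && _) _) ((-1) ^+ s) (\tr Q).
  move: ((Xi *m p *m V) i (s i)) (W i (s i)) => y w a b e t; ring.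
move: first; set d1 := \det _; set d2 := \det (setrow i (row i W) _) => first.
transitivity ((N%:R * d1 - \tr Q * d2) + #|S|%:R * - (d1 - d2)).
  by clear first; move: d1 d2 (\tr Q) => x y t; ring.
by congr (_ + _); exact: esym first.
Qed.

Lemma E_det_mixmx (S : {set 'I_n}) C : (#|S| <= N)%N ->
  E (fun Phi => \det (mixmx S (Y Phi) C)) =
  (\prod_(j < #|S|) ((\tr Q - j%:R) / (N%:R - j%:R))) * \det (mixmx S W C).
Proof.
move: {2}#|S| (erefl #|S|) => m; elim: m S C => [|m IH] S C Sm SN.
  have -> : S = finset.set0 by apply/eqP; rewrite -cards_eq0 Sm.
  rewrite cards0 big_ord0 mul1r -[RHS](EC_cst mD muD).
  by apply: eq_EC => Phi _; rewrite !mixmx0.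
have /set0Pn[i iS] : S != finset.set0 by rewrite -cards_eq0 Sm.
have SE : i |: (S :\ i) = S by rewrite finset.setD1K.
have iS' : i \notin S :\ i by rewrite !inE eqxx.
have S'm : #|S :\ i| = m by apply/eqP; rewrite -eqSS -Sm (cardsD1 i S) iS.
(* The bound on the size of [S] keeps every denominator N - j away from 0. *)
have Nm : N%:R - m%:R != 0 :> R[i].
  by rewrite subr_eq0 eqr_nat neq_ltn -[(m < N)%N]/(m.+1 <= N)%N -Sm SN orbT.
have S'N : (#|S :\ i| <= N)%N by rewrite S'm ltnW // -[(m < N)%N]/(m.+1 <= N)%N -Sm.
have := E_det_mixmx_step C iS'; rewrite SE S'm (IH (S :\ i) _ S'm S'N) S'm.
rewrite mixmx_setrow // -mixmxU1 SE Sm big_ord_recr /= => e.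
apply: (mulfI Nm); rewrite e; move: (\det _) (\prod_(_ < _) _) => x y.
by field.
Qed.

Section Symmetric.
Variables (j0 : 'I_n) (eta : 'rV[R[i]]_N) (S : {set 'I_n}) (C : 'M[R[i]]_n).
Hypothesis C0 : forall k, k \notin S -> C k j0 = 0.
Local Notation w := (col j0 V).
Local Notation X := (fun Phi => (eta *m P Phi *m w) 0 0).

Lemma pairing_bmeasC : bmeasC D X.
Proof.
apply: bmeasC_mulmx => *; last exact: bmeasC_cst.
by apply: bmeasC_mulmx => *; [exact: bmeasC_cst | exact: proj_bmeasC].
Qed.

(** Here one copy of the pairing serves as [B0]. Each of the a other copies joined with it raises
    both N and Tr Q by one. The rows of [S] together raise them by one more, whatever their number:
    the pairing uses column [j0] of V, so [sum_det_setrow] evaluates their sum, which [C0] extends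
    from [S] to all rows. *)
Lemma E_det_mixmxX_step a :
  (N%:R + a.+1%:R) *
    E (fun Phi => \det (mixmx S (Y Phi) C) * X Phi ^+ a.+1) =
  (\tr Q + a.+1%:R) * (eta *m w) 0 0 *
    E (fun Phi => \det (mixmx S (Y Phi) C) * X Phi ^+ a).
Proof.
have bd : bmeasC D (fun Phi => \det (mixmx S (Y Phi) C)).
  by apply: bmeasC_det => *; exact: mixmx_bmeasC.
have b1 k : bmeasC D (fun Phi => \det (mixmx S (Y Phi) C) * X Phi ^+ k).
  by apply: bmeasCM => //; apply: bmeasCX; exact: pairing_bmeasC.
rewrite -(EC_scale mD muD _ (b1 a.+1)) -(EC_scale mD muD _ (b1 a)).
apply/eqP; rewrite -subr_eq0.
rewrite -(EC_sub mD muD (bmeasCZ _ (b1 a.+1)) (bmeasCZ _ (b1 a))).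
pose c (s : 'S_n) := (-1) ^+ s * \prod_(l | l \notin S) C l (s l).
pose S' : {set 'I_n + 'I_a} := [set z | if z is inl l then l \in S else true]%SET.
pose B (s : 'S_n) (z : 'I_n + 'I_a) :=
  if z is inl l then col (s l) V *m row l Xi else w *m eta.
rewrite -(E_loop_sum c S' B (fun=> w *m eta)); apply/eqP/eq_EC => Phi DPhi.
rewrite /loop_integrand; set p := P Phi.
set M := mixmx S (Xi *m p *m V) C.
set x := (eta *m p *m w) 0 0; set y := (eta *m w) 0 0.
have prodE s : prod_legs Q S' (B s) Phi =
    \prod_(l in S) (Xi *m p *m V) l (s l) * x ^+ a.
  rewrite /prod_legs big_sumType /=; congr (_ * _).
    apply: eq_big => [l|l _]; first by rewrite inE.
    by rewrite mxtrace_mul_rank1 mulmx_row_col.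
  rewrite (eq_bigr (fun=> x)) => [|k _]; last exact: mxtrace_mul_rank1.
  by rewrite (eq_bigl xpredT) ?prodr_const ?card_ord // => k; rewrite inE.
have prod_inl s k : k \in S -> prod_legs_but Q S' (B s) (inl k) Phi =
    \prod_(l in S | l != k) (Xi *m p *m V) l (s l) * x ^+ a.
  move=> kS; rewrite /prod_legs_but big_sumType /=; congr (_ * _).
    apply: eq_big => [l|l _]; first by rewrite inE.
    by rewrite mxtrace_mul_rank1 mulmx_row_col.
  rewrite (eq_bigr (fun=> x)) => [|l _]; last exact: mxtrace_mul_rank1.
  by rewrite (eq_bigl xpredT) ?prodr_const ?card_ord // => l; rewrite inE.
have prod_inr s k : prod_legs_but Q S' (B s) (inr k) Phi =
    \prod_(l in S) (Xi *m p *m V) l (s l) * x ^+ a.-1.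
  rewrite /prod_legs_but big_sumType /=; congr (_ * _).
    apply: eq_big => [l|l _]; first by rewrite inE andbT.
    by rewrite mxtrace_mul_rank1 mulmx_row_col.
  rewrite (eq_bigr (fun=> x)) => [|l _]; last exact: mxtrace_mul_rank1.
  rewrite (eq_bigl (predC1 k)) => [|l]; last by rewrite !inE.
  by rewrite prodr_const cardC1 card_ord.
pose u := eta *m p *m V - eta *m V.
have uE : u 0 j0 = x - y.
  by rewrite /x /y !mulmx_col_entry /u; move: (eta *m p *m V) => A; rewrite !mxE.
have detM : \sum_s c s * \prod_(l in S) (Xi *m p *m V) l (s l) = \det M.
  apply: eq_bigr => s _; rewrite /M prod_mixmx /c -mulrA; congr (_ * _).
  rewrite mulrC; congr (_ * _); apply: eq_bigl => l.
  by rewrite andbT.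
have detMk k : k \in S -> \sum_s c s * (u 0 (s k) *
    \prod_(l in S | l != k) (Xi *m p *m V) l (s l)) = \det (setrow k u M).
  move=> kS; rewrite det_setrow_perm; apply: eq_bigr => s _.
  rewrite /M prod_mixmx /c -mulrA; congr (_ * _).
  rewrite mulrCA; congr (_ * _); rewrite mulrC; congr (_ * _).
  by apply: eq_bigl => l; case: (l =P k) => //= ->; rewrite kS.
have inner s : \sum_(k in S') (\tr (p *m (w *m eta) *m p *m B s k)
      - \tr (p *m (w *m eta) *m B s k)) * prod_legs_but Q S' (B s) k Phi =
    \sum_(k in S) (Xi *m p *m V) k j0 * x ^+ a * (u 0 (s k) *
      \prod_(l in S | l != k) (Xi *m p *m V) l (s l))
    + a%:R * (x - y) * x ^+ a * \prod_(l in S) (Xi *m p *m V) l (s l).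
  rewrite big_sumType /=; congr (_ + _).
    apply: eq_big => [k|k]; first by rewrite inE.
    rewrite inE => kS; rewrite prod_inl // mxtrace_two_rank1 mxtrace_two_rank1_1.
    rewrite mulmx_row_col !mulmx_col_entry -mulrBl.
    have -> : u 0 (s k) = (eta *m p *m V) 0 (s k) - (eta *m V) 0 (s k).
      by rewrite /u; move: (eta *m p *m V) (eta *m V) => A A'; rewrite !mxE.
    move: ((eta *m p *m V) 0 (s k)) ((eta *m V) 0 (s k)) => e f.
    by move: ((Xi *m p *m V) k j0) (\prod_(_ in _ | _) _) => g h; ring.
  rewrite (eq_bigr (fun=> (x * x - y * x) *
      (\prod_(l in S) (Xi *m p *m V) l (s l) * x ^+ a.-1))); last first.
    by move=> k _; rewrite prod_inr mxtrace_two_rank1 mxtrace_two_rank1_1.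
  rewrite (eq_bigl xpredT) => [|k]; last by rewrite inE.
  rewrite sumr_const card_ord -mulr_natl; case: (a) => [|a'].
    by rewrite !mul0r.
  by rewrite exprS /=; move: (\prod_(_ in _) _) => h; ring.
rewrite (eq_bigr (fun s => (N%:R * x - \tr Q * y + a%:R * (x - y)) * x ^+ a *
    (c s * \prod_(l in S) (Xi *m p *m V) l (s l)) +
    \sum_(k in S) (Xi *m p *m V) k j0 * x ^+ a * (c s * (u 0 (s k) *
      \prod_(l in S | l != k) (Xi *m p *m V) l (s l))))); last first.
  move=> s _; rewrite inner prodE mxtrace_mul_rank1 -/x.
  rewrite -[\tr (w *m eta)]/(\tr (w *m eta)) -[w *m eta]mul1mx.
  rewrite mxtrace_mul_rank1 mulmx1 -/y !mulrDr mulr_sumr.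
  rewrite addrCA addrC; congr (_ + _).
    by move: (\prod_(_ in _) _) (\tr Q) (c s) => h q e; ring.
  apply: eq_bigr => k _.
  by move: (\prod_(_ in _ | _) _) (u 0 (s k)) (c s) ((Xi *m p *m V) k j0) => h q e f; ring.
rewrite big_split -mulr_sumr detM exchange_big /=.
rewrite (eq_bigr (fun k => x ^+ a * (M k j0 * \det (setrow k u M)))); last first.
  move=> k kS; rewrite -mulr_sumr detMk // /M mixmx_in // -/M.
  by move: (\det _) ((Xi *m p *m V) k j0) => g h; ring.
have -> : \sum_(k in S) x ^+ a * (M k j0 * \det (setrow k u M)) =
    x ^+ a * ((x - y) * \det M).
  rewrite -uE -sum_det_setrow -mulr_sumr; congr (_ * _).
  rewrite [RHS](bigID (mem S)) /= [X in _ = _ + X]big1 ?addr0 // => k kS.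
  by rewrite /M mxE (negbTE kS) C0 // mul0r.
rewrite exprS; move: (\det M) (\tr Q) => h q.
by rewrite -natr1; ring.
Qed.

Lemma E_det_mixmxX a : (#|S| <= N)%N ->
  E (fun Phi => \det (mixmx S (Y Phi) C) * X Phi ^+ a) =
  (\prod_(j < #|S|) ((\tr Q - j%:R) / (N%:R - j%:R))) *
  (\prod_(j < a) ((\tr Q + j.+1%:R) / (N%:R + j.+1%:R))) *
  (\det (mixmx S W C) * (eta *m w) 0 0 ^+ a).
Proof.
move=> SN; elim: a => [|a IH].
  rewrite big_ord0 !mulr1 -E_det_mixmx //.
  by apply: eq_EC => Phi _; rewrite mulr1.
have Na : N%:R + a.+1%:R != 0 :> R[i] by rewrite -natrD pnatr_eq0 addnS.
apply: (mulfI Na); rewrite E_det_mixmxX_step IH big_ord_recr exprS /=.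
set u := \prod_(j < #|S|) _; set v := \prod_(j < a) _.
move: u v (\det _) (\tr Q) => u v z q.
by field.
Qed.

End Symmetric.
End Alternating.
End Moments.

(** * Bordered determinants *)

(** Multilinearity in the rows: a subset records the rows from which the variable is taken. *)
Lemma coef_det_mixmx (K : idomainType) n (C X : 'M[K]_n) k :
  (\det (map_mx polyC C + 'X *: map_mx polyC X))`_k =
  \sum_(S : {set 'I_n} | #|S| == k) \det (mixmx S X C).
Proof.
rewrite coef_sum [RHS]exchange_big /=; apply: eq_bigr => s _.
rewrite -mulr_sumr !mulr_sign.
suff : (\prod_i (map_mx polyC C + 'X *: map_mx polyC X) i (s i))`_k =
    \sum_(S : {set 'I_n} | #|S| == k) \prod_i mixmx S X C i (s i).
  by move=> H; rewrite -H; case: ifP => _; rewrite ?coefN.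
transitivity ((\sum_(S : {set 'I_n})
    'X^#|S| * (\prod_i mixmx S X C i (s i))%:P)`_k).
  apply: (congr1 (fun p : {poly K} => p`_k)); under eq_bigr do rewrite !mxE addrC.
  have -> : forall F G : 'I_n -> {poly K}, \prod_i (F i + G i) =
      \sum_(S : {set 'I_n}) \prod_i (if i \in S then F i else G i).
    by move=> F G; rewrite bigA_distr; apply: eq_bigl => S; rewrite inE.
  apply: eq_bigr => S _.
  rewrite rmorph_prod -prodr_const [X in X * _]big_mkcond -big_split /=.
  by apply: eq_bigr => i _; rewrite mxE; case: ifP => _; rewrite ?mul1r.
rewrite coef_sum (bigID (fun S : {set 'I_n} => #|S| == k)) /=.
rewrite [X in _ + X]big1 => [|S /negbTE Sk]; last first.
  by rewrite coefMC coefXn eq_sym Sk mul0r.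
by rewrite addr0; apply: eq_bigr => S /eqP <-; rewrite coefMC coefXn eqxx mul1r.
Qed.

Section Bordered.
Variables (K : numFieldType) (N : nat) (A : 'M[K]_N).
Variables (eta : 'rV[K]_N) (w : 'cV[K]_N).

Definition corner : 'M[K]_(N + 1) := block_mx 1%:M 0 0 0.

(** The sum is a coefficient of the determinant of 1 + tA bordered by tAw, t eta A and t eta A w.
    Its Schur complement collapses to t eta A adj(1 + tA) w, because t adj(1 + tA) A = det(1 + tA) -
    adj(1 + tA). Values of [elemx] thereby become determinants with random rows. *)
Lemma sum_det_bordered b :
  \sum_(S : {set 'I_(N + 1)} | #|S| == b.+1)
    \det (mixmx S (block_mx A (A *m w) (eta *m A) (eta *m A *m w)) corner) =
  (eta *m A *m elemx A b *m w) 0 0.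
Proof.
rewrite -coef_det_mixmx /corner !map_block_mx scale_block_mx add_block_mx.
rewrite !map_mx0 !add0r map_mx1 -/(affine_mx A).
rewrite det_block_mx11 ?det_affine_neq0 //.
set M := affine_mx A.
have -> : ('X *: map_mx polyC (eta *m A *m w)) 0 0 * \det M -
    ('X *: map_mx polyC (eta *m A) *m \adj M *m ('X *: map_mx polyC (A *m w))) 0 0
    = 'X * (map_mx polyC (eta *m A) *m \adj M *m map_mx polyC w) 0 0.
  have -> : ('X *: map_mx polyC (eta *m A) *m \adj M *m
      ('X *: map_mx polyC (A *m w))) 0 0 = 'X * (map_mx polyC (eta *m A) *m
      (\adj M *m ('X *: map_mx polyC A)) *m map_mx polyC w) 0 0.
    rewrite [map_mx polyC (A *m w)]map_mxM /=.
    move: (map_mx polyC (eta *m A)) (map_mx polyC A) (map_mx polyC w) (\adj M).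
    move=> r B c J.
    by rewrite -!scalemxAr -!scalemxAl !mulmxA mxE.
  have -> : \adj M *m ('X *: map_mx polyC A) = (\det M)%:M - \adj M.
    by rewrite -mul_adj_mx /M {3}/affine_mx mulmxDr mulmx1 addrC addKr.
  rewrite mulmxBr mulmxBl mul_mx_scalar -scalemxAl.
  rewrite [map_mx polyC (eta *m A *m w)]map_mxM.
  move: (map_mx polyC (eta *m A)) (map_mx polyC w) => r c.
  have eZ a (B : 'M[{poly K}]_1) : (a *: B) 0 0 = a * B 0 0 by rewrite mxE.
  have eB (B B' : 'M[{poly K}]_1) : (B - B') 0 0 = B 0 0 - B' 0 0.
    by rewrite !mxE.
  by rewrite eZ eB eZ; ring.
rewrite coefXM /=; move: (eta *m A) => r.
rewrite mxE coef_sum [RHS]mxE; apply: eq_bigr => i _.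
rewrite [(map_mx polyC w) _ _]mxE coefMC; congr (_ * _).
rewrite mxE coef_sum [RHS]mxE; apply: eq_bigr => j _.
by rewrite [(map_mx polyC r) _ _]mxE coefCM [(elemx _ _) _ _]mxE.
Qed.

End Bordered.

(** * Means of hook functions *)

Lemma mulr_sum_sum (K : comNzRingType) (I : finType) (A : pred I) (c x : K)
    (F : I -> K) :
  c * ((\sum_(i | A i) F i) * x) = \sum_(i | A i) c * (F i * x).
Proof. by rewrite mulr_suml mulr_sumr. Qed.

Section HookMoments.
Context (R : realType) (L N : nat).
Variables (mu : probability (borelMx R N L) R) (mu_iso : isotropic mu).
Local Notation T := (borelMx R N L).
Local Notation D := (stiefel R L N).
Local Notation E := (Cintegral mu D).
Let muD : mu D = 1%E := proj1 mu_iso.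
Let mD := @measurable_stiefel R L N.

Definition hook_ratio (rho : R[i]) a b : R[i] :=
  (\prod_(j < b.+1) ((rho - j%:R) / (N%:R - j%:R))) *
  (\prod_(j < a) ((rho + j.+1%:R) / (N%:R + j.+1%:R))).

Lemma E_bordered (Q : 'M[R[i]]_L) (QQ : Q *m Q = Q) (Dd : 'M[R[i]]_N)
    (eta : 'rV[R[i]]_N) (w : 'cV[R[i]]_N) a b :
  E (fun Phi => (eta *m (proj Q Phi *m Dd) *m elemx (proj Q Phi *m Dd) b *m w) 0 0
      * (eta *m (proj Q Phi *m Dd) *m w) 0 0 ^+ a) =
  hook_ratio (\tr Q) a b *
    ((eta *m Dd *m elemx Dd b *m w) 0 0 * (eta *m Dd *m w) 0 0 ^+ a).
Proof.
(* For b >= N both sides vanish; otherwise b + 1 <= N and [E_det_mixmxX] applies. *)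
have [Nb|bN] := leqP N b.
  rewrite (elemx_eq0 Dd Nb) mulmx0 mul0mx mxE mul0r mulr0.
  rewrite -[RHS](EC_cst mD muD); apply: eq_EC => Phi _.
  by rewrite elemx_eq0 // mulmx0 mul0mx mxE mul0r.
(* With these factors Xi p V is the bordered matrix of p D, for p = 1 as well as for the random
   projection, and its corner entry is the pairing that is raised to the power a. *)
pose Xi : 'M[R[i]]_(N + 1, N) := col_mx 1%:M eta.
pose V : 'M[R[i]]_(N, N + 1) := row_mx Dd (Dd *m w).
pose j0 : 'I_(N + 1) := rshift N ord0.
have XiV p : Xi *m p *m V = block_mx (p *m Dd) (p *m Dd *m w)
    (eta *m (p *m Dd)) (eta *m (p *m Dd) *m w).
  by rewrite mul_col_mx mul1mx mul_col_row !mulmxA.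
have colV : col j0 V = Dd *m w.
  by apply/matrixP => k l; rewrite mxE row_mxEr (ord1 l).
have C0 (S : {set 'I_(N + 1)}) k : k \notin S -> corner R[i] N k j0 = 0.
  move=> _; rewrite /corner /j0; case: (split_ordP k) => k' ->.
    by rewrite block_mxEur mxE.
  by rewrite block_mxEdr mxE.
apply: etrans _ (congr1 (fun z => hook_ratio (\tr Q) a b *
  (z * (eta *m Dd *m w) 0 0 ^+ a)) (sum_det_bordered Dd eta w b)).
apply: etrans _ (esym (mulr_sum_sum _ _ _ _)).
transitivity (\sum_(S : {set 'I_(N + 1)} | #|S| == b.+1)
  E (fun Phi => \det (mixmx S (Xi *m proj Q Phi *m V) (corner R[i] N)) *
     (eta *m proj Q Phi *m col j0 V) 0 0 ^+ a)).
  rewrite -(EC_sum mD muD) => [|S _]; last first.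
    apply: bmeasCM; first by apply: bmeasC_det => *; exact: mixmx_bmeasC.
    by apply: bmeasCX; exact: pairing_bmeasC.
  apply: eq_EC => Phi _.
  apply: etrans (congr1 ( *%R^~ _)
    (esym (sum_det_bordered (proj Q Phi *m Dd) eta w b))) _.
  rewrite mulr_suml.
  by apply: eq_bigr => S _; rewrite XiV colV !mulmxA.
apply: eq_bigr => S /eqP Sb.
have SN : (#|S| <= N)%N by rewrite Sb.
apply: (etrans (E_det_mixmxX mu_iso QQ Xi V eta (C0 S) a SN)).
rewrite Sb -/(hook_ratio _ a b) -[Xi]mulmx1 XiV colV !mul1mx mulmxA.
by [].
Qed.

(** * Moments of a rank-one projection as complete functions *)

Section Wick.
Variables (i0 : 'I_L) (A : 'M[R[i]]_N).
Local Notation Q := (delta_mx i0 i0 : 'M[R[i]]_L).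
Local Notation p := (@proj R L N Q).
Definition wick (B : 'M[R[i]]_N) (a : nat) : R[i] :=
  E (fun Psi => \tr (p Psi *m B) * \tr (p Psi *m A) ^+ a).

Lemma delta_idem : Q *m Q = Q.
Proof. by rewrite mul_delta_mx. Qed.

Lemma trace_delta : \tr Q = 1.
Proof. by rewrite -[Q]mul1mx mxtrace_mul_delta mxE eqxx. Qed.

Lemma proj_delta Psi : p Psi =
  col i0 (Psi : 'M[R[i]]_(N, L)) *m (col i0 (Psi : 'M[R[i]]_(N, L)))^t*.
Proof.
rewrite /proj colE trmx_mul map_mxM trmx_delta map_delta_mx !mulmxA.
by rewrite -[_ *m delta_mx i0 0 *m _]mulmxA mul_delta_mx.
Qed.

Lemma trace_proj_delta Psi B B' :
  \tr (p Psi *m B *m p Psi *m B') = \tr (p Psi *m B) * \tr (p Psi *m B').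
Proof.
rewrite proj_delta; set w := col i0 _; set e := w^t*.
have trE C : \tr (w *m e *m C) = (e *m C *m w) 0 0.
  by rewrite -mulmxA mxtrace_mulC /mxtrace big_ord1.
have -> : w *m e *m B *m (w *m e) *m B' =
    1%:M *m (w *m e) *m B *m (w *m (e *m B')) by rewrite mul1mx !mulmxA.
by rewrite mxtrace_two_rank1 mulmx1 !trE.
Qed.

(** For a rank-one projection Tr(p B p A) is a product of two traces, so the loop equation closes on
    these moments. At a = 0 the index [a.-1] carries the coefficient 0. *)
Lemma wick_step B a : (N%:R + a%:R) * wick B a =
  \tr B * E (fun Psi => \tr (p Psi *m A) ^+ a) + a%:R * wick (B *m A) a.-1.
Proof.
rewrite /wick; have bw B' k : bmeasC D (fun Psi => \tr (p Psi *m B') * \tr (p Psi *m A) ^+ k).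
  by apply: bmeasCM; last apply: bmeasCX; exact: trace_proj_bmeasC.
have bA k : bmeasC D (fun Psi => \tr (p Psi *m A) ^+ k).
  by apply: bmeasCX; exact: trace_proj_bmeasC.
rewrite -(EC_scale mD muD _ (bw B a)) -(EC_scale mD muD _ (bA a)).
rewrite -(EC_scale mD muD _ (bw (B *m A) a.-1)).
rewrite -(EC_add mD muD (bmeasCZ _ (bA a)) (bmeasCZ _ (bw _ a.-1))).
apply/eqP; rewrite -subr_eq0.
rewrite -(EC_sub mD muD (bmeasCZ _ (bw B a))); last first.
  by apply: bmeasCD; exact: bmeasCZ.
rewrite -(loop_equation mu_iso delta_idem [set: 'I_a]%SET (fun=> A) B).
apply/eqP/eq_EC => Psi _; rewrite trace_delta mul1r.
have -> : prod_legs Q [set: 'I_a]%SET (fun=> A) Psi = \tr (p Psi *m A) ^+ a.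
  by rewrite /prod_legs prodr_const cardsT card_ord.
rewrite (eq_bigr (fun=> (\tr (p Psi *m B) * \tr (p Psi *m A) -
    \tr (p Psi *m B *m A)) * \tr (p Psi *m A) ^+ a.-1)); last first.
  move=> k _; rewrite trace_proj_delta; congr (_ * _).
  rewrite /prod_legs_but (eq_bigl (predC1 k)) => [|l]; last by rewrite !inE.
  by rewrite prodr_const cardC1 card_ord.
rewrite sumr_const cardsT card_ord -mulr_natl !mulmxA.
move: (\tr (p Psi *m B)) (\tr (p Psi *m A)) (\tr B) (\tr (_ *m _ *m A)).
move=> x y z t; case: (a) => [|k]; rewrite ?mul0r ?exprS /=; ring.
Qed.

(** The inverse is the binomial coefficient of N + a - 1 over a, the value of h_a at the identity
    matrix, where every moment is 1. *)
Definition kappa (a : nat) : R[i] := \prod_(j < a) (j.+1%:R / (N%:R + j%:R)).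
Definition complete (a : nat) : R[i] :=
  (kappa a)^-1 * E (fun Psi => \tr (p Psi *m A) ^+ a).

Hypothesis N_gt0 : (0 < N)%N.

Lemma kappa_neq0 a : kappa a != 0.
Proof.
apply/prodf_neq0 => j _; rewrite mulf_neq0 ?pnatr_eq0 // invr_eq0.
by rewrite -natrD pnatr_eq0 -lt0n addn_gt0 N_gt0.
Qed.

Lemma kappaS a : (N%:R + a%:R) * kappa a.+1 = a.+1%:R * kappa a.
Proof.
have Na : N%:R + a%:R != 0 :> R[i].
  by rewrite -natrD pnatr_eq0 -lt0n addn_gt0 N_gt0.
by rewrite /kappa big_ord_recr /=; move: (\prod_(_ < _) _) => k; field.
Qed.

Lemma complete0 : complete 0 = 1.
Proof.
rewrite /complete /kappa big_ord0 invr1 mul1r -[RHS](EC_cst mD muD).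
by apply: eq_EC => Psi _; rewrite expr0.
Qed.

(** Unrolling [wick_step] multiplies [B] by successive powers of [A], which assembles
    [completex]. *)
Lemma wick_completex B a :
  (N%:R + a%:R) * wick B a = kappa a * \tr (B *m completex A complete a).
Proof.
elim: a B => [|a IH] B; rewrite wick_step.
  rewrite mul0r addr0 completex0 ?complete0 // mulmx1.
  rewrite -[E _]mul1r -[1](mulfV (kappa_neq0 0)) -mulrA -/(complete 0).
  by rewrite complete0 mulr1 mulrC.
have Na : N%:R + a%:R != 0 :> R[i].
  by rewrite -natrD pnatr_eq0 -lt0n addn_gt0 N_gt0.
rewrite completexS mulmxDr -scalemxAr mulmx1 mxtraceD mxtraceZ mulrDr.
congr (_ + _).
  by rewrite /complete -mulrA mulVKf ?kappa_neq0 // mulrC.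
apply: (mulfI Na); rewrite mulrCA IH mulrA [in RHS]mulrA kappaS.
by rewrite mulmxA.
Qed.

(** The case B = A of [wick_completex], whose left side is the next moment. *)
Lemma complete_newton a :
  complete a.+1 *+ a.+1 = \sum_(j < a.+1) \tr (A ^+ j.+1) * complete (a - j).
Proof.
have -> : \sum_(j < a.+1) \tr (A ^+ j.+1) * complete (a - j) =
    \tr (A *m completex A complete a).
  rewrite /completex mulmx_sumr raddf_sum /=; apply: eq_bigr => j _.
  by rewrite -scalemxAr mxtraceZ mulmxE -exprS mulrC.
apply: (mulfI (kappa_neq0 a)); rewrite -wick_completex -[_ *+ a.+1]mulr_natl [LHS]mulrCA [LHS]mulrA.
rewrite -kappaS -mulrA /complete mulVKf ?kappa_neq0 //; congr (_ * _).
by apply: eq_EC => Psi _; rewrite /wick exprS.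
Qed.

End Wick.
End HookMoments.

Lemma coef_signM (K : nzRingType) (p : {poly K}) n k :
  ((-1) ^+ n * p)`_k = (-1) ^+ n * p`_k.
Proof.
by rewrite -signr_odd -[in RHS]signr_odd !mulr_sign; case: ifP => _; rewrite ?coefN.
Qed.

(** * Exchange of the two means and power sums of P D *)

Section PowerSums.
Context (R : realType) (L N : nat).
Variables (mu : probability (borelMx R N L) R) (mu_iso : isotropic mu).
Local Notation T := (borelMx R N L).
Local Notation D := (stiefel R L N).
Local Notation E := (Cintegral mu D).
Let muD : mu D = 1%E := proj1 mu_iso.
Let mD := @measurable_stiefel R L N.

(** The kernels to be exchanged are polynomial in the entries of both matrices and their conjugates,
    hence of this form; the two iterated means then agree by finite linearity. *)
Definition separable_fun (F : T -> T -> R[i]) :=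
  exists (I : finType) (f g : I -> T -> R[i]),
    [/\ forall i, bmeasC D (f i), forall i, bmeasC D (g i) &
        forall Phi Psi, F Phi Psi = \sum_i f i Phi * g i Psi].

Lemma separable_swap F : separable_fun F ->
  E (fun Phi => E (F Phi)) = E (fun Psi => E (F^~ Psi)).
Proof.
move=> [I [f [g [bf bg FE]]]].
transitivity (\sum_i E (f i) * E (g i)).
  rewrite -[RHS]/(\sum_(i in I) _).
  under [RHS]eq_bigr do rewrite mulrC -(EC_scale mD muD _ (bf _)).
  rewrite -(EC_sum mD muD) => [|i _]; last exact: bmeasCZ.
  apply: eq_EC => Phi _.
  under [RHS]eq_bigr do rewrite mulrC -(EC_scale mD muD _ (bg _)).
  rewrite -(EC_sum mD muD) => [|i _]; last exact: bmeasCZ.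
  by apply: eq_EC => Psi _.
under eq_bigr do rewrite -(EC_scale mD muD _ (bg _)).
rewrite -(EC_sum mD muD) => [|i _]; last exact: bmeasCZ.
apply: eq_EC => Psi _.
under eq_bigr do rewrite mulrC -(EC_scale mD muD _ (bf _)).
rewrite -(EC_sum mD muD) => [|i _]; last exact: bmeasCZ.
apply: eq_EC => Phi _; rewrite FE.
by apply: eq_bigr => i _; rewrite mulrC.
Qed.

Lemma separable_bmeasC F : separable_fun F -> bmeasC D (fun Phi => E (F Phi)).
Proof.
move=> [I [f [g [bf bg FE]]]].
apply: (@bmeasC_ext _ _ _ _ (fun Phi => \sum_i E (g i) * f i Phi)).
  move=> Phi; under eq_bigr do rewrite mulrC -(EC_scale mD muD _ (bg _)).
  rewrite -(EC_sum mD muD) => [|i _]; last exact: bmeasCZ.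
  by apply: eq_EC => Psi _.
by apply: bmeasC_sum => i _; exact: bmeasCZ.
Qed.

Lemma separable_cst c : separable_fun (fun _ _ => c).
Proof.
exists 'I_1, (fun _ _ => c), (fun _ _ => 1).
by split=> [_|_|Phi Psi]; rewrite ?big_ord1 ?mulr1 //; exact: bmeasC_cst.
Qed.

Lemma separableM F G : separable_fun F -> separable_fun G ->
  separable_fun (fun Phi Psi => F Phi Psi * G Phi Psi).
Proof.
move=> [I [f [g [bf bg FE]]]] [J [f' [g' [bf' bg' GE]]]].
exists (I * J)%type, (fun ij Phi => f ij.1 Phi * f' ij.2 Phi),
  (fun ij Psi => g ij.1 Psi * g' ij.2 Psi); split.
- by move=> ij; exact: bmeasCM.
- by move=> ij; exact: bmeasCM.
move=> Phi Psi; rewrite FE GE mulr_suml.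
rewrite -(pair_bigA _ (fun i j => f i Phi * f' j Phi * (g i Psi * g' j Psi))) /=.
apply: eq_bigr => i _; by rewrite mulr_sumr; apply: eq_bigr => j _; rewrite mulrACA.
Qed.

Lemma separableX F n : separable_fun F ->
  separable_fun (fun Phi Psi => F Phi Psi ^+ n).
Proof.
move=> sF; elim: n => [|n IH]; first exact: separable_cst.
have := separableM sF IH; congr separable_fun.
by apply/funext => Phi; apply/funext => Psi; rewrite exprS.
Qed.

Lemma separable_trace Q (B : T -> 'M[R[i]]_N) :
  (forall i j, bmeasC D (fun Phi => B Phi i j)) ->
  separable_fun (fun Phi Psi => \tr (@proj R L N Q Psi *m B Phi)).
Proof.
move=> bB; exists ('I_N * 'I_N)%type, (fun ij Phi => B Phi ij.2 ij.1),
  (fun ij Psi => @proj R L N Q Psi ij.1 ij.2); split => //.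
  by move=> ij; exact: proj_bmeasC.
move=> Phi Psi.
rewrite -(pair_bigA _ (fun i j => B Phi j i * @proj R L N Q Psi i j)) /=.
apply: eq_bigr => i _.
by rewrite mxE; apply: eq_bigr => j _ /=; rewrite mulrC.
Qed.

Lemma coef_det_bmeasC n (M : T -> 'M[{poly R[i]}]_n) :
  (forall i j k, bmeasC D (fun Phi => (M Phi i j)`_k)) ->
  forall k, bmeasC D (fun Phi => (\det (M Phi))`_k).
Proof.
move=> bM k.
apply: (@bmeasC_ext _ _ _ _ (fun Phi => \sum_(s : 'S_n)
    (-1) ^+ s * (\prod_i M Phi i (s i))`_k)).
  by move=> Phi; rewrite coef_sum; apply: eq_bigr => s _; rewrite coef_signM.
apply: bmeasC_sum => s _; apply: bmeasCZ.
by apply: coef_prod_bmeasC => i k' _; exact: bM.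
Qed.

Lemma elemx_bmeasC (B : T -> 'M[R[i]]_N) b :
  (forall i j, bmeasC D (fun Phi => B Phi i j)) ->
  forall i j, bmeasC D (fun Phi => elemx (B Phi) b i j).
Proof.
move=> bB i j.
apply: (@bmeasC_ext _ _ _ _ (fun Phi => (-1) ^+ (j + i) *
    (\det (row' j (col' i (affine_mx (B Phi)))))`_b)).
  by move=> Phi; rewrite [RHS]mxE [(\adj _) i j]mxE /cofactor coef_signM.
apply: bmeasCZ; apply: coef_det_bmeasC => k l m.
apply: (@bmeasC_ext _ _ _ _ (fun Phi => (lift j k == lift i l)%:R * (m == 0%N)%:R
    + B Phi (lift j k) (lift i l) * (m == 1%N)%:R)).
  move=> Phi; rewrite !mxE coefD coefMn coef1 coefXM coefC.
  case: (_ == _); rewrite ?mul1r ?mul0r; case: m => [|[|m]] /=;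
    by rewrite ?(mulr0, mulr1, mul0r, mul1r, addr0, add0r, mulr0n, mulr1n).
apply: bmeasCD; first exact: bmeasC_cst.
by apply: bmeasCM; [exact: bB | exact: bmeasC_cst].
Qed.

Variables (i0 : 'I_L) (Dd : 'M[R[i]]_N).
Hypothesis N_gt0 : (0 < N)%N.

Local Notation compl := (complete mu i0).
Local Notation Q0 := (delta_mx i0 i0 : 'M[R[i]]_L).
Definition compressed (Phi : T) : 'M[R[i]]_N := @proj R L N 1%:M Phi *m Dd.

Lemma compressed_bmeasC i j : bmeasC D (fun Phi => compressed Phi i j).
Proof.
by apply: bmeasC_mulmx => *; [exact: proj_bmeasC | exact: bmeasC_cst].
Qed.

Lemma hook_wick A a b : hook A (compl A) a b =
  (kappa R N a)^-1 * (N%:R + a%:R) *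
    E (fun Psi => \tr (@proj R L N Q0 Psi *m (A *m elemx A b)) *
                  \tr (@proj R L N Q0 Psi *m A) ^+ a).
Proof.
rewrite -mulrA -/(wick mu i0 A (A *m elemx A b) a).
by rewrite (wick_completex mu_iso) // mulKf ?kappa_neq0.
Qed.

Definition hook_kernel a b (Phi Psi : T) : R[i] :=
  \tr (@proj R L N Q0 Psi *m (compressed Phi *m elemx (compressed Phi) b)) *
  \tr (@proj R L N Q0 Psi *m compressed Phi) ^+ a.

Lemma hook_kernel_separable a b : separable_fun (hook_kernel a b).
Proof.
apply: separableM; last apply: separableX; apply: separable_trace => i j.
  apply: bmeasC_mulmx => k l; first exact: compressed_bmeasC.
  by apply: elemx_bmeasC; exact: compressed_bmeasC.
exact: compressed_bmeasC.
Qed.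

Lemma hook_bmeasC a b :
  bmeasC D (fun Phi => hook (compressed Phi) (compl (compressed Phi)) a b).
Proof.
apply: (bmeasC_ext _ (bmeasCZ _ (separable_bmeasC (hook_kernel_separable a b)))).
by move=> Phi; rewrite hook_wick.
Qed.

(** Once the means are exchanged psi is fixed, and Tr(psi psi^* B) = psi^* B psi gives the kernel
    the form averaged by [E_bordered], with Q = 1. The remaining mean over psi is read back by
    [hook_wick] as a hook of D. *)
Lemma E_hook a b :
  E (fun Phi => hook (compressed Phi) (compl (compressed Phi)) a b) =
  hook_ratio N (\tr (1%:M : 'M[R[i]]_L)) a b * hook Dd (compl Dd) a b.
Proof.
pose p := @proj R L N Q0; pose F := hook_kernel a b.
have sepF : separable_fun F := hook_kernel_separable a b.
transitivity (E (fun Phi => (kappa R N a)^-1 * (N%:R + a%:R) * E (F Phi))).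
  by apply: eq_EC => Phi _; rewrite hook_wick.
rewrite (EC_scale mD muD _ (separable_bmeasC sepF)) (separable_swap sepF).
rewrite hook_wick mulrCA; congr (_ * _).
have bmain : bmeasC D (fun Psi => \tr (p Psi *m (Dd *m elemx Dd b)) *
    \tr (p Psi *m Dd) ^+ a).
  by apply: bmeasCM; last apply: bmeasCX; exact: trace_proj_bmeasC.
rewrite -(EC_scale mD muD _ bmain); apply: eq_EC => Psi _.
pose w := col i0 (Psi : 'M[R[i]]_(N, L)); pose e := w^t*.
have trE B : \tr (p Psi *m B) = (e *m B *m w) 0 0.
  by rewrite /p proj_delta -mulmxA mxtrace_mulC /mxtrace big_ord1.
rewrite !trE [e *m (Dd *m _)]mulmxA.
apply: (etrans _ (E_bordered mu_iso (mulmx1 _) Dd e w a b)).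
apply: eq_EC => Phi _.
by rewrite /F /hook_kernel -/p !trE [e *m (compressed Phi *m _)]mulmxA.
Qed.

Lemma compressed_power_sum n :
  E (fun Phi => \tr (compressed Phi ^+ n.+1)) * n.+1%:R =
  \sum_(b < n.+1) (-1) ^+ b *
    (hook_ratio N (\tr (1%:M : 'M[R[i]]_L)) (n - b) b * hook Dd (compl Dd) (n - b) b).
Proof.
under eq_bigr do rewrite -E_hook -(EC_scale mD muD _ (hook_bmeasC _ _)).
rewrite -(EC_sum mD muD) => [|b _]; last exact/bmeasCZ/hook_bmeasC.
have btr : bmeasC D (fun Phi => \tr (compressed Phi ^+ n.+1)).
  apply: bmeasC_trace; elim: n => [|n IH] i j; first exact: compressed_bmeasC.
  apply: (@bmeasC_ext _ _ _ _ (fun Phi => (compressed Phi *m compressed Phi ^+ n.+1) i j)).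
    by move=> Phi; rewrite [in RHS]exprS.
  by apply: bmeasC_mulmx => k l; [exact: compressed_bmeasC | exact: IH].
rewrite mulrC -(EC_scale mD muD _ btr); apply: eq_EC => Phi _.
rewrite power_sum_hook ?mulr_natl //; first exact: complete0.
by move=> a; exact: complete_newton.
Qed.

End PowerSums.

(** * Monomials *)

Section HookRatio.
Variable R : realType.
Local Notation C := R[i].

Lemma prod_falling (n b : nat) : (b < n)%N ->
  \prod_(j < b.+1) (n%:R - j%:R : C) = n`!%:R / (n - b.+1)`!%:R.
Proof.
move=> bn; apply: (canRL (mulfK _)); first by rewrite pnatr_eq0 -lt0n fact_gt0.
rewrite -(ffact_fact bn) natrM ffact_prod natr_prod; congr (_ * _).
by apply: eq_bigr => j _; rewrite natrB // ltnW // (leq_trans (ltn_ord j)).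
Qed.

Lemma prod_rising (n a : nat) :
  \prod_(j < a) (n%:R + j.+1%:R : C) = (n + a)`!%:R / n`!%:R.
Proof.
have nf k : (k`!%:R : C) != 0 by rewrite pnatr_eq0 -lt0n fact_gt0.
elim: a => [|a IH]; first by rewrite big_ord0 addn0 divff.
rewrite big_ord_recr /= IH -natrD !addnS factS natrM.
by rewrite mulrAC [(_ * (n + a).+1%:R)]mulrC.
Qed.

Lemma hook_ratioE (L N a b : nat) : (b < L)%N -> (L <= N)%N ->
  hook_ratio N (L%:R : C) a b =
  (N - b.+1)`!%:R / (L - b.+1)`!%:R * ((L + a)`!%:R / (N + a)`!%:R).
Proof.
move=> bL LN; have bN := leq_trans bL LN.
have nf k : (k`!%:R : C) != 0 by rewrite pnatr_eq0 -lt0n fact_gt0.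
rewrite /hook_ratio !prodf_div !prod_falling // !prod_rising.
move: (nf L) (nf N) (nf (L - b.+1)%N) (nf (N - b.+1)%N) (nf (L + a)%N) (nf (N + a)%N).
move: (L`!%:R : C) (N`!%:R : C) ((L - b.+1)`!%:R : C) ((N - b.+1)`!%:R : C).
move: ((L + a)`!%:R : C) ((N + a)`!%:R : C) => la na l n lb nb.
by move=> *; field; do ?[apply/andP; split].
Qed.

Lemma hook_ratio_eq0 (L N a b : nat) : (L <= b)%N ->
  hook_ratio N (L%:R : C) a b = 0.
Proof.
move=> Lb; rewrite /hook_ratio (bigD1 (Ordinal (n := b.+1) (m := L) _)) //=.
by rewrite subrr !mul0r.
Qed.

Lemma prod_shift_fact (m p : nat) :
  \prod_(1 <= j < p.+1) (m + j)%:R = (m + p)`!%:R / m`!%:R :> C.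
Proof.
rewrite -prod_rising big_add1 big_mkord; apply: eq_bigr => j _.
by rewrite natrD.
Qed.

End HookRatio.

Section Monomial.
Context (R : realType) (L N : nat) (hL : (1 <= L)%N) (hLN : (L <= N)%N).
Variables (mu : probability (borelMx R N L) R) (mu_iso : isotropic mu).
Local Notation T := (borelMx R N L).
Local Notation D := (stiefel R L N).
Local Notation E := (Cintegral mu D).
Variable d : 'rV[R]_N.
Hypothesis Delta_neq0 : \det (Delta d) != 0.
Let muD : mu D = 1%E := proj1 mu_iso.
Let mD := @measurable_stiefel R L N.
Let dC : 'rV[R[i]]_N := map_mx (fun x => x%:C) d.
Local Notation Dd := (diag_mx dC).

Definition sandwich (Phi : T) : 'M[R[i]]_L :=
  (Phi : 'M[R[i]]_(N, L))^t* *m Dd *m (Phi : 'M[R[i]]_(N, L)).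

Lemma Delta_revVandermonde : Delta d = revVandermonde dC.
Proof. by apply/matrixP => i j; rewrite !mxE. Qed.

(** Cyclicity of the trace; at exponent 0 the two traces would be L and N. *)
Lemma trace_sandwichX Phi n :
  \tr (sandwich Phi ^+ n.+1) = \tr (compressed Dd Phi ^+ n.+1).
Proof.
rewrite /sandwich /compressed /proj mulmx1.
have [w [e [-> ->]]] : exists (w : 'M[R[i]]_(N, L)) (e : 'M[R[i]]_(L, N)),
    (Phi : 'M[R[i]]_(N, L))^t* = e /\ Phi = w by exists Phi, ((Phi : 'M[R[i]]_(N, L))^t*).
have power k : (e *m Dd *m w) ^+ k.+1 = e *m (Dd *m (w *m e *m Dd) ^+ k) *m w.
  elim: k => [|k IH]; first by rewrite expr1 expr0 mulmx1.
  by rewrite exprSr IH -mulmxE [in RHS]exprSr -mulmxE !mulmxA.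
by rewrite power mxtrace_mulC exprS -mulmxE !mulmxA.
Qed.

(** Row k of [Gmx] for f = x^n: the operator of order N - L applied to x^(L-k-1+n). *)
Definition monomial_row (k : nat) (n : nat) : 'rV[R[i]]_N :=
  \row_i (dC 0 i ^+ (L - k.+1 + n + (N - L)) /
          \prod_(1 <= j < (N - L).+1) (L - k.+1 + n + j)%:R).

Lemma E_trace_sandwichX n :
  E (fun Phi => \tr (sandwich Phi ^+ n)) =
  \sum_(k < L) ((N - k.+1)`!%:R / (L - k.+1)`!%:R) *
    (\det (setrow (widen_ord hLN k) (monomial_row k n) (Delta d)) / \det (Delta d)).
Proof.
have N_gt0 := leq_trans hL hLN.
have nf k : (k`!%:R : R[i]) != 0 by rewrite pnatr_eq0 -lt0n fact_gt0.
pose i0 := Ordinal hL.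
have exponent k : (k < L)%N -> (L - k.+1 + n + (N - L) = N - k.+1 + n)%N by lia.
have det_row (k : 'I_L) : \det (setrow (widen_ord hLN k) (monomial_row k n) (Delta d)) =
    (L - k.+1 + n)`!%:R / (N - k.+1 + n)`!%:R *
    \det (setrow (widen_ord hLN k) (\row_i dC 0 i ^+ (N - k.+1 + n)) (Delta d)).
  rewrite !det_setrow mulr_sumr; apply: eq_bigr => j _.
  rewrite [(monomial_row _ _) _ _]mxE [(\row_i _) 0 j]mxE prod_shift_fact.
  by rewrite exponent // invf_div; ring.
case: n exponent det_row => [|m] exponent det_row.
  (* For n = 0 the new row k is a multiple of the old one and each of the L summands equals 1. *)
  transitivity (L%:R : R[i]).
    rewrite -[RHS](EC_cst mD muD); apply: eq_EC => Phi _.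
    by rewrite expr0 mxtrace1.
  rewrite -[X in X%:R](card_ord L) -sumr_const; apply: eq_bigr => k _.
  rewrite det_row !addn0.
  have -> : setrow (widen_ord hLN k) (\row_i dC 0 i ^+ (N - k.+1)) (Delta d) = Delta d.
    apply/matrixP => i j; rewrite !mxE; case: eqP => // ->.
    by [].
  by rewrite mulfK // -[X in _ * X]invf_div divff // mulf_neq0 ?invr_eq0.
have m0 : m.+1%:R != 0 :> R[i] by rewrite pnatr_eq0.
apply: (mulIf m0).
transitivity (E (fun Phi => \tr (compressed Dd Phi ^+ m.+1)) * m.+1%:R).
  by congr (_ * _); apply: eq_EC => Phi _; rewrite trace_sandwichX.
rewrite (compressed_power_sum mu_iso i0) // mxtrace1.
pose G (b : nat) : R[i] := (-1) ^+ b *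
  (hook_ratio N L%:R (m - b) b * hook Dd (complete mu i0 Dd) (m - b) b).
transitivity (\sum_(b < m.+1 | (b < L)%N) G b).
  rewrite [RHS]big_mkcond; apply: eq_bigr => b _; case: ltnP => // Lb.
  by rewrite hook_ratio_eq0 // mul0r mulr0.
(* The leg length b of the hook becomes the index k of the replaced row. *)
transitivity (\sum_(b < L | (b < m.+1)%N) G b).
  rewrite (big_ord_widen_cond _ (fun b => (b < L)%N) G (leq_maxr L m.+1)).
  rewrite [RHS](big_ord_widen_cond _ (fun b => (b < m.+1)%N) G (leq_maxl L m.+1)).
  by apply: eq_bigl => b; rewrite andbC.
rewrite [LHS]big_mkcond mulr_suml; apply: eq_bigr => k _.
rewrite det_row Delta_revVandermonde.
case: ltnP => km.
  have -> : (N - k.+1 + m.+1 = N + (m - k))%N by have := ltn_ord k; lia.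
  have -> : (L - k.+1 + m.+1 = L + (m - k))%N by have := ltn_ord k; lia.
  rewrite (det_setrow_hook (h := complete mu i0 Dd)) //; first last.
  - by move=> a; exact: complete_newton.
  - exact: complete0.
  rewrite /schur_hook subnK // /G hook_ratioE //.
  have D0 : \det (revVandermonde dC) != 0 by rewrite -Delta_revVandermonde.
  move: (nf (N - k.+1)%N) (nf (L - k.+1)%N) (nf (L + (m - k))%N) (nf (N + (m - k))%N).
  move: ((N - k.+1)`!%:R : R[i]) ((L - k.+1)`!%:R : R[i]).
  move: ((L + (m - k))`!%:R : R[i]) ((N + (m - k))`!%:R : R[i]).
  move: (\det _) D0 (hook _ _ _ _) ((-1) ^+ k) (m.+1%:R : R[i]) m0.
  move=> v v0 x s M M0 la na nb lb nb0 lb0 la0 na0.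
  by field; rewrite v0 M0 lb0 na0.
(* Rows k > m correspond to no hook: the exponent N - k + m is below N and differs from N - k - 1,
   so two rows coincide. *)
rewrite det_setrow_dup; first by rewrite mulr0 mul0r mulr0 mul0r.
  by have := ltn_ord k; lia.
by have := ltn_ord k; rewrite /=; lia.
Qed.

End Monomial.

(** * Weierstrass approximation *)

Section Bernstein.
Variable R : realType.

(** De Casteljau's recursion. The value at x is the mean of [g] under the binomial law with
    parameters n and x; rescaling the nodes to k/n is left to the use. *)
Fixpoint bernstein (n : nat) (g : nat -> R) : {poly R} :=
  if n is m.+1 then
    (1 - 'X) * bernstein m g + 'X * bernstein m (fun k => g k.+1)
  else (g 0)%:P.

Lemma bernsteinS n g x : (bernstein n.+1 g).[x] =
  (1 - x) * (bernstein n g).[x] + x * (bernstein n (fun k => g k.+1)).[x].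
Proof. by rewrite /= !hornerE. Qed.

Lemma le_bernstein n (g h : nat -> R) (x : R) : 0 <= x <= 1 ->
  (forall k, (k <= n)%N -> g k <= h k) ->
  (bernstein n g).[x] <= (bernstein n h).[x].
Proof.
move=> /andP[x0 x1]; elim: n g h => [|n IH] g h gh.
  by rewrite !hornerC gh.
rewrite !bernsteinS lerD // ler_wpM2l ?subr_ge0 //; apply: IH => k kn; apply: gh.
  exact: leqW.
by [].
Qed.

(** The second moment of a binomial variable about [c]: its variance plus the squared bias. *)
Lemma bernstein_quadratic n (a b c x : R) :
  (bernstein n (fun k => a + b * (k%:R - c) ^+ 2)).[x] =
  a + b * (n%:R * x * (1 - x) + (n%:R * x - c) ^+ 2).
Proof.
elim: n c => [|n IH] c; first by rewrite hornerC; ring.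
rewrite bernsteinS IH.
have -> : (fun k => a + b * (k.+1%:R - c) ^+ 2) =
    fun k => a + b * (k%:R - (c - 1)) ^+ 2.
  by apply/funext => k; rewrite -natr1; congr (a + b * _ ^+ 2); ring.
by rewrite IH -natr1; ring.
Qed.

End Bernstein.

(** * Continuity on a segment *)

Section SegmentContinuity.
Variable R : realType.

Definition cont_on (a b : R) (g : R -> R) :=
  forall x e, x \in `[a, b] -> 0 < e ->
  exists2 dl : R, 0 < dl &
    forall y, y \in `[a, b] -> `|x - y| < dl -> `|g x - g y| < e.

(** Heine-Cantor: a modulus for e / 2 at each point is halved, and the covering form of compactness
    makes it uniform. *)
Lemma cont_on_unif (a b : R) (g : R -> R) (e : R) : cont_on a b g -> 0 < e ->
  exists2 dl : R, 0 < dl & forall x y, x \in `[a, b] -> y \in `[a, b] ->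
    `|x - y| < dl -> `|g x - g y| < e.
Proof.
move=> cg e0.
have /compact_near_coveringP cK := @segment_compact R a b.
have e20 : 0 < e / 2 by rewrite divr_gt0.
have cov : \forall dl \near 0^'+, `[a, b]%classic `<=` (fun x => forall y,
    y \in `[a, b] -> `|x - y| < dl -> `|g x - g y| < e).
  apply: (@filterS _ _ _ (fun dl : R => `[a, b]%classic `<=` fun x => x \in `[a, b] ->
     forall y, y \in `[a, b] -> `|x - y| < dl -> `|g x - g y| < e)).
    by move=> dl h x xK; exact: h.
  apply: (cK R (0^'+) (fun dl x => x \in `[a, b] -> forall y,
    y \in `[a, b] -> `|x - y| < dl -> `|g x - g y| < e)) => x xK.
  have [dl dl0 h] := cg x (e / 2) xK e20.
  have dl20 : 0 < dl / 2 by rewrite divr_gt0.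
  exists (ball x (dl / 2), [set t | t < dl / 2]).
    split; first exact: nbhsx_ballx.
    exact: nbhs_right_lt.
  move=> [x' t] [/= bx tdl] x'K y yK x'y.
  rewrite -ball_normE /= in bx.
  rewrite (le_lt_trans (ler_distD (g x) _ _)) // [e]splitr ltrD //.
    by rewrite distrC h // (lt_trans bx) // gtr_pMr // invf_lt1 // ltr1n.
  rewrite h // (le_lt_trans (ler_distD x' _ _)) // [dl]splitr ltrD //.
  exact: lt_trans x'y tdl.
near (0:R)^'+ => dl; exists dl; first by near: dl; exact: nbhs_right_gt.
suff h : `[a, b]%classic `<=` (fun x => forall y,
    y \in `[a, b] -> `|x - y| < dl -> `|g x - g y| < e) by move=> x y xK; exact: h.
by near: dl.
Unshelve. all: by end_near.
Qed.

Lemma cont_on_bounded (a b : R) (g : R -> R) : cont_on a b g ->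
  exists M : R, forall x, x \in `[a, b] -> `|g x| <= M.
Proof.
move=> cg; have [dl dl0 h] := cont_on_unif cg ltr01.
have /compact_near_coveringP cK := @segment_compact R a b.
have cov : \forall M \near +oo%R, `[a, b]%classic `<=` (fun x => `|g x| <= M).
  apply: (@filterS _ _ _ (fun M : R => `[a, b]%classic `<=`
     fun x => x \in `[a, b] -> `|g x| <= M)).
    by move=> M bd x xK; exact: bd.
  apply: (cK R (+oo%R) (fun M x => x \in `[a, b] -> `|g x| <= M)) => x xK.
  exists (ball x dl, [set t | `|g x| + 1 < t]).
    split; first exact: nbhsx_ballx.
    exists (`|g x| + 1); split => //; exact: num_real.
  move=> [x' t] [/= bx tM] x'K.
  rewrite -ball_normE /= in bx.
  rewrite ltW // (le_lt_trans _ tM) // -[g x'](subKr (g x)).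
  by rewrite (le_trans (ler_normB _ _)) // lerD2l ltW // h.
near (+oo%R : set_system R) => M; exists M.
suff bd : `[a, b]%classic `<=` (fun x => `|g x| <= M) by move=> x xK; exact: bd.
by near: M.
Unshelve. all: by end_near.
Qed.

Lemma within_cont_on (a b : R) (g : R -> R) :
  {within `[a, b], continuous g} <-> cont_on a b g.
Proof.
split=> [/subspace_continuousP|] cg.
  move=> x e xK e0; have /cvgrPdist_lt/(_ e e0) := cg x xK.
  by case=> dl /= dl0 h; exists dl => // y yK xy; exact: h.
apply/subspace_continuousP => x xK; apply/cvgrPdist_lt => e e0.
by have [dl dl0 h] := cg x e xK e0; exists dl => //= y xy yK; exact: h.
Qed.

Lemma C0P (r : R) (F : R -> R[i]) : C0 r F <->
  cont_on 0 r (fun x => complex.Re (F x)) /\ cont_on 0 r (fun x => complex.Im (F x)).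
Proof.
split=> [cF|[cRe cIm]].
  split; apply/within_cont_on => x.
    apply: (@continuous_comp _ _ _ (F : subspace _ -> R[i]^o) (@complex.Re R : R[i]^o -> R)).
      exact: cF.
    exact: Re_continuous.
  apply: (@continuous_comp _ _ _ (F : subspace _ -> R[i]^o) (@complex.Im R : R[i]^o -> R)).
    exact: cF.
  exact: Im_continuous.
apply/(@subspace_continuousP _ _ R[i]^o) => x xK.
apply/(@cvgrPdist_lt _ R[i]^o) => -[e e'].
rewrite ltcE /= => /andP[/eqP -> e0].
have e20 : 0 < e / 2 by rewrite divr_gt0.
have [d1 d10 h1] := cRe x _ xK e20.
have [d2 d20 h2] := cIm x _ xK e20.
exists (Num.min d1 d2) => /=; first by rewrite lt_min d10.
move=> y /=; rewrite lt_min => /andP[y1 y2] yK.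
have -> : e +i* 0 = (e / 2 + e / 2)%:C by rewrite -splitr.
apply: le_lt_trans (norm_complex_le _) _.
rewrite ltcR.
have -> : complex.Re (F x - F y) = complex.Re (F x) - complex.Re (F y).
  by case: (F x) (F y) => [? ?] [? ?].
have -> : complex.Im (F x - F y) = complex.Im (F x) - complex.Im (F y).
  by case: (F x) (F y) => [? ?] [? ?].
by rewrite ltrD // ?h1 ?h2.
Qed.

End SegmentContinuity.

Section Weierstrass.
Variable R : realType.

Lemma weierstrass01 (g : R -> R) (e : R) : cont_on 0 1 g -> 0 < e ->
  exists q : {poly R}, forall x, x \in `[0, 1] -> `|g x - q.[x]| <= e.
Proof.
move=> cg e0.
have e20 : 0 < e / 2 by rewrite divr_gt0.
have [dl dl0 h] := cont_on_unif cg e20.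
have [M gM] := cont_on_bounded cg.
have M0 : 0 <= M by apply: le_trans (gM 0 _); rewrite // in_itv /= lexx ler01.
(* Chosen so that B (x - y)^2 is at least 2 M once |x - y| >= dl, which gives a quadratic modulus
   valid for all pairs. *)
pose B := 2 * M / dl ^+ 2.
have B0 : 0 <= B.
  by rewrite divr_ge0 ?exprn_ge0 ?(ltW dl0) // mulr_ge0 // ler0n.
have close x y : x \in `[0, 1] -> y \in `[0, 1] ->
    `|g x - g y| <= e / 2 + B * (x - y) ^+ 2.
  move=> xK yK; case: (ltP `|x - y| dl) => xy.
    by rewrite (le_trans (ltW (h x y xK yK xy))) // lerDl mulr_ge0 ?sqr_ge0.
  rewrite (le_trans (ler_normB _ _)) //.
  rewrite (le_trans (lerD (gM x xK) (gM y yK))) //.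
  rewrite -[leLHS]add0r lerD ?(ltW e20) // /B mulrAC.
  rewrite ler_pdivlMr ?exprn_gt0 // -mulr2n mulr_natl ler_wpM2l //.
    by rewrite mulrn_wge0.
  rewrite -(real_normK (num_real (x - y))) lerXn2r ?nnegrE //; exact: ltW.
(* Chebyshev's argument: the binomial variance turns the quadratic modulus into an error of at most
   B / n. *)
pose n := (Num.truncn (B / (e / 2))).+1.
have nB : B / n%:R <= e / 2.
  rewrite ler_pdivrMr // mulrC -ler_pdivrMr //.
  exact/ltW/truncnS_gt.
have n0 : n%:R != 0 :> R by rewrite pnatr_eq0.
exists (bernstein n (fun k => g (k%:R / n%:R))) => x xK.
have x01 : 0 <= x <= 1 by move: xK; rewrite in_itv.
have bound k : (k <= n)%N -> `|g x - g (k%:R / n%:R)| <=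
    e / 2 + B / n%:R ^+ 2 * (k%:R - n%:R * x) ^+ 2.
  move=> kn; apply: le_trans (close _ _ xK _) _.
    by rewrite in_itv /= divr_ge0 //= ler_pdivrMr // mul1r ler_nat.
  rewrite lerD2l le_eqVlt; apply/orP; left; apply/eqP.
  by move: (n%:R : R) n0 (k%:R : R) => m m0 k'; field.
have quad a b s : (bernstein n (fun k => a + s * (e / 2 +
     b * (k%:R - n%:R * x) ^+ 2))).[x] = a + s * (e / 2 + b * (n%:R * x * (1 - x))).
  have := bernstein_quadratic n (a + s * (e / 2)) (s * b) (n%:R * x) x.
  rewrite subrr expr0n addr0 => q.
  transitivity (a + s * (e / 2) + s * b * (n%:R * x * (1 - x))); last by ring.
  rewrite -q; congr (horner (bernstein _ _) _); apply/funext => k; ring.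
have small : e / 2 + B / n%:R ^+ 2 * (n%:R * x * (1 - x)) <= e.
  rewrite [leRHS]splitr lerD2l (le_trans _ nB) //.
  have -> : B / n%:R ^+ 2 * (n%:R * x * (1 - x)) = B / n%:R * (x * (1 - x)).
    by move: (n%:R : R) n0 => m m0; field.
  case/andP: x01 => x0 x1.
  have Bn : 0 <= B / n%:R by rewrite divr_ge0.
  rewrite (ler_piMr Bn) // mulr_ile1 ?subr_ge0 //; lra.
rewrite ler_distlC; apply/andP; split.
  apply: (@le_trans _ _ (g x + (-1) * (e / 2 + B / n%:R ^+ 2 * (n%:R * x * (1 - x))))).
    by rewrite mulN1r lerD2l lerN2.
  rewrite -quad.
  apply: le_bernstein => // k kn; rewrite mulN1r.
  by have := bound k kn; rewrite ler_distlC => /andP[].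
apply: (@le_trans _ _ (g x + 1 * (e / 2 + B / n%:R ^+ 2 * (n%:R * x * (1 - x))))); last first.
  by rewrite mul1r lerD2l.
rewrite -quad.
apply: le_bernstein => // k kn; rewrite mul1r.
by have := bound k kn; rewrite ler_distlC => /andP[].
Qed.

Lemma weierstrass (r : R) (g : R -> R) (e : R) : 0 < r -> cont_on 0 r g -> 0 < e ->
  exists q : {poly R}, forall x, x \in `[0, r] -> `|g x - q.[x]| <= e.
Proof.
move=> r0 cg e0.
have scale x : x \in `[0, 1] -> r * x \in `[0, r].
  by rewrite !in_itv /= => /andP[x0 x1]; rewrite mulr_ge0 ?(ltW r0) //= ger_pMr.
have [|q hq] := @weierstrass01 (fun x => g (r * x)) e _ e0.
  move=> x e' xK e'0; have [dl dl0 h] := cg _ _ (scale _ xK) e'0.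
  exists (dl / r); first by rewrite divr_gt0.
  move=> y yK xy; apply: h; first exact: scale.
  by rewrite -mulrBr normrM gtr0_norm // mulrC -ltr_pdivlMr.
exists (q \Po (r^-1 *: 'X)) => x; rewrite in_itv /= => /andP[x0 xr].
rewrite horner_comp !hornerE.
have := hq (r^-1 * x); rewrite mulVKf ?gt_eqF //; apply.
by rewrite in_itv /= mulr_ge0 ?invr_ge0 ?(ltW r0) //= mulrC ler_pdivrMr // mul1r.
Qed.

Lemma horner_real (q : {poly R}) (x : R) :
  (map_poly (fun x => x%:C) q).[x%:C] = (q.[x])%:C.
Proof. exact: (@horner_map _ _ (real_complex R)). Qed.

Lemma weierstrassC (r : R) (F : R -> R[i]) (e : R) : 0 < r -> C0 r F -> 0 < e ->
  exists q : {poly R[i]}, forall x, x \in `[0, r] -> `|F x - q.[x%:C]| <= e%:C.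
Proof.
move=> r0 /C0P[cRe cIm] e0.
have e20 : 0 < e / 2 by rewrite divr_gt0.
have [p hp] := weierstrass r0 cRe e20.
have [q hq] := weierstrass r0 cIm e20.
exists (map_poly (fun x => x%:C) p + 'i%:P * map_poly (fun x => x%:C) q) => x xK.
rewrite hornerD hornerM hornerC !horner_real.
apply: le_trans (norm_complex_le _) _.
rewrite lecR [leRHS]splitr.
case: (F x) (hp x xK) (hq x xK) => a b /= h1 h2.
by rewrite lerD //; rewrite !(mul0r, mul1r, mulr0, subr0, add0r, addr0, oppr0).
Qed.

End Weierstrass.

(** * Iterated antiderivatives *)

Section Antiderivative.
Variables (R : realType) (r : R).
Hypothesis r0 : 0 < r.
Local Notation leb := (@lebesgue_measure R).

Definition antideriv (g : R -> R) (x : R) : R := parameterized_integral leb 0 x g.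

Lemma cont_on_integrable (g : R -> R) x : cont_on 0 r g -> x <= r ->
  leb.-integrable `[0, x] (EFin \o g).
Proof.
move=> /within_cont_on cg xr.
have : leb.-integrable `[0, r] (EFin \o g).
  by apply: continuous_compact_integrable => //; exact: segment_compact.
apply: integrableS => //.
exact: subset_itvl.
Qed.

Lemma cont_on_antideriv g : cont_on 0 r g -> cont_on 0 r (antideriv g).
Proof.
move=> cg; apply/within_cont_on.
by apply: parameterized_integral_continuous (ltW r0) (cont_on_integrable cg (lexx r)).
Qed.

Lemma eq_antideriv g h x : (forall y, y \in `[0, x] -> g y = h y) ->
  antideriv g x = antideriv h x.
Proof. by move=> gh; apply: eq_Rintegral => y /set_mem; exact: gh. Qed.

Lemma antiderivD g h x : cont_on 0 r g -> cont_on 0 r h -> x <= r ->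
  antideriv (fun y => g y + h y) x = antideriv g x + antideriv h x.
Proof.
by move=> cg ch xr; rewrite /antideriv /parameterized_integral RintegralD //;
  exact: cont_on_integrable.
Qed.

Lemma antiderivZ a g x : cont_on 0 r g -> x <= r ->
  antideriv (fun y => a * g y) x = a * antideriv g x.
Proof.
by move=> cg xr; rewrite /antideriv /parameterized_integral RintegralZl //;
  exact: cont_on_integrable.
Qed.

Lemma norm_antideriv_le g (M x : R) : cont_on 0 r g -> x \in `[0, r] ->
  (forall y, y \in `[0, r] -> `|g y| <= M) -> `|antideriv g x| <= r * M.
Proof.
move=> cg; rewrite in_itv /= => /andP[x0 xr] gM.
have ig := cont_on_integrable cg xr.
have M0 : 0 <= M.
  by apply: le_trans (gM 0 _); rewrite // in_itv /= lexx ltW.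
apply: (@le_trans _ _ (M * x)); last by rewrite mulrC ler_wpM2r.
apply: le_trans (le_normr_Rintegral _ ig) _ => //.
apply: (@le_trans _ _ (Rintegral leb `[0, x] (fun=> M))).
  apply: le_Rintegral => //.
  - by have := integrable_norm ig.
  - apply: (@cont_on_integrable (fun=> M)) => // y e yK e0.
    by exists 1 => // z _ _; rewrite subrr normr0.
  - move=> y; rewrite /= in_itv /= => /andP[y0 yx]; apply: gM.
    by rewrite in_itv /= y0 (le_trans yx).
have e : fine (leb `[0, x]%classic) = x.
  rewrite lebesgue_measure_itv /= lte_fin.
  by case: ltP x0 => [_ _|h1 h2]; [rewrite /= subr0|apply/eqP; rewrite eq_le h1 h2].
rewrite (Rintegral_cst leb (measurable_itv `[0, x])) le_eqVlt.
by apply/orP; left; apply/eqP; congr (_ * _); exact: e.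
Qed.

Lemma antiderivX n x : 0 <= x -> antideriv (fun y => y ^+ n) x = x ^+ n.+1 / n.+1%:R.
Proof.
rewrite le_eqVlt => /predU1P[<-|x0].
  by rewrite /antideriv /parameterized_integral set_itv1 Rintegral_set1 exprS mul0r mul0r.
have n0 : n.+1%:R != 0 :> R by rewrite pnatr_eq0.
have cX m : {within `[0, x], continuous (fun y : R => y ^+ m)}.
  by apply: continuous_subspaceT => y; exact: exprn_continuous.
have FTC : Rintegral leb `[0, x] (fun y => n.+1%:R * y ^+ n) = x ^+ n.+1.
  rewrite /Rintegral (@continuous_FTC2 _ _ (@GRing.exp R ^~ n.+1)) //=.
  - by rewrite expr0n subr0.
  - apply: continuous_subspaceT => y.
    by apply: cvgM; [exact: cvg_cst|exact: exprn_continuous].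
  - split.
    + by move=> y _; exact: exprn_derivable.
    + exact/cvg_at_right_filter/exprn_continuous.
    + exact/cvg_at_left_filter/exprn_continuous.
  - by move=> y _; rewrite derive1E exp_derive scaler1.
rewrite -FTC RintegralZl //; first by rewrite mulrC mulKf.
by apply: continuous_compact_integrable; [exact: segment_compact|exact: cX].
Qed.

End Antiderivative.

(** * Bounded operators on C[0, r] *)

Section BoundedOperators.
Variables (R : realType) (r : R).
Hypothesis r0 : 0 < r.
Implicit Types (g h : R -> R[i]) (T : (R -> R[i]) -> R -> R[i]).

Lemma C0_cst (a : R[i]) : C0 r (fun=> a).
Proof.
by apply/C0P; split=> x e _ e0; exists 1 => // y _ _; rewrite subrr normr0.
Qed.

Lemma cont_onD (g h : R -> R) : cont_on 0 r g -> cont_on 0 r h ->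
  cont_on 0 r (fun y => g y + h y).
Proof.
move=> /within_cont_on cg /within_cont_on ch; apply/within_cont_on => x.
by apply: (@continuousD R R (subspace `[0, r])); [exact: cg|exact: ch].
Qed.

Lemma cont_onM (g h : R -> R) : cont_on 0 r g -> cont_on 0 r h ->
  cont_on 0 r (fun y => g y * h y).
Proof.
move=> /within_cont_on cg /within_cont_on ch; apply/within_cont_on => x.
by apply: (@continuousM R (subspace `[0, r])); [exact: cg|exact: ch].
Qed.

Lemma cont_onZ a (g : R -> R) : cont_on 0 r g -> cont_on 0 r (fun y => a * g y).
Proof.
by apply: cont_onM => x e _ e0; exists 1 => // y _ _; rewrite subrr normr0.
Qed.

Lemma C0D g h : C0 r g -> C0 r h -> C0 r (fun x => g x + h x).
Proof.
move=> /C0P[g1 g2] /C0P[h1 h2]; apply/C0P; split.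
  rewrite (_ : (fun _ => _) = fun x => complex.Re (g x) + complex.Re (h x)).
    exact: cont_onD.
  by apply/funext => x; case: (g x) (h x) => [? ?] [? ?].
rewrite (_ : (fun _ => _) = fun x => complex.Im (g x) + complex.Im (h x)).
  exact: cont_onD.
by apply/funext => x; case: (g x) (h x) => [? ?] [? ?].
Qed.

Lemma C0M g h : C0 r g -> C0 r h -> C0 r (fun x => g x * h x).
Proof.
move=> /C0P[g1 g2] /C0P[h1 h2]; apply/C0P; split.
  rewrite (_ : (fun _ => _) = fun x => complex.Re (g x) * complex.Re (h x) +
      (- 1) * (complex.Im (g x) * complex.Im (h x))).
    by apply: cont_onD; [|apply: cont_onZ]; exact: cont_onM.
  by apply/funext => x; rewrite Re_mulC mulN1r.
rewrite (_ : (fun _ => _) = fun x => complex.Re (g x) * complex.Im (h x) +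
    complex.Im (g x) * complex.Re (h x)).
  by apply: cont_onD; exact: cont_onM.
by apply/funext => x; rewrite Im_mulC.
Qed.

Lemma C0B g h : C0 r g -> C0 r h -> C0 r (fun x => g x - h x).
Proof.
move=> cg ch; rewrite (_ : (fun _ => _) = fun x => g x + (-1) * h x).
  by apply: C0D cg _; apply: C0M ch; exact: C0_cst.
by apply/funext => x; rewrite mulN1r.
Qed.

Lemma C0_id : C0 r (fun x => x%:C).
Proof.
apply/C0P; split=> x e _ e0.
  by exists e.
by exists 1 => // y _ _ /=; rewrite subrr normr0.
Qed.

Lemma C0X g n : C0 r g -> C0 r (fun x => g x ^+ n).
Proof.
move=> cg; elim: n => [|n IH].
  by rewrite (_ : (fun _ => _) = fun=> 1); [exact: C0_cst|apply/funext => x].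
rewrite (_ : (fun _ => _) = fun x => g x * g x ^+ n); first exact: C0M.
by apply/funext => x; rewrite exprS.
Qed.

Lemma C0_horner (q : {poly R[i]}) : C0 r (fun x => q.[x%:C]).
Proof.
elim/poly_ind: q => [|q c IH].
  by rewrite (_ : (fun _ => _) = fun=> 0); [exact: C0_cst|apply/funext => x; rewrite horner0].
rewrite (_ : (fun _ => _) = fun x => q.[x%:C] * x%:C + c).
  apply: C0D; last exact: C0_cst.
  exact: C0M IH C0_id.
by apply/funext => x; rewrite !hornerE.
Qed.

Definition linear_on T :=
  forall (a : R[i]) g h, C0 r g -> C0 r h -> forall x : R, x \in `[0, r] ->
    T (fun y => a * g y + h y) x = a * T g x + T h x.

Definition bounded_on T := exists2 K : R, 0 < K &
  forall g (M : R), C0 r g -> (forall x, x \in `[0, r] -> `|g x| <= M%:C) ->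
  forall x, x \in `[0, r] -> `|T g x| <= (K * M)%:C.

Definition C0_operator T :=
  [/\ forall g, C0 r g -> C0 r (T g), linear_on T & bounded_on T].

Lemma linear_onB T g h (x : R) : linear_on T -> C0 r g -> C0 r h -> x \in `[0, r] ->
  T (fun y => g y - h y) x = T g x - T h x.
Proof.
move=> linT cg ch xK; have := linT (-1) h g ch cg x xK.
rewrite mulN1r addrC => <-; congr (T _ x).
by apply/funext => y; rewrite mulN1r addrC.
Qed.

Lemma linear_on0 T (x : R) : linear_on T -> x \in `[0, r] -> T (fun=> 0) x = 0.
Proof.
move=> linT xK;
have e := linear_onB linT (@C0_cst 0) (@C0_cst 0) xK; rewrite [RHS]subrr in e.
by apply: etrans e; congr (T _ x); apply/funext => y; rewrite subr0.
Qed.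

Lemma linear_onZ T a g (x : R) : linear_on T -> C0 r g -> x \in `[0, r] ->
  T (fun y => a * g y) x = a * T g x.
Proof.
move=> linT cg xK; have := linT a g (fun=> 0) cg (@C0_cst 0) x xK.
rewrite linear_on0 // addr0 => <-; congr (T _ x).
by apply/funext => y; rewrite addr0.
Qed.

(** Functions are total, so agreement on [0, r] is weaker than equality; boundedness with M = 0
    shows that an operator sees only the values on the segment. This makes composition and iteration
    possible. *)
Lemma C0_operator_eq T g h (x : R) : C0_operator T -> C0 r g -> C0 r h ->
  (forall y, y \in `[0, r] -> g y = h y) -> x \in `[0, r] -> T g x = T h x.
Proof.
move=> [_ linT [K K0 bT]] cg ch gh xK; apply/eqP; rewrite -subr_eq0.
rewrite -linear_onB // -normr_eq0 eq_le normr_ge0 andbT.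
have -> : 0 = (K * 0)%:C :> R[i] by rewrite mulr0.
apply: (bT _ _ (C0B cg ch) _ x xK).
by move=> y yK; rewrite gh // subrr normr0.
Qed.

Lemma C0_operator_id : C0_operator id.
Proof. by split=> //; exists 1 => // g M cg gM x xK; rewrite mul1r gM. Qed.

Lemma C0_operator_comp S T : C0_operator S -> C0_operator T -> C0_operator (S \o T).
Proof.
move=> opS opT; have [pS linS [K K0 bS]] := opS; have [pT linT [K' K'0 bT]] := opT.
split=> [g cg|a g h cg ch x xK|]; first exact: (pS _ (pT _ cg)).
  apply: etrans (linS a (T g) (T h) (pT _ cg) (pT _ ch) x xK).
  apply: (@C0_operator_eq S (T (fun y => a * g y + h y)) (fun y => a * T g y + T h y) x opS _ _ _ xK).
  - by apply: pT; apply: C0D ch; apply: C0M cg; exact: C0_cst.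
  - apply: C0D (pT _ ch); apply: C0M (pT _ cg); exact: C0_cst.
  - by move=> y yK; exact: (linT a g h cg ch y yK).
exists (K * K'); first exact: mulr_gt0.
move=> g M cg gM x xK; rewrite -mulrA.
by apply: (bS _ _ (pT _ cg)) => // y yK; exact: (bT g M cg gM y yK).
Qed.

Definition antiderivC (g : R -> R[i]) (x : R) : R[i] :=
  antideriv (fun y => complex.Re (g y)) x +i*
  antideriv (fun y => complex.Im (g y)) x.

Lemma C0_operator_antiderivC : C0_operator antiderivC.
Proof.
have in_le (x : R) : x \in `[0, r] -> x <= r by rewrite in_itv => /andP[].
split=> [g /C0P[c1 c2]|[a b] g h /C0P[g1 g2] /C0P[h1 h2] x xK|].
- by apply/C0P; split; exact: cont_on_antideriv.
- have xr := in_le x xK.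
  apply/eqP; rewrite eq_complex; apply/andP; split; apply/eqP.
    transitivity (antideriv (fun y => (a * complex.Re (g y) +
        (- b) * complex.Im (g y)) + complex.Re (h y)) x).
      apply: eq_antideriv => y _.
      by case: (g y) (h y) => [? ?] [? ?] /=; rewrite mulNr.
    have e1 := cont_onZ a g1; have e2 := cont_onZ (- b) g2.
    rewrite (antiderivD (cont_onD e1 e2) h1 xr) (antiderivD e1 e2 xr).
    rewrite (antiderivZ a g1 xr) (antiderivZ (- b) g2 xr).
    by rewrite /= mulNr.
  transitivity (antideriv (fun y => (a * complex.Im (g y) +
      b * complex.Re (g y)) + complex.Im (h y)) x).
    by apply: eq_antideriv => y _; case: (g y) (h y) => [? ?] [? ?].
  have e1 := cont_onZ a g2; have e2 := cont_onZ b g1.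
  rewrite (antiderivD (cont_onD e1 e2) h2 xr) (antiderivD e1 e2 xr).
  by rewrite (antiderivZ a g2 xr) (antiderivZ b g1 xr).
- exists (r + r); first exact: addr_gt0.
  move=> g M /C0P[g1 g2] gM x xK.
  apply: le_trans (norm_complex_le _) _; rewrite lecR mulrDl lerD //=.
    by apply: norm_antideriv_le => // y yK; exact/norm_Re_le/gM.
  by apply: norm_antideriv_le => // y yK; exact/norm_Im_le/gM.
Qed.

Lemma antiderivCX n (x : R) : 0 <= x ->
  antiderivC (fun y => y%:C ^+ n) x = x%:C ^+ n.+1 / n.+1%:R.
Proof.
move=> x0; rewrite /antiderivC.
have powR (y : R) m : y%:C ^+ m = (y ^+ m)%:C by rewrite rmorphXn.
have -> : antideriv (fun y => complex.Re (y%:C ^+ n : R[i])) x = x ^+ n.+1 / n.+1%:R.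
  by rewrite -antiderivX //; apply: eq_antideriv => y _; rewrite powR.
have -> : antideriv (fun y => complex.Im (y%:C ^+ n : R[i])) x = 0.
  transitivity (antideriv (fun=> 0 : R) x).
    by apply: eq_antideriv => y _; rewrite powR.
  rewrite /antideriv /parameterized_integral.
  by rewrite /Rintegral integral0.
by rewrite powR -(rmorph_nat (real_complex R)) -fmorphV -rmorphM.
Qed.

End BoundedOperators.

(** * Existence of the operators I^(p) *)

Section IopExistence.
Variables (R : realType) (r : R).
Hypothesis r0 : 0 < r.
Implicit Types (g h : R -> R[i]) (T : (R -> R[i]) -> R -> R[i]).

Lemma entourage_complexP (E : set (R[i]^o * R[i]^o)) : entourage E <->
  exists2 e : R, 0 < e & forall a b : R[i], `|a - b| < e%:C -> E (a, b).
Proof.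
rewrite -entourage_ballE; split=> [[[e e'] /=]|[e e0 eE]].
  rewrite ltcE /= => /andP[/eqP -> e0] eE; exists e => // a b ab.
  by apply: eE; rewrite /= -ball_normE.
exists e%:C; first by rewrite /= ltcR.
by move=> [a b] /=; rewrite -ball_normE; exact: eE.
Qed.

Lemma uniform_continuousP T :
  {within (C0 r : set {uniform` `[0, r] -> R[i]^o}), continuous
    (T : {uniform` `[0, r] -> R[i]^o} -> {uniform` `[0, r] -> R[i]^o})} <->
  forall g (e : R), C0 r g -> 0 < e -> exists2 dl : R, 0 < dl &
    forall h, C0 r h -> (forall y, y \in `[0, r] -> `|g y - h y| < dl%:C) ->
    forall x, x \in `[0, r] -> `|T g x - T h x| < e%:C.
Proof.
split=> [/subspace_continuousP cT g e cg e0|cT].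
  have TgP : nbhs (T g : {uniform` `[0, r] -> R[i]^o})
      [set k | forall x : R, x \in `[0, r] -> `|T g x - k x| < e%:C].
    apply/uniform_nbhs; exists [set ab | `|ab.1 - ab.2| < e%:C]; split=> //.
    by apply/entourage_complexP; exists e.
  have /uniform_nbhs[E [/entourage_complexP[dl dl0 dlE] EP]] := cT g cg _ TgP.
  exists dl => // h ch gh; apply: (EP h _ ch) => y yK.
  by apply: dlE; exact: gh.
apply/subspace_continuousP => g cg P /uniform_nbhs[E [/entourage_complexP[e e0 eE] EP]].
have [dl dl0 cont] := cT g e cg e0.
apply/uniform_nbhs; exists [set ab | `|ab.1 - ab.2| < dl%:C]; split.
  by apply/entourage_complexP; exists dl.
move=> h gh ch; apply: EP => x xK; apply: eE.
exact: (cont h ch).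
Qed.

Lemma C0_operator_continuous T : C0_operator r T ->
  {within (C0 r : set {uniform` `[0, r] -> R[i]^o}), continuous
    (T : {uniform` `[0, r] -> R[i]^o} -> {uniform` `[0, r] -> R[i]^o})}.
Proof.
move=> [pT linT [K K0 bT]]; apply/uniform_continuousP => g e cg e0.
have K20 : 0 < K + K by rewrite addr_gt0.
exists (e / (K + K)); first by rewrite divr_gt0.
move=> h ch gh x xK; rewrite -(linear_onB linT cg ch xK).
apply: (@le_lt_trans _ _ (K * (e / (K + K)))%:C).
  by apply: (bT _ _ (C0B cg ch) _ x xK) => y yK; exact/ltW/gh.
rewrite ltcR mulrCA gtr_pMr // ltr_pdivrMr // mul1r ltrDl //.
Qed.

Lemma antideriv_iterX p n (x : R) : x \in `[0, r] ->
  iter p (@antiderivC R) (fun y => y%:C ^+ n) x =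
  x%:C ^+ (n + p) / \prod_(1 <= j < p.+1) (n + j)%:R.
Proof.
have opJ p' : C0_operator r (iter p' (@antiderivC R)).
  elim: p' => [|p' IH]; first exact: C0_operator_id.
  exact: (C0_operator_comp (C0_operator_antiderivC r0) IH).
have cX m : C0 r (fun y => y%:C ^+ m) by apply: C0X; exact: C0_id.
elim: p x => [|p IH] x xK; first by rewrite addn0 big_geq // divr1.
have [pJ _ _] := opJ p.
pose c : R[i] := (\prod_(1 <= j < p.+1) (n + j)%:R)^-1.
have opA := C0_operator_antiderivC r0.
rewrite iterS (@C0_operator_eq R r _ _ (fun y => c * y%:C ^+ (n + p)) x opA (pJ _ (cX n)) _ _ xK).
  have [_ linA _] := opA; rewrite (linear_onZ c linA (cX _) xK).
  have x0 : 0 <= x by move: xK; rewrite in_itv => /andP[].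
  by rewrite antiderivCX // big_nat_recr //= invfM addnS; exact: mulrCA.
- by apply: C0M (cX _); exact: C0_cst.
- by move=> y yK; rewrite IH // mulrC.
Qed.

(** The p-fold iterate of integration from 0 meets the specification, so the operator picked by
    [xget] meets it too. *)
Lemma IopP p : is_Iop r p (Iop r p).
Proof.
apply: (xgetPex (id : (R -> R[i]) -> R -> R[i])).
exists (iter p (@antiderivC R)).
have op : C0_operator r (iter p (@antiderivC R)).
  elim: p => [|p IH]; first exact: C0_operator_id.
  exact: (C0_operator_comp (C0_operator_antiderivC r0) IH).
split; first by case: op.
- by case: op.
- exact: C0_operator_continuous.
- by move=> n x xK; exact: antideriv_iterX.
Qed.

End IopExistence.

(** * Functional calculus *)

Section Spectral.
Variable R : realType.
Local Notation C := R[i].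

Lemma trace_mxfun n (g : C -> C) (A : 'M[C]_n) :
  \tr (mxfun g A) = \sum_i g (spectral_diag A 0 i).
Proof.
rewrite /mxfun -mulmxA mxtrace_mulC -mulmxA mulmxV ?spectral_unit // mulmx1.
by rewrite mxtrace_diag; apply: eq_bigr => i _; rewrite mxE.
Qed.

Lemma trace_expmx_spectral n (A : 'M[C]_n) k : A \is normalmx ->
  \tr (A ^+ k) = \sum_i spectral_diag A 0 i ^+ k.
Proof.
move=> /orthomx_spectralP e.
have Pu := spectral_unit A.
move: (spectralmx A) (spectral_diag A) e Pu => P X -> Pu.
have -> : (invmx P *m diag_mx X *m P) ^+ k =
    invmx P *m diag_mx (map_mx (fun x => x ^+ k) X) *m P.
  elim: k => [|k IH].
    rewrite expr0; have -> : map_mx (fun x : C => x ^+ 0) X = const_mx 1.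
      by apply/rowP => i; rewrite !mxE.
    by rewrite diag_const_mx mulmx1 mulVmx.
  rewrite exprS IH -mulmxE -!mulmxA; congr (_ *m _).
  rewrite [P *m _]mulmxA mulmxV // mul1mx mulmxA; congr (_ *m _).
  by rewrite mulmx_diag; congr diag_mx; apply/rowP => i; rewrite !mxE exprS.
rewrite -mulmxA mxtrace_mulC -mulmxA mulmxV // mulmx1 mxtrace_diag.
by apply: eq_bigr => i _; rewrite mxE.
Qed.

Lemma trace_horner_spectral n (A : 'M[C]_n) (q : {poly C}) : A \is normalmx ->
  \sum_(k < size q) q`_k * \tr (A ^+ k) = \sum_i q.[spectral_diag A 0 i].
Proof.
move=> nA; under eq_bigr => k _ do rewrite trace_expmx_spectral // mulr_sumr.
by rewrite exchange_big; apply: eq_bigr => i _; rewrite horner_coef.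
Qed.

Context (L N : nat) (d : 'rV[R]_N).
Local Notation T := (borelMx R N L).
Local Notation D := (stiefel R L N).

Lemma le_dmax i : d 0 i <= dmax d.
Proof. exact: le_bigmax. Qed.

Lemma dmin_le i : dmin d <= d 0 i.
Proof. exact: bigmin_le. Qed.

Lemma sandwich_adj (Phi : T) : (sandwich d Phi)^t* = sandwich d Phi.
Proof.
rewrite /sandwich; move: (Phi : 'M[C]_(N, L)) => W.
rewrite !trmx_mul !map_mxM trmxCK mulmxA; congr (_ *m _ *m _).
rewrite tr_diag_mx map_diag_mx; congr diag_mx; apply/rowP => i; rewrite !mxE.
by apply/eqP; rewrite eq_complex /= oppr0 !eqxx.
Qed.

Lemma sandwich_normal (Phi : T) : sandwich d Phi \is normalmx.
Proof. by apply/normalmxP; rewrite sandwich_adj. Qed.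

(* An eigenvalue is the barycentre of the d_j with weights |<v, Phi^* e_j>|^2
   for a unit eigenvector v. *)
Lemma spectral_diag_sandwich (Phi : T) : D Phi -> exists2 w : 'M[R]_(L, N),
  (forall i j, 0 <= w i j) /\ (forall i, \sum_j w i j = 1) &
  forall i, spectral_diag (sandwich d Phi) 0 i = (\sum_j w i j * d 0 j)%:C.
Proof.
move=> DPhi; have /orthomx_spectralP := sandwich_normal Phi.
have Pu := spectral_unitarymx (sandwich d Phi).
move: (spectralmx _) (spectral_diag _) Pu => P X Pu.
have /unitarymxP PP := Pu.
rewrite invmx_unitary // /sandwich.
have WW : (Phi : 'M[C]_(N, L))^t* *m (Phi : 'M[C]_(N, L)) = 1%:M := DPhi.
move: (Phi : 'M[C]_(N, L)) WW => W WW e.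
pose U := P *m W^t*.
have UU : U *m U^t* = 1%:M.
  by rewrite /U trmx_mul map_mxM trmxCK -mulmxA [_ *m (W *m _)]mulmxA WW mul1mx.
have eX : diag_mx X = U *m diag_mx (map_mx (fun x => x%:C) d) *m U^t*.
  rewrite /U trmx_mul map_mxM trmxCK.
  have := congr1 (fun M => P *m M *m P^t*) e.
  rewrite !mulmxA PP mul1mx -[_ *m P *m P^t*]mulmxA PP mulmx1 => <-.
  by [].
clearbody U.
have nU i j : U i j * (U i j)^* = (complex.Re (U i j) ^+ 2 + complex.Im (U i j) ^+ 2)%:C.
  case: (U i j) => a b; rewrite conjCE; apply/eqP; rewrite eq_complex /=.
  by apply/andP; split; apply/eqP; ring.
exists (\matrix_(i, j) (complex.Re (U i j) ^+ 2 + complex.Im (U i j) ^+ 2)).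
  split=> [i j|i]; first by rewrite mxE addr_ge0 ?sqr_ge0.
  have /matrixP/(_ i i) := UU; rewrite !mxE eqxx mulr1n => e1.
  apply: (@complexI R); rewrite rmorph_sum -[RHS]e1 /=.
  by apply: eq_bigr => j _; rewrite !mxE nU.
move=> i; have /matrixP/(_ i i) := eX; rewrite !mxE eqxx mulr1n => ->.
rewrite rmorph_sum; apply: eq_bigr => j _.
rewrite mul_mx_diag !mxE mulrAC nU.
by rewrite [RHS]rmorphM.
Qed.

(** A weighted mean of the d_j lies between their extremes; the functional calculus therefore
    evaluates [f] only where it agrees with its extension [F]. *)
Lemma spectral_diag_sandwich_bound (Phi : T) i : D Phi ->
  exists2 x : R, x \in `[dmin d, dmax d] & spectral_diag (sandwich d Phi) 0 i = x%:C.
Proof.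
move=> /spectral_diag_sandwich[w [w0 w1] ->].
exists (\sum_j w i j * d 0 j) => //; rewrite in_itv /=; apply/andP; split.
  rewrite -[leLHS]mul1r -(w1 i) mulr_suml; apply: ler_sum => j _.
  by rewrite ler_wpM2l // dmin_le.
rewrite -[leRHS]mul1r -(w1 i) mulr_suml; apply: ler_sum => j _.
by rewrite ler_wpM2l // le_dmax.
Qed.

End Spectral.

(** * Passage to the limit *)

Lemma complex_close_eq (R : realType) (a b : R[i]) :
  (forall e : R, 0 < e -> `|a - b| <= e%:C) -> a = b.
Proof.
move=> ab; apply/eqP; rewrite -subr_eq0 -normr_eq0 normc_def.
set n := Num.sqrt _.
have : 0 <= n by exact: sqrtr_ge0.
rewrite le_eqVlt => /predU1P[<-|n0]; first by rewrite eqxx.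
have n2 : 0 < n / 2 by rewrite divr_gt0.
have := ab _ n2; rewrite normc_def lecR -/n leNgt.
by rewrite gtr_pMr // invf_lt1 ?ltr1n.
Qed.

Section UniformLimit.
Context (dd : measure_display) (T : measurableType dd) (R : realType).
Variables (D : set T).

(** The trace of f(Phi^* D Phi) rests on a pointwise choice of eigenbasis; its measurability is
    obtained as that of a uniform limit of polynomial traces. *)
Lemma bmeas_lim (h : T -> R) :
  (forall e : R, 0 < e -> exists2 g, bmeas D g & forall x, D x -> `|h x - g x| <= e) ->
  bmeas D h.
Proof.
move=> approx.
have ne (n : nat) : 0 < n.+1%:R^-1 :> R by rewrite invr_gt0 ltr0n.
have approxn (n : nat) : exists g, bmeas D g /\
    forall x, D x -> `|h x - g x| <= n.+1%:R^-1.
  by have [g bg hg] := approx _ (ne n); exists g.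
have [g gP] := choice approxn.
split.
  apply: (@measurable_fun_cvg _ _ _ _ g) => [n|x Dx]; first by case: (gP n) => -[].
  apply/cvgrPdist_lt => e e0.
  near=> n; have [_ /(_ x Dx)] := gP n; move=> /le_lt_trans; apply.
  near: n; exact: (near_infty_natSinv_lt (PosNum e0)).
have [[_ [M gM]] hg] := gP 0%N.
exists (M + 1) => x Dx; rewrite -[h x](subrK (g 0%N x)) addrC.
rewrite (le_trans (ler_normD _ _)) // lerD ?gM //.
by rewrite (le_trans (hg x Dx)) // invr1.
Unshelve. all: by end_near.
Qed.

Lemma bmeasC_lim (h : T -> R[i]) :
  (forall e : R, 0 < e -> exists2 g, bmeasC D g &
    forall x, D x -> `|h x - g x| <= e%:C) -> bmeasC D h.
Proof.
move=> approx; split; apply: bmeas_lim => e e0; have [g [g1 g2] hg] := approx e e0.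
  exists (fun x => complex.Re (g x)) => // x Dx; have := norm_Re_le (hg x Dx).
  by case: (h x) (g x) => [? ?] [? ?].
exists (fun x => complex.Im (g x)) => // x Dx; have := norm_Im_le (hg x Dx).
by case: (h x) (g x) => [? ?] [? ?].
Qed.

End UniformLimit.

(** * Continuity of both sides and their equality on polynomials *)

Section Approximation.
Context (R : realType) (L N : nat) (hL : (1 <= L)%N) (hLN : (L <= N)%N).
Variables (mu : probability (borelMx R N L) R) (mu_iso : isotropic mu).
Local Notation T := (borelMx R N L).
Local Notation D := (stiefel R L N).
Local Notation E := (Cintegral mu D).
Variables (d : 'rV[R]_N) (r : R).
Hypotheses (d_gt0 : forall i, 0 < d 0 i) (Delta_neq0 : \det (Delta d) != 0).
Hypotheses (hr : dmax d <= r).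
Let muD : mu D = 1%E := proj1 mu_iso.
Let mD := @measurable_stiefel R L N.
Let r_gt0 : 0 < r.
Proof.
apply: lt_le_trans (d_gt0 (Ordinal (leq_trans hL hLN))) _.
exact: le_trans (le_dmax d _) hr.
Qed.

Lemma d_in0r i : d 0 i \in `[0, r].
Proof. by rewrite in_itv /= (ltW (d_gt0 i)) (le_trans (le_dmax d i) hr). Qed.

Lemma spectrum_in0r (x : R) : x \in `[dmin d, dmax d] -> x \in `[0, r].
Proof.
rewrite !in_itv /= => /andP[x1 x2]; rewrite (le_trans x2 hr) andbT.
apply: le_trans x1; apply: le_bigmin => [|i _]; last exact: ltW.
exact: bigmax_ge_id.
Qed.

Definition det_weight (k : 'I_L) (j : 'I_N) : R[i] :=
  (N - k.+1)`!%:R / (L - k.+1)`!%:R *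
  (cofactor (Delta d) (widen_ord hLN k) j / \det (Delta d)).

Definition det_sum (F : R -> R[i]) : R[i] :=
  \sum_(k < L) ((N - k.+1)`!%:R / (L - k.+1)`!%:R) *
    (\det (Gmx L r d F k) / \det (Delta d)).

Lemma det_sumE F : det_sum F = \sum_(k < L) \sum_j det_weight k j *
  Iop r (N - L) (fun x => x%:C ^+ (L - k.+1) * F x) (d 0 j).
Proof.
apply: eq_bigr => k _.
have -> : Gmx L r d F k = setrow (widen_ord hLN k)
    (\row_j Iop r (N - L) (fun x => x%:C ^+ (L - k.+1) * F x) (d 0 j)) (Delta d).
  apply/matrixP => i j; rewrite [LHS]mxE [RHS]mxE -val_eqE /=.
  by case: ifP => _ //; rewrite mxE.
rewrite det_setrow mulr_suml mulr_sumr; apply: eq_bigr => j _.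
rewrite mxE /det_weight; move: (Iop _ _ _ _) (cofactor _ _ _) => x c.
by rewrite -!mulrA; congr (_ * (_ * _)); rewrite mulrCA [x * _]mulrC.
Qed.

Lemma linear_on_sum (op : (R -> R[i]) -> R -> R[i]) n (c : nat -> R[i])
    (g : nat -> R -> R[i]) (x : R) :
  linear_on r op -> (forall k, C0 r (g k)) -> x \in `[0, r] ->
  op (fun y => \sum_(k < n) c k * g k y) x = \sum_(k < n) c k * op (g k) x.
Proof.
move=> linop cg xK.
have csum m : C0 r (fun y => \sum_(k < m) c k * g k y).
  elim: m => [|m IH].
    rewrite (_ : (fun _ => _) = fun=> 0); first exact: C0_cst.
    by apply/funext => y; rewrite big_ord0.
  rewrite (_ : (fun _ => _) = fun y => \sum_(k < m) c k * g k y + c m * g m y).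
    apply: C0D (IH) _; apply: C0M (cg m); exact: C0_cst.
  by apply/funext => y; rewrite big_ord_recr.
elim: n => [|n IH].
  rewrite big_ord0 (_ : (fun _ => _) = fun=> 0); first exact: linear_on0 linop xK.
  by apply/funext => y; rewrite big_ord0.
rewrite big_ord_recr /= -IH addrC.
apply: etrans (linop (c n) (g n) _ (cg n) (csum n) x xK).
by congr (op _ x); apply/funext => y; rewrite big_ord_recr addrC.
Qed.

(** Both sides are linear in [q], and on monomials the specification of [Iop] produces
    [monomial_row]. *)
Lemma det_sum_horner (q : {poly R[i]}) : det_sum (fun x => q.[x%:C]) =
  \sum_(n < size q) q`_n * E (fun Phi => \tr (sandwich d Phi ^+ n)).
Proof.
under [RHS]eq_bigr => n _ do rewrite (E_trace_sandwichX hL hLN mu_iso Delta_neq0).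
rewrite det_sumE.
under [RHS]eq_bigr => n _ do rewrite mulr_sumr.
rewrite [RHS]exchange_big; apply: eq_bigr => k _.
transitivity (\sum_j \sum_(n < size q)
    det_weight k j * (q`_n * monomial_row L d k n 0 j)).
  apply: eq_bigr => j _; rewrite -mulr_sumr; congr (_ * _).
  have [_ linI _ IX] := IopP r_gt0 (N - L).
  rewrite (_ : (fun x => _) = fun x : R => \sum_(n < size q) q`_n * x%:C ^+ (L - k.+1 + n)).
    apply: etrans (@linear_on_sum (Iop r (N - L)) (size q) (fun n => q`_n)
      (fun n x => x%:C ^+ (L - k.+1 + n)) (d 0 j) linI _ (d_in0r j)) _.
      by move=> m; apply: C0X; exact: C0_id.
    by apply: eq_bigr => n _; rewrite IX ?d_in0r // !mxE.
  apply/funext => x; rewrite horner_coef mulr_sumr; apply: eq_bigr => n _.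
  by rewrite mulrCA exprD.
rewrite exchange_big; apply: eq_bigr => n _ /=.
rewrite det_setrow mulr_suml !mulr_sumr; apply: eq_bigr => j _.
rewrite /det_weight; move: (monomial_row _ _ _ _ _ _) (cofactor _ _ _) => x c.
move: (_ / (L - _)`!%:R) (\det _)^-1 q`_n => a b e.
by ring.
Qed.

(** By [det_sumE] this is a finite weighted sum of values of [Iop], so it inherits the continuity of
    that operator; multiplication by x^(L-k-1) costs at most a factor r^(L-k-1). *)
Lemma det_sum_continuous F (e : R) : C0 r F -> 0 < e -> exists2 dl : R, 0 < dl &
  forall G, C0 r G -> (forall x, x \in `[0, r] -> `|F x - G x| <= dl%:C) ->
  `|det_sum F - det_sum G| <= e%:C.
Proof.
move=> cF e0.
pose W := \sum_(k < L) \sum_j complex.Re `|det_weight k j|.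
have W0 : 0 <= W.
  apply: sumr_ge0 => k _; apply: sumr_ge0 => j _.
  by rewrite normc_def /= sqrtr_ge0.
(* Adding 1 to the total weight makes it a positive divisor. *)
have W10 : 0 < W + 1 by rewrite ltr_wpDl.
have eW : 0 < e / (W + 1) by rewrite divr_gt0.
pose P (k : 'I_L) (dl : R) := forall G, C0 r G ->
  (forall x, x \in `[0, r] -> `|F x - G x| <= dl%:C) -> forall j,
  `|Iop r (N - L) (fun x => x%:C ^+ (L - k.+1) * F x) (d 0 j) -
    Iop r (N - L) (fun x => x%:C ^+ (L - k.+1) * G x) (d 0 j)| <= (e / (W + 1))%:C.
have cX k : C0 r (fun x => x%:C ^+ k) by apply: C0X; exact: C0_id.
(* A common [dl] exists because there are finitely many k. *)
have Pnear : \forall dl \near 0^'+, forall k, P k dl.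
  apply: filter_forall => k.
  have [_ _ /uniform_continuousP contI _] := IopP r_gt0 (N - L).
  have [dl dl0 h] := contI _ (e / (W + 1)) (C0M (cX (L - k.+1)%N) cF) eW.
  near=> t => G cG FG j; apply/ltW/h; [exact: C0M (cX _) cG| |exact: d_in0r].
  move=> y yK; rewrite -mulrBr normrM.
  have ry : `|y%:C ^+ (L - k.+1)| <= (r ^+ (L - k.+1))%:C :> R[i].
    move: yK; rewrite in_itv /= => /andP[y0 yr].
    rewrite normrX rmorphXn lerXn2r ?nnegrE ?normr_ge0 //.
      by rewrite lecR ltW.
    by rewrite ger0_norm ?lecR // ler0c.
  apply: (@le_lt_trans _ _ (r ^+ (L - k.+1) * t)%:C).
    by rewrite rmorphM ler_pM ?normr_ge0 //; exact: FG.
  rewrite ltcR mulrC -ltr_pdivlMr ?exprn_gt0 //.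
  by near: t; apply: nbhs_right_lt; rewrite divr_gt0 ?exprn_gt0.
near (0:R)^'+ => dl; exists dl; first by near: dl; exact: nbhs_right_gt.
have PP : forall k, P k dl by near: dl.
move=> G cG FG; rewrite !det_sumE -sumrB.
under eq_bigr => k _ do rewrite -sumrB.
apply: (@le_trans _ _ (W * (e / (W + 1)))%:C); last first.
  by rewrite lecR mulrCA ger_pMr // ler_pdivrMr // mul1r lerDl.
rewrite rmorphM rmorph_sum mulr_suml.
apply: (le_trans (ler_norm_sum _ _ _)); apply: ler_sum => k _.
rewrite rmorph_sum mulr_suml.
apply: (le_trans (ler_norm_sum _ _ _)); apply: ler_sum => j _.
rewrite -mulrBr normrM ler_pM ?normr_ge0 //; last exact: PP.
Unshelve. all: by end_near.
Qed.

Lemma trace_sandwichX_bmeasC n : bmeasC D (fun Phi => \tr (sandwich d Phi ^+ n)).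
Proof.
apply: bmeasC_trace; elim: n => [|n IH] i j.
  apply: (@bmeasC_ext _ _ _ _ (fun=> (i == j)%:R : R[i]) _ _ (bmeasC_cst _ _)) => Phi.
  by rewrite expr0 mxE.
apply: (@bmeasC_ext _ _ _ _ (fun Phi => (sandwich d Phi *m sandwich d Phi ^+ n) i j)).
  by move=> Phi; rewrite exprS.
apply: bmeasC_mulmx => // k l.
apply: bmeasC_mulmx => [k' l'|]; last exact: coord_bmeasC.
apply: bmeasC_mulmx => [|u v]; first exact: adj_coord_bmeasC.
exact: bmeasC_cst.
Qed.

Lemma trace_horner_bmeasC (q : {poly R[i]}) :
  bmeasC D (fun Phi => \sum_(k < size q) q`_k * \tr (sandwich d Phi ^+ k)).
Proof. by apply: bmeasC_sum => k _; apply: bmeasCZ; exact: trace_sandwichX_bmeasC. Qed.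

Lemma E_trace_horner (q : {poly R[i]}) :
  E (fun Phi => \sum_(k < size q) q`_k * \tr (sandwich d Phi ^+ k)) =
  det_sum (fun x => q.[x%:C]).
Proof.
rewrite det_sum_horner (EC_sum mD muD) => [|k _]; last first.
  by apply: bmeasCZ; exact: trace_sandwichX_bmeasC.
apply: eq_bigr => k _; apply: (EC_scale mD muD); exact: trace_sandwichX_bmeasC.
Qed.

Lemma trace_mxfun_close (f F : R -> R[i]) (q : {poly R[i]}) (dl : R) (Phi : T) :
  (forall x : R, x \in `[dmin d, dmax d] -> F x = f x) ->
  (forall x : R, x \in `[0, r] -> `|F x - q.[x%:C]| <= dl%:C) -> D Phi ->
  `|\tr (mxfun (fun z => f (complex.Re z)) (sandwich d Phi)) -
    \sum_(k < size q) q`_k * \tr (sandwich d Phi ^+ k)| <= (L%:R * dl)%:C.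
Proof.
move=> Ff Fq DPhi; rewrite trace_mxfun trace_horner_spectral ?sandwich_normal //.
rewrite -sumrB (le_trans (ler_norm_sum _ _ _)) //.
apply: (@le_trans _ _ (\sum_(i < L) dl%:C)).
  apply: ler_sum => i _; have [x xK ->] := spectral_diag_sandwich_bound d i DPhi.
  by rewrite /= -Ff // Fq // spectrum_in0r.
by rewrite sumr_const card_ord mulr_natl rmorphMn.
Qed.

End Approximation.

(** The function [f] matters only on the interval spanned by the d_i, while [Iop] acts on functions
    on [0, r]; hence the continuous extension [F]. The left side does not involve [F], so the right
    side is the same for all extensions. The condition on [Delta] says that the d_i are distinct. *)
Theorem theorem1 (R : realType) (L N : nat) (hL : (1 <= L)%N) (hLN : (L <= N)%N)
    (d : 'rV[R]_N) (d_gt0 : forall i, 0 < d 0 i)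
    (Delta_neq0 : \det (Delta d) != 0)
    (mu : probability (borelMx R N L) R) (mu_isotropic : isotropic mu)
    (f : R -> R[i])
    (f_cont : {within `[dmin d, dmax d], continuous (f : R -> R[i]^o)})
    (r : R) (hr : dmax d <= r)
    (F : R -> R[i]) (F_cont : C0 r F)
    (F_ext : forall x : R, x \in `[dmin d, dmax d] -> F x = f x) :
  Cintegral mu (stiefel R L N)
    (fun Phi : 'M[R[i]]_(N, L) =>
       \tr (mxfun (fun z => f (complex.Re z))
              (Phi^t* *m diag_mx (map_mx (fun x => x%:C) d) *m Phi))) =
  \sum_(k < L) ((N - k.+1)`!%:R / (L - k.+1)`!%:R) *
               (\det (Gmx L r d F k) / \det (Delta d)).
Proof.
have muD : mu (stiefel R L N) = 1%E := proj1 mu_isotropic.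
have mD := @measurable_stiefel R L N.
have r_gt0 : 0 < r.
  apply: lt_le_trans (d_gt0 (Ordinal (leq_trans hL hLN))) _.
  exact: le_trans (le_dmax d _) hr.
have L_gt0 : 0 < L%:R :> R by rewrite ltr0n.
pose h (Phi : borelMx R N L) :=
  \tr (mxfun (fun z => f (complex.Re z)) (sandwich d Phi)).
have approx (e : R) : 0 < e -> exists q : {poly R[i]},
    (forall x : R, x \in `[0, r] -> `|F x - q.[x%:C]| <= e%:C) /\
    forall Phi, stiefel R L N Phi ->
      `|h Phi - \sum_(k < size q) q`_k * \tr (sandwich d Phi ^+ k)| <= (L%:R * e)%:C.
  move=> e0; have [q Fq] := weierstrassC r_gt0 F_cont e0.
  by exists q; split=> // Phi DPhi; exact: (trace_mxfun_close d_gt0 hr F_ext Fq DPhi).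
have bh : bmeasC (stiefel R L N) h.
  apply: bmeasC_lim => e e0; have e'0 : 0 < e / L%:R by rewrite divr_gt0.
  have [q [_ hq]] := approx _ e'0.
  exists (fun Phi => \sum_(k < size q) q`_k * \tr (sandwich d Phi ^+ k)).
    exact: trace_horner_bmeasC.
  by move=> Phi /hq; rewrite mulrC divfK // gt_eqF.
change (Cintegral mu (stiefel R L N) h = det_sum L d r F).
apply: complex_close_eq => e e0.
have e20 : 0 < e / 2 by rewrite divr_gt0.
have [dl dl0 rhsF] := det_sum_continuous hL hLN d_gt0 hr F_cont e20.
(* The L eigenvalues and the factor 2 of [norm_EC_le] turn e / (4 L) into e / 2; [dl] takes care of
   the determinants. *)
pose t := Num.min dl (e / 4 / L%:R).
have t0 : 0 < t by rewrite lt_min dl0 !divr_gt0.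
have [q [Fq hq]] := approx t t0.
have det_close : `|det_sum L d r F - det_sum L d r (fun x => q.[x%:C])| <= (e / 2)%:C.
  apply: rhsF; first exact: C0_horner.
  by move=> x xK; apply: le_trans (Fq x xK) _; rewrite lecR ge_min lexx.
have E_close : `|Cintegral mu (stiefel R L N) h - det_sum L d r (fun x => q.[x%:C])| <=
    (e / 2)%:C.
  rewrite -(E_trace_horner hL hLN mu_isotropic d_gt0 Delta_neq0 hr).
  rewrite -(EC_sub mD muD bh (trace_horner_bmeasC L d q)).
  have -> : e / 2 = e / 4 + e / 4 by field.
  apply: (norm_EC_le mD muD (bmeasCB bh (trace_horner_bmeasC L d q))) => Phi DPhi.
  apply: le_trans (hq Phi DPhi) _.
  by rewrite lecR mulrC -ler_pdivlMr // ge_min lexx orbT.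
have -> : e%:C = (e / 2)%:C + (e / 2)%:C :> R[i] by rewrite -rmorphD -splitr.
apply: le_trans (ler_distD (det_sum L d r (fun x => q.[x%:C])) _ _) _.
by apply: lerD; [exact: E_close|rewrite distrC; exact: det_close].
Qed.
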